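(* For every continuous proper function $F:X_3\to[0,\infty)$ there exists $T>0$ such that $(T,\infty)\subset\mathcal{L}_F(3)$, where $$\mathcal{L}_F(3)=\Big\{\limsup_{t\to\infty}F(g_th_x\mathbb{Z}^3):x\in\mathbb{R}^2\Big\}.$$
   Context: $X_3=\mathrm{SL}_3(\mathbb{R})/\mathrm{SL}_3(\mathbb{Z})$ is the space of unimodular lattices in $\mathbb{R}^3$ (the class of $g$ is identified with the lattice $g\mathbb{Z}^3$). The flow $g_t=\operatorname{diag}(e^{-2t},e^t,e^t)$, $t\in\mathbb{R}$, acts on $X_3$ by left multiplication. For a column vector $x\in\mathbb{R}^2$, $h_x=\begin{pmatrix}1&0\\-x&I_2\end{pmatrix}\in\mathrm{SL}_3(\mathbb{R})$ (in $1+2$ block form). A continuous proper function $F:X_3\to[0,\infty)$ is called a height function. *)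

(* Defs.v *)
From HB Require Import structures.
From mathcomp Require Import all_boot all_order all_algebra.
From mathcomp Require Import all_classical all_reals all_analysis.
From mathcomp Require Import ring.
Import Order.TTheory GRing.Theory Num.Theory.
Import numFieldNormedType.Exports.

Set Implicit Arguments.
Unset Strict Implicit.
Unset Printing Implicit Defensive.

Local Open Scope ring_scope.
Local Open Scope classical_set_scope.
Local Open Scope quotient_scope.

Section SpecialLinear.
Variables (n : nat) (A : comUnitRingType).

Record SL := MkSL { SLval :> 'M[A]_n ; SLdet : \det SLval == 1 }.

HB.instance Definition _ := [isSub for SLval].
HB.instance Definition _ := [Choice of SL by <:].

Lemma SL_unitmx (g : SL) : (g : 'M[A]_n) \in unitmx.
Proof. by rewrite unitmxE (eqP (SLdet g)) unitr1. Qed.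

Fact SL_one_subproof : \det (1%:M : 'M[A]_n) == 1.
Proof. by rewrite det1. Qed.

Fact SL_mul_subproof (g h : SL) : \det (g *m h) == 1.
Proof. by rewrite det_mulmx (eqP (SLdet g)) (eqP (SLdet h)) mulr1. Qed.

Fact SL_inv_subproof (g : SL) : \det (invmx g) == 1.
Proof. by rewrite det_inv (eqP (SLdet g)) invr1. Qed.

Definition SL_one := MkSL SL_one_subproof.
Definition SL_mul g h := MkSL (SL_mul_subproof g h).
Definition SL_inv g := MkSL (SL_inv_subproof g).

Fact SL_mulA : associative SL_mul.
Proof. by move=> g h k; apply: val_inj; exact: mulmxA. Qed.

Fact SL_mul1 : left_id SL_one SL_mul.
Proof. by move=> g; apply: val_inj; exact: mul1mx. Qed.

Fact SL_1mul : right_id SL_one SL_mul.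
Proof. by move=> g; apply: val_inj; exact: mulmx1. Qed.

Fact SL_mulV : left_inverse SL_one SL_inv SL_mul.
Proof. by move=> g; apply: val_inj; exact: mulVmx (SL_unitmx g). Qed.

Fact SL_Vmul : right_inverse SL_one SL_inv SL_mul.
Proof. by move=> g; apply: val_inj; exact: mulmxV (SL_unitmx g). Qed.

HB.instance Definition _ :=
  isGroup.Build SL SL_mulA SL_mul1 SL_1mul SL_mulV SL_Vmul.

End SpecialLinear.

HB.instance Definition _ (n : nat) (R : realType) :=
  Topological.copy (SL n R) (initial_topology (@SLval n R)).

Section SpaceOfLattices.
Variables (n : nat) (R : realType).

Fact SL_of_int_subproof (k : SL n int) :
  \det (map_mx (intr : int -> R) k) == 1.
Proof. by rewrite det_map_mx (eqP (SLdet k)) rmorph1. Qed.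

Definition SL_of_int (k : SL n int) : SL n R := MkSL (SL_of_int_subproof k).

Definition SLZ : set (SL n R) := range SL_of_int.

Definition SLZ_rel (g h : SL n R) : bool := `[< SLZ (g^-1 * h)%g >].

Fact SL_of_int1 : SL_of_int 1%g = 1%g.
Proof. by apply: val_inj; exact: map_mx1. Qed.

Fact SL_of_intM : {morph SL_of_int : k l / (k * l)%g}.
Proof. by move=> k l; apply: val_inj; exact: map_mxM. Qed.

Fact SLZ_1 : SLZ 1%g.
Proof. by exists 1%g => //; exact: SL_of_int1. Qed.

Fact SLZ_V g : SLZ g -> SLZ g^-1%g.
Proof.
case=> k _ <-; exists k^-1%g => //; apply: (mulIg (SL_of_int k)).
by rewrite -SL_of_intM !mulVg SL_of_int1.
Qed.

Fact SLZ_M g h : SLZ g -> SLZ h -> SLZ (g * h)%g.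
Proof. by case=> k _ <- [l _ <-]; exists (k * l)%g => //; exact: SL_of_intM. Qed.

Fact SLZ_rel_equiv : equiv_class_of SLZ_rel.
Proof.
split=> [g | g h | h g k].
- by apply/asboolP; rewrite mulVg; exact: SLZ_1.
- by apply/asboolP/asboolP => /SLZ_V; rewrite invgM invgK.
- move=> /asboolP gh /asboolP hk; apply/asboolP.
  by have := SLZ_M gh hk; rewrite -mulgA mulVKg.
Qed.

Definition SLZ_equiv := EquivRelPack SLZ_rel_equiv.

(* SL_n(R) / SL_n(Z), by left cosets, with the quotient topology. *)
Definition lattice_space := quotient_topology {eq_quot SLZ_equiv}.
HB.instance Definition _ := Topological.on lattice_space.
HB.instance Definition _ := Quotient.on lattice_space.

(* The class of g, identified with the lattice g Z^n. *)
Definition lattice (g : SL n R) : lattice_space := \pi_lattice_space g.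

Lemma lattice_eqP (g h : SL n R) :
  lattice g = lattice h <-> SLZ (g^-1 * h)%g.
Proof.
split=> [/(eqmodP SLZ_equiv)/asboolP //|gh].
exact/(eqmodP SLZ_equiv)/asboolP.
Qed.

End SpaceOfLattices.

Section Flow.
Variable R : realType.

Fact flow_subproof (t : R) :
  \det (diag_mx (\row_(i < 3) if i == 0 then expR (- (2 * t)) else expR t)) == 1.
Proof.
rewrite det_diag !big_ord_recl big_ord0 !mxE /= mulr1 -!expRD.
by rewrite (_ : _ + _ = 0) ?expR0 //; ring.
Qed.

Definition flow (t : R) : SL 3 R := MkSL (flow_subproof t).

Fact horo_subproof (x : 'cV[R]_2) :
  \det (block_mx (1%:M : 'M[R]_1) 0 (- x) 1%:M) == 1.
Proof. by rewrite det_lblock !det1 mulr1. Qed.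

Definition horo (x : 'cV[R]_2) : SL 3 R := MkSL (horo_subproof x).

Definition height_function (F : lattice_space 3 R -> R) : Prop :=
  [/\ continuous F, forall L, 0 <= F L
    & forall K : set R, compact K -> compact (F @^-1` K)].

(* The limsup is taken in \bar R since it may be +oo. *)
Definition limsup_spectrum (F : lattice_space 3 R -> R) : set (\bar R) :=
  range (fun x : 'cV[R]_2 =>
    limf_esup (fun t : R => (F (lattice (flow t * horo x)%g))%:E) +oo).

End Flow.

(* Main.v *)
Require Import Defs.
From mathcomp Require Import all_boot all_order all_algebra.
From mathcomp Require Import all_classical all_reals all_analysis.
From mathcomp Require Import ring lra.
Import Order.TTheory GRing.Theory Num.Theory.
Import numFieldNormedType.Exports.

(** The flow g_t expands the last two coordinates at the same rate, so that it commutes with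
    the matrices n of SL_2(R) acting on them: a bounded orbit of the flow may be displaced
    by any such n, and the height along it then varies with n. The proof builds a point x
    whose orbit follows, forever, displaced copies of a single homoclinic orbit, and steers
    the displacements so that the supremum of the heights is s in the limit.

    The ring Z[x] / (x^3 - x^2 - 1), embedded in R x C = R^3, is a lattice g Z^3 on which
    multiplication by the unit 1/x acts, up to a rotation of the complex line, as a time of
    the flow (cubic_return). As that rotation has infinite order (cubic_irrational), its
    powers are dense among the rotations. A unipotent integer matrix yields another element
    of the stabilizer of the lattice. Its triangular factorization (upper_factor) gives a
    horospherical translate of g Z^3 whose orbit is asymptotic to that of g Z^3 in the past,
    and in the future to the orbit of g Z^3 displaced by a fixed matrix D of SL_2(R), called
    kick (homoclinic_past, homoclinic_future); D is triangular, with diagonal entries mu and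
    1/mu for some 0 < mu < 1 (cubic_kick).

    Excursions can be concatenated. An orbit close to that of g Z^3 displaced by n may stay
    there for k periods, which turns the displacement into e = n R^k, then make an excursion
    along the homoclinic orbit displaced by e, and be left close to the orbit of g Z^3
    displaced by e D. This costs a change of x that is exponentially small in time
    (step_heights), so that infinitely many excursions converge to a point x (chain_limsup).
    Up to errors tending to 0, the largest height during the excursion is E e (edge_max), a
    continuous function of e. By density of the R^k one moves from n to n rho D, for an
    arbitrary rotation rho, at the price E (n rho).

    Since D is not a rotation, products of D with rotations reach every element of SL_2(R)
    up to rotations (rot_word, attainable_any). There is moreover a rotation for which
    W = D rho has square -1 (quarter_turn), and from m one can therefore go to m D, then
    to m W D, which is m times a rotation, and start again; the two excursions cost
    E m and E (m W). Small deviations are corrected by two further excursions (two_turns),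
    whose costs are close to E (m rho') and E (m rho' W) for some rotations rho'. So if

        E (m rho') <= s and E (m rho' W) <= s for all rotations rho',

    with equality for one of the two when rho' = 1, some orbit has limit superior
    exactly s (steering_limsup).

    Such an m exists for all large s (target_exists). Let Phi(n) be the supremum over rho'
    of max (E (n rho'), E (n rho' W)), called star_height. It is continuous, and unbounded
    along the path diag(e^-v, e^v), because a rotation followed by a strong contraction
    makes some vector of some displaced lattice of the orbit short, and the height is proper
    (star_height_unbounded). By the intermediate value theorem Phi takes every value s
    above Phi(1), and rotating a point where it does gives m. *)

Set Implicit Arguments.
Unset Strict Implicit.
Unset Printing Implicit Defensive.

Local Open Scope ring_scope.
Local Open Scope classical_set_scope.

(** * Norms and compactness of matrices *)

Section MatrixNorm.
Variable R : realType.

Lemma mx_norm_le m n (A : 'M[R]_(m, n)) r :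
  0 <= r -> (forall i j, `|A i j| <= r) -> `|A| <= r.
Proof.
move=> r0 h; rewrite -[`|A|]/(mx_norm A) mx_normrE.
by apply/bigmax_leP; split => // -[i j] _; exact: h.
Qed.

Lemma le_mx_norm m n (A : 'M[R]_(m, n)) i j : `|A i j| <= `|A|.
Proof.
rewrite -[`|A|]/(mx_norm A) mx_normrE.
by apply/bigmax_geP; right; exists (i, j).
Qed.

Lemma normM_le m n p (A : 'M[R]_(m, n)) (B : 'M[R]_(n, p)) :
  `|A *m B| <= n%:R * (`|A| * `|B|).
Proof.
apply: mx_norm_le => [|i j]; first by rewrite !mulr_ge0.
have -> : n%:R * (`|A| * `|B|) = \sum_(k < n) (`|A| * `|B|).
  by rewrite sumr_const card_ord mulr_natl.
rewrite mxE (le_trans (ler_norm_sum _ _ _))//.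
by apply: ler_sum => k _; rewrite normrM ler_pM// le_mx_norm.
Qed.

Lemma ball_matrix_compact n (r : R) : compact [set A : 'M[R]_n | `|A| <= r].
Proof.
have vecc : continuous (@vec_mx R n n : 'rV[R]_(n * n) -> 'M[R]_n).
  move=> v; apply: (iffRL (@cvgrPdist_le _ _ _ _ (nbhs_filter v) _ _)) => e e0.
  have : \forall w \near v, `|v - w| <= e.
    by apply/nbhs_ballP; exists e => //= w; rewrite mx_norm_ball => /ltW.
  apply: filterS => w vw; rewrite -linearB/=; apply: mx_norm_le; first exact: ltW.
  by move=> i j; rewrite mxE (le_trans (le_mx_norm _ _ _)).
have -> : [set A : 'M[R]_n | `|A| <= r]
    = vec_mx @` [set v : 'rV[R]_(n * n) | `|v| <= r].
  apply/seteqP; split => [A /= Ar|A /= [v vr <-]].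
    exists (mxvec A); rewrite ?mxvecK//=.
    apply: mx_norm_le => [|i j]; first exact: le_trans Ar.
    by case/mxvec_indexP : j => k l; rewrite ord1 mxvecE (le_trans (le_mx_norm _ _ _)).
  apply: mx_norm_le => [|i j]; first exact: le_trans vr.
  by rewrite mxE (le_trans (le_mx_norm _ _ _)).
apply: continuous_compact; first exact: continuous_subspaceT.
apply: bounded_closed_compact.
  exists r; split; first exact: num_real.
  by move=> x rx v /= /le_trans; apply; exact: ltW.
apply: (@closed_comp _ _ (fun v : 'rV[R]_(n * n) => `|v|) [set x | x <= r]).
  by move=> v _; exact: norm_continuous.
exact: closed_le.
Qed.

End MatrixNorm.

(** * Height functions as functions of matrices *)

Section MatrixFunctions.
Variables (R : realType) (f : 'M[R]_3 -> R).

Definition intmx m n (B : 'M[int]_(m, n)) : 'M[R]_(m, n) := map_mx intr B.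

(** The four properties of a height function used below, for the function of matrices of
    determinant 1 that it induces. *)
Definition lattice_invariant := forall A (C : 'M[int]_3),
  \det A = 1 -> \det C = 1 -> f (A *m intmx C) = f A.

Definition unif_continuous_on_balls := forall r e : R, 0 < e ->
  exists2 d : R, 0 < d & forall A B, \det A = 1 -> \det B = 1 ->
    `|A| <= r -> `|A - B| < d -> `|f A - f B| < e.

Definition bounded_on_balls := forall r : R, exists b, forall A,
  \det A = 1 -> `|A| <= r -> f A <= b.

(** What properness gives by the easy direction of Mahler's criterion, that lattices with
    arbitrarily short vectors do not stay in a compact set. *)
Definition proper_on_lattices := forall s : R, exists2 e : R, 0 < e &
  forall A (v : 'cV[int]_3),
    \det A = 1 -> v != 0 -> `|A *m intmx v| < e -> s < f A.

End MatrixFunctions.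

Section Height.
Variables (R : realType) (F : lattice_space 3 R -> R).
Local Notation intmx := (intmx R).

(** A total map, with a default value on the matrices of determinant other than 1, so that
    heights apply to products of matrices without proofs about their determinants. *)
Definition to_SL (A : 'M[R]_3) : SL 3 R := insubd (1%g : SL 3 R) A.

Definition hgt (A : 'M[R]_3) : R := F (lattice (to_SL A)).

Lemma SLval_to_SL A : \det A = 1 -> SLval (to_SL A) = A.
Proof. by move=> dA; rewrite /to_SL val_insubd dA eqxx. Qed.

Lemma hgt_lattice_invariant : lattice_invariant hgt.
Proof.
move=> A C dA dC; congr F; apply/esym/lattice_eqP.
have dC' : \det C == 1 by apply/eqP.
exists (MkSL dC') => //; apply: (mulgI (to_SL A)); rewrite mulVKg.
apply: val_inj => /=; rewrite !SLval_to_SL//.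
by rewrite det_mulmx dA mul1r det_map_mx dC.
Qed.

Hypothesis hF : height_function F.

Lemma det_mx_continuous n : continuous (fun A : 'M[R]_n => \det A).
Proof.
move=> A; rewrite /determinant.
apply: (@cvg_big _ _ _ _ _ add_continuous _ _ _ _ _ (nbhs_filter A)) => s _.
apply: (cvgM (FF := nbhs_filter A)); first exact: cvg_cst.
apply: (@cvg_big _ _ _ _ _ mul_continuous _ _ _ _ _ (nbhs_filter A)) => i _.
exact: coord_continuous.
Qed.

Lemma hgt_continuous A e : \det A = 1 -> 0 < e -> exists2 d, 0 < d &
  forall B, \det B = 1 -> `|A - B| < d -> `|hgt A - hgt B| < e.
Proof.
move=> dA e0; have [cF _ _] := hF.
have : nbhs (to_SL A) [set h | `|F (lattice (to_SL A)) - F (lattice h)| < e].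
  have : {for to_SL A, continuous (F \o @lattice 3 R)}.
    apply: continuous_comp; last exact: cF.
    exact: pi_continuous.
  by move/cvgrPdist_lt; exact.
rewrite nbhsE => -[U [[V oV <-] /= VA] VU].
have /nbhs_ballP[d d0 dV] : nbhs A V.
  by move: oV; rewrite openE; apply; rewrite -[A]SLval_to_SL.
exists d => // B dB AB; apply: VU => /=; apply: dV.
by rewrite SLval_to_SL// mx_norm_ball.
Qed.

(** Heine's theorem on the compact set of matrices of determinant 1 and norm at most r,
    in a slightly stronger form: the nearby matrix may lie outside that set. *)
Lemma hgt_unif_continuous : unif_continuous_on_balls hgt.
Proof.
move=> r e e0; have e20 : 0 < e / 2 by rewrite divr_gt0.
pose K := [set A : 'M[R]_3 | `|A| <= r] `&` [set A | \det A = 1].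
have cK : compact K.
  apply: compact_closedI; first exact: ball_matrix_compact.
  apply: (@closed_comp _ _ (fun A : 'M[R]_3 => \det A) [set x | x = 1]).
    by move=> A _; exact: det_mx_continuous.
  exact: closed_eq.
pose Q d A := forall B, \det A = 1 -> \det B = 1 -> `|A - B| < d ->
    `|hgt A - hgt B| < e.
have : \forall d \near 0^'+, K `<=` Q d.
  move/compact_near_coveringP : cK; apply => A [_ /= dA].
  have [d d0 dP] := hgt_continuous dA e20.
  have d20 : 0 < d / 2 by rewrite divr_gt0.
  exists (ball A (d / 2), [set x | x < d / 2]) => /=.
    by split; [exact: nbhsx_ballx|exact: nbhs_right_lt].
  move=> [A' d'] /= []; rewrite mx_norm_ball /= => AA' d'd B dA' dB A'B.
  rewrite -(subrKA (hgt A)) (le_lt_trans (ler_normD _ _))// (splitr e) ltrD//.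
    rewrite distrC; apply: dP => //; apply: lt_trans AA' _.
    by rewrite ltr_pdivrMr// ltr_pMr// ltr1n.
  apply: dP => //; rewrite -(subrKA A') (le_lt_trans (ler_normD _ _))//.
  by rewrite (splitr d) ltrD// (lt_trans A'B).
case=> d /= d0 dP; exists (d / 2); first by rewrite divr_gt0.
move=> A B dA dB Ar AB; apply: (dP (d / 2)) => //=.
- by rewrite sub0r normrN gtr0_norm ?divr_gt0// ltr_pdivrMr// ltr_pMr// ltr1n.
- by rewrite divr_gt0.
Qed.

Lemma hgt_bounded : bounded_on_balls hgt.
Proof.
move=> r.
pose K := [set A : 'M[R]_3 | `|A| <= r] `&` [set A | \det A = 1].
have cK : compact K.
  apply: compact_closedI; first exact: ball_matrix_compact.
  apply: (@closed_comp _ _ (fun A : 'M[R]_3 => \det A) [set x | x = 1]).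
    by move=> A _; exact: det_mx_continuous.
  exact: closed_eq.
pose Q b A := \det A = 1 -> hgt A <= b.
have : \forall b \near +oo, K `<=` Q b.
  move/compact_near_coveringP : cK; apply => A [_ /= dA].
  have [d d0 dP] := hgt_continuous dA ltr01.
  exists (ball A d, [set x | hgt A + 1 < x]) => /=.
    by split; [exact: nbhsx_ballx|apply: nbhs_pinfty_gt; exact: num_real].
  move=> [A' b] /= []; rewrite mx_norm_ball /= => AA' bA dA'.
  have := dP _ dA' AA'; rewrite ltr_distlC => /andP[_ /ltW]; move/le_trans; apply.
  exact: ltW.
case=> b [_ bP]; exists (b + 1) => A dA Ar.
by apply: (bP (b + 1)) => //; rewrite ltrDl.
Qed.

(** Nonzero integer vectors have norm at least 1, and A^-1 expands norms by a bounded
    factor. *)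
Lemma intmx_lower_bound (A : 'M[R]_3) : \det A = 1 ->
  exists2 e, 0 < e & forall v : 'cV[int]_3, v != 0 -> e <= `|A *m intmx v|.
Proof.
move=> dA; have uA : A \in unitmx by rewrite unitmxE dA unitr1.
pose M := 3 * (`|invmx A| + 1).
have M0 : 0 < M by rewrite mulr_gt0// ltr_wpDl.
exists M^-1; first by rewrite invr_gt0.
move=> v v0; rewrite -[X in _ <= X]mul1r -ler_pdivrMr ?normr_gt0; last first.
  apply: contra v0 => /eqP Av; have : intmx v = 0.
    by rewrite -[intmx v](mulKmx uA) Av mulmx0.
  move/matrixP => h; apply/eqP/matrixP => i j; have := h i j.
  by rewrite !mxE => /eqP; rewrite intr_eq0 => /eqP.
rewrite -invfM invf_le1 ?mulr_gt0// ?normr_gt0; last first.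
  apply: contra v0 => /eqP Av; have : intmx v = 0.
    by rewrite -[intmx v](mulKmx uA) Av mulmx0.
  move/matrixP => h; apply/eqP/matrixP => i j; have := h i j.
  by rewrite !mxE => /eqP; rewrite intr_eq0 => /eqP.
have /matrix0Pn[i [j vij]] : v != 0 by [].
have : 1 <= `|intmx v|.
  apply: le_trans (le_mx_norm _ i j); rewrite mxE -intr_norm ler1z.
  by rewrite -gtz0_ge1 normr_gt0.
move=> /le_trans; apply; rewrite -{1}[intmx v](mulKmx uA).
rewrite (le_trans (normM_le _ _))// /M -mulrA ler_wpM2l// ler_wpM2r// lerDl.
exact: ler01.
Qed.

Lemma lattice_surj (L : lattice_space 3 R) : exists g, lattice g = L.
Proof. by exists (repr L); exact: reprK. Qed.

(** Lattices whose nonzero vectors all have norm bounded below by some constant larger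
    than e. The strict margin makes this set open, and these sets exhaust the space as e
    tends to 0. *)
Let wide e : set (lattice_space 3 R) := [set L | exists2 e', e < e' &
  forall g, lattice g = L -> forall v : 'cV[int]_3, v != 0 ->
    e' <= `|SLval g *m intmx v|].

Let wideE e g : wide e (lattice g) <-> exists2 e', e < e' &
  forall v : 'cV[int]_3, v != 0 -> e' <= `|SLval g *m intmx v|.
Proof.
split=> -[e' ee' h]; exists e' => //; first by move=> v; exact: h.
move=> k /lattice_eqP[C _ kC] v v0.
have -> : SLval k = SLval g *m intmx (SLval C)^-1.
  apply: (can_inj (mulmxK (SL_unitmx (SL_of_int R C)))) => /=.
  rewrite -mulmxA -[map_mx _ _]/(intmx (SLval C)) -map_mxM mulVmx ?SL_unitmx//.
  rewrite map_mx1 mulmx1.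
  have -> : intmx (SLval C) = SLval (SL_of_int R C) by [].
  by rewrite kC -[LHS]/(SLval (k * (k^-1 * g))%g) mulVKg.
rewrite -mulmxA -map_mxM; apply: h.
apply: contra v0 => /eqP Cv.
by rewrite -(mulKVmx (SL_unitmx C) v) Cv mulmx0.
Qed.

Let wide_open e : 0 < e -> open (wide e).
Proof.
move=> e0; suff : open (@lattice 3 R @^-1` wide e) by [].
rewrite openE => g /wideE[e' ee' h].
have uA : SLval g \in unitmx by exact: SL_unitmx.
(* The factor 9 is the product of two factors 3, one for each product of 3x3 matrices;
   adding 1 to the norm makes M positive. *)
pose M := 9 * (`|invmx (SLval g)| + 1).
have M0 : 0 < M by rewrite mulr_gt0// ltr_wpDl.
have e'0 : 0 < e' by exact: lt_trans ee'.
pose d := (1 - e / e') / (2 * M).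
have q1 : 0 < 1 - e / e' by rewrite subr_gt0 ltr_pdivrMr// mul1r.
have d0 : 0 < d by rewrite divr_gt0// mulr_gt0.
have oB : open [set B : 'M[R]_3 | `|SLval g - B| < d].
  rewrite openE => B /= gB; apply/nbhs_ballP.
  exists (d - `|SLval g - B|) => /=; first by rewrite subr_gt0.
  move=> C; rewrite mx_norm_ball /= ltrBrDr => BC.
  by rewrite -(subrKA B) (le_lt_trans (ler_normD _ _))// addrC.
rewrite /interior nbhsE /=; exists (@SLval _ R @^-1` [set B | `|SLval g - B| < d]).
  by split; [exists [set B : 'M[R]_3 | `|SLval g - B| < d]|rewrite /= subrr normr0].
move=> k /= gk; apply/wideE; exists (e' * (1 - M * d)).
  rewrite /d invfM mulrCA [M * _]mulrCA divff ?gt_eqF// mulr1.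
  have -> : e' * (1 - (1 - e / e') / 2) = (e + e') / 2.
    by field; rewrite gt_eqF.
  by rewrite midf_lt.
move=> v v0; have := h v v0; set a := _ *m _ => ea.
have -> : SLval k *m intmx v = a - (SLval g - SLval k) *m intmx v.
  by rewrite mulmxBl opprB addrC subrK.
rewrite (le_trans _ (lerB_dist _ _))// (@le_trans _ _ (`|a| * (1 - M * d)))//.
  rewrite ler_wpM2r// subr_ge0 /d invfM mulrCA [M * _]mulrCA divff ?gt_eqF// mulr1.
  have : 0 <= e / e' by rewrite divr_ge0// ltW.
  by lra.
rewrite mulrBr mulr1 lerB// (le_trans (normM_le _ _))//.
have -> : `|intmx v| = `|invmx (SLval g) *m a| by rewrite mulKmx.
rewrite (@le_trans _ _ (3 * (d * (3 * (`|invmx (SLval g)| * `|a|)))))//.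
  apply: ler_wpM2l => //; apply: ler_pM => //; first exact: ltW.
  exact: normM_le.
have xd : 0 <= `|a| * d by rewrite mulr_ge0// ltW.
have ring9 (x y z : R) : z * (9 * (x + 1) * y) - 3 * (y * (3 * (x * z))) = 9 * (z * y).
  by ring.
by rewrite /M -subr_ge0 ring9 mulr_ge0.
Qed.

(** The lattices of height at most s form a compact set, covered by the increasing open
    sets wide e, hence contained in one of them. *)
Lemma hgt_proper : proper_on_lattices hgt.
Proof.
move=> s.
have [_ F0 pF] := hF.
have cK := pF _ (@segment_compact R 0 s).
have : \forall e \near 0^'+, F @^-1` `[0, s] `<=` wide e.
  move/compact_near_coveringP : cK; apply => L _.
  have [g gL] := lattice_surj L.
  have [e e0 eP] := intmx_lower_bound (eqP (SLdet g)).
  have e20 : 0 < e / 2 by rewrite divr_gt0.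
  exists (wide (e / 2), [set x | x < e / 2]) => /=.
    split; last exact: nbhs_right_lt.
    apply: open_nbhs_nbhs; split; first exact: wide_open.
    rewrite -gL; apply/wideE; exists e => //.
    by rewrite ltr_pdivrMr// ltr_pMr// ltr1n.
  move=> [L' e'] /= [[x ex h] ee']; exists x => //; exact: lt_trans ex.
case=> d /= d0 dP; exists (d / 2); first by rewrite divr_gt0.
move=> A v dA v0 Av; rewrite ltNge; apply/negP => As.
have : wide (d / 2) (lattice (to_SL A)).
  apply: dP => /=; last by rewrite in_itv/= F0.
  - by rewrite sub0r normrN gtr0_norm ?divr_gt0// ltr_pdivrMr// ltr_pMr// ltr1n.
  - by rewrite divr_gt0.
case/wideE => e' de' /(_ v v0); rewrite SLval_to_SL// leNgt => /negP; apply.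
exact: lt_trans de'.
Qed.

End Height.

(** * Rotations and matrices of the plane *)

Section PlaneMatrices.
Variable R : realType.
Implicit Types (a b c d x y : R) (A B : 'M[R]_2).

Definition mx2 a b c d : 'M[R]_2 := \matrix_(i, j)
  if i == 0 then if j == 0 then a else b else if j == 0 then c else d.

Lemma mx2P A : A = mx2 (A 0 0) (A 0 1) (A 1 0) (A 1 1).
Proof.
apply/matrixP => i j; rewrite mxE.
by case: i => -[|[|//]] i2; case: j => -[|[|//]] j2 /=;
  congr (A _ _); apply: val_inj.
Qed.

Lemma mx2_00 a b c d : mx2 a b c d 0 0 = a. Proof. by rewrite mxE. Qed.
Lemma mx2_01 a b c d : mx2 a b c d 0 1 = b. Proof. by rewrite mxE. Qed.
Lemma mx2_10 a b c d : mx2 a b c d 1 0 = c. Proof. by rewrite mxE. Qed.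
Lemma mx2_11 a b c d : mx2 a b c d 1 1 = d. Proof. by rewrite mxE. Qed.
Definition mx2E := (mx2_00, mx2_01, mx2_10, mx2_11).

Lemma mx2M a b c d a' b' c' d' : mx2 a b c d *m mx2 a' b' c' d' =
  mx2 (a * a' + b * c') (a * b' + b * d') (c * a' + d * c') (c * b' + d * d').
Proof.
apply/matrixP => i j; rewrite !mxE big_ord_recl big_ord1 !mxE/=.
by case: i => -[|[|//]] i2; case: j => -[|[|//]] j2.
Qed.

Lemma mx2N a b c d : - mx2 a b c d = mx2 (- a) (- b) (- c) (- d).
Proof.
apply/matrixP => i j; rewrite !mxE.
by case: i => -[|[|//]] i2; case: j => -[|[|//]] j2.
Qed.

Lemma mx2_1 : 1%:M = mx2 1 0 0 1.
Proof.
apply/matrixP => i j; rewrite !mxE.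
by case: i => -[|[|//]] i2; case: j => -[|[|//]] j2.
Qed.

Lemma det_mx2 a b c d : \det (mx2 a b c d) = a * d - b * c.
Proof.
rewrite (expand_det_row _ 0) big_ord_recl big_ord1 /cofactor !det_mx11 !mxE/=.
by rewrite expr0 expr1 mul1r mulN1r mulrN.
Qed.

Lemma mx2_norm_le a b c d r : 0 <= r -> `|a| <= r -> `|b| <= r -> `|c| <= r ->
  `|d| <= r -> `|mx2 a b c d| <= r.
Proof.
move=> *; apply: mx_norm_le => // i j; rewrite mxE.
by case: ifP; case: ifP.
Qed.

Definition rotmx x : 'M[R]_2 := mx2 (cos x) (- sin x) (sin x) (cos x).

Lemma rotmxD x y : rotmx (x + y) = rotmx x *m rotmx y.
Proof. by rewrite /rotmx mx2M cosD sinD; congr mx2; ring. Qed.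

Lemma rotmx0 : rotmx 0 = 1%:M.
Proof. by rewrite /rotmx cos0 sin0 oppr0 -mx2_1. Qed.

Lemma rotmxNK x : rotmx (- x) *m rotmx x = 1%:M.
Proof. by rewrite -rotmxD addNr rotmx0. Qed.

Lemma rotmxKN x : rotmx x *m rotmx (- x) = 1%:M.
Proof. by rewrite -rotmxD subrr rotmx0. Qed.

Lemma rotmxDpi x : rotmx (x + pi) = - rotmx x.
Proof. by rewrite /rotmx cosDpi sinDpi mx2N. Qed.

Lemma rotmxX x k : rotmx x ^+ k = rotmx (k%:R * x).
Proof.
elim: k => [|k IH]; first by rewrite expr0 mul0r rotmx0.
by rewrite exprS IH -natr1 mulrDl mul1r addrC rotmxD.
Qed.

Lemma det_rotmx x : \det (rotmx x) = 1.
Proof. by rewrite det_mx2 -(cos2Dsin2 x); ring. Qed.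

Lemma norm_rotmx_le1 x : `|rotmx x| <= 1.
Proof.
by apply: mx2_norm_le; rewrite ?normrN ?ler_norml ?cos_le1 ?sin_le1 ?cos_geN1 ?sin_geN1.
Qed.

(** Continuity is only ever needed entrywise, for one real parameter. *)
Definition entry_continuous m n (M : R -> 'M[R]_(m, n)) :=
  forall i j, continuous (fun x => M x i j).

Lemma entry_continuousM m n p (M : R -> 'M[R]_(m, n)) (N : R -> 'M[R]_(n, p)) :
  entry_continuous M -> entry_continuous N ->
  entry_continuous (fun x => M x *m N x).
Proof.
move=> cM cN i j x.
have -> : (fun x => (M x *m N x) i j) = (fun x => \sum_k M x i k * N x k j).
  by apply/funext => y; rewrite mxE.
by apply: cvg_big => [|k _]; [exact: add_continuous|apply: cvgM; [exact: cM|exact: cN]].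
Qed.

Lemma entry_continuous_cst m n (M : 'M[R]_(m, n)) : entry_continuous (fun=> M).
Proof. by move=> i j x; exact: cvg_cst. Qed.

Lemma entry_continuousX n (M : R -> 'M[R]_n.+1) k :
  entry_continuous M -> entry_continuous (fun x => M x ^+ k).
Proof.
move=> cM; elim: k => [|k IH]; first exact: entry_continuous_cst.
have -> : (fun x => M x ^+ k.+1) = (fun x => M x *m M x ^+ k).
  by apply/funext => x; rewrite exprS.
exact: entry_continuousM.
Qed.

Lemma entry_continuous_rotmx : entry_continuous rotmx.
Proof.
move=> i j x; have -> : (fun x => rotmx x i j) = (fun x =>
   if i == 0 then if j == 0 then cos x else - sin x
   else if j == 0 then sin x else cos x) by apply/funext => y; rewrite mxE.
case: (i == 0); case: (j == 0); try exact: continuous_cos; try exact: continuous_sin.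
by apply: cvgN; exact: continuous_sin.
Qed.

Lemma entry_continuous_norm m n (M : R -> 'M[R]_(m, n)) x e :
  entry_continuous M -> 0 < e -> \forall y \near x, `|M x - M y| < e.
Proof.
move=> cM e0; have e20 : 0 < e / 2 by rewrite divr_gt0.
have H : forall i j, \forall y \near x, `|M x i j - M y i j| <= e / 2.
  by move=> i j; move: (cM i j x) => /cvgrPdist_le; exact.
have {}H : nbhs x [set y | forall ij, `|M x ij.1 ij.2 - M y ij.1 ij.2| <= e / 2].
  apply: (@filter_forall R ('I_m * 'I_n)%type
    (fun ij => [set y | `|M x ij.1 ij.2 - M y ij.1 ij.2| <= e / 2])
    (nbhs x) (nbhs_filter x)) => -[i j].
  exact: H.
apply: filterS H => y h; apply: (@le_lt_trans _ _ (e / 2)).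
  by apply: mx_norm_le => [|i j]; [exact: ltW|rewrite !mxE; exact: (h (i, j))].
by rewrite ltr_pdivrMr// ltr_pMr// ltr1n.
Qed.

Lemma polar x y : x ^+ 2 + y ^+ 2 = 1 ->
  exists2 t, - pi <= t <= pi & x = cos t /\ y = sin t.
Proof.
move=> xy; have x1 : -1 <= x <= 1.
  by rewrite -ler_norml -(@ler_pXn2r _ 2)// ?nnegrE// expr1n real_normK ?num_real//
    -xy lerDl sqr_ge0.
have [a0 api] := (acos_ge0 x1, acos_lepi x1).
have sy : sin (acos x) = `|y|.
  by rewrite sin_acos// -xy addrAC subrr add0r sqrtr_sqr.
have ca : cos (acos x) = x by rewrite acosK// in_itv.
have p0 := pi_ge0 R.
have [y0|y0] := leP 0 y.
  by exists (acos x); [lra|rewrite ca sy ger0_norm].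
by exists (- acos x); [lra|rewrite cosN sinN ca sy ltr0_norm// opprK].
Qed.

(** Rotations form a compact family, although their angles range over all of R. *)
Lemma rot_reduce x : exists2 t, - pi <= t <= pi & rotmx x = rotmx t.
Proof.
have [t tpi [ct st]] := polar (cos2Dsin2 x).
by exists t => //; rewrite /rotmx ct st.
Qed.

Lemma rotate_vector (x y x' y' : R) : x ^+ 2 + y ^+ 2 = x' ^+ 2 + y' ^+ 2 ->
  exists t, x = cos t * x' - sin t * y' /\ y = sin t * x' + cos t * y'.
Proof.
move=> h; have [e0|n0] := eqVneq (x' ^+ 2 + y' ^+ 2) 0.
  have [x0 y0] : x = 0 /\ y = 0.
    by split; apply/eqP; rewrite -sqrf_eq0; apply/eqP; nra.
  have [x'0 y'0] : x' = 0 /\ y' = 0.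
    by split; apply/eqP; rewrite -sqrf_eq0; apply/eqP; nra.
  by exists 0; rewrite x0 y0 x'0 y'0; split; ring.
pose r := x' ^+ 2 + y' ^+ 2.
have [|t _ [ct st]] := @polar ((x * x' + y * y') / r) ((y * x' - x * y') / r).
  have -> : ((x * x' + y * y') / r) ^+ 2 + ((y * x' - x * y') / r) ^+ 2
    = (x ^+ 2 + y ^+ 2) / r by rewrite /r; field.
  by rewrite h divff.
by exists t; rewrite -ct -st /r; split; field.
Qed.

(** The square of the Frobenius norm, chosen because rotations on either side preserve
    it. *)
Definition frob A : R := A 0 0 ^+ 2 + A 0 1 ^+ 2 + A 1 0 ^+ 2 + A 1 1 ^+ 2.

(** Writing a real 2x2 matrix as z |-> p z + q conj(z), left and right rotations
    turn the complex numbers p and q independently; determinant and Frobenius norm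
    give |p|^2 - |q|^2 and |p|^2 + |q|^2. *)
Lemma rot_equivalent A B : \det A = \det B -> frob A = frob B ->
  exists s t, A = rotmx s *m B *m rotmx t.
Proof.
rewrite (mx2P A) (mx2P B); move: (A 0 0) (A 0 1) (A 1 0) (A 1 1) => a b c d.
move: (B 0 0) (B 0 1) (B 1 0) (B 1 1) => a' b' c' d'.
rewrite !det_mx2 /frob !mx2E => hd hf.
have [|u [u1 u2]] := @rotate_vector (a + d) (c - b) (a' + d') (c' - b'); first by nra.
have [|v [v1 v2]] := @rotate_vector (a - d) (c + b) (a' - d') (c' + b'); first by nra.
pose s := (u + v) / 2; pose t := (u - v) / 2.
have hu : u = s + t by rewrite /s /t; field.
have hv : v = s - t by rewrite /s /t; field.
exists s, t; rewrite /rotmx !mx2M.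
move: u1 u2 v1 v2; rewrite hu hv cosD sinD cosB sinB.
move: (cos s) (sin s) (cos t) (sin t) => cs ss ct st u1 u2 v1 v2.
by congr mx2; lra.
Qed.

(** The excess over 2 ad - 2 bc is (a - d)^2 + (b + c)^2. *)
Lemma frob_ge2 A : \det A = 1 -> 2 <= frob A.
Proof.
rewrite (mx2P A); move: (A 0 0) (A 0 1) (A 1 0) (A 1 1) => a b c d.
by rewrite det_mx2 /frob !mx2E; have := sqr_ge0 (a - d); have := sqr_ge0 (b + c); nra.
Qed.

End PlaneMatrices.

(** * Density of irrational rotations *)

Section RotationDensity.
Variables (R : realType) (theta : R).
Hypothesis irr : forall k (l : int), (0 < k)%N -> k%:R * theta != l%:~R * (2 * pi).

Lemma rot_periodic (x : R) (l : int) : rotmx (x + l%:~R * (2 * pi)) = rotmx x.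
Proof.
have H (y : R) n : rotmx (y + n%:R * (2 * pi)) = rotmx y.
  elim: n => [|n IH]; first by rewrite mul0r addr0.
  have -> : y + n.+1%:R * (2 * pi) = y + n%:R * (2 * pi) + pi + pi.
    by rewrite -natr1; ring.
  by rewrite !rotmxDpi opprK.
case: l => n; first exact: H.
by rewrite NegzE mulrNz mulNr -(@H (x - _) n.+1) subrK.
Qed.

(** The distances to 0 of the multiples k theta on the circle have infimum 0: were it
    positive, a multiple x with distance close to the infimum would come back, after one
    turn, closer to 0 than the infimum, since 2 pi lies between two consecutive multiples
    of x. *)
Lemma small_return (d : R) : 0 < d ->
  exists k (l : int), (0 < k)%N /\ 0 < `|k%:R * theta - l%:~R * (2 * pi)| < d.
Proof.
move=> d0; have p0 : 0 < 2 * pi :> R by rewrite mulr_gt0// pi_gt0.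
pose S := [set x : R | exists k (l : int), (0 < k)%N /\
  x = `|k%:R * theta - l%:~R * (2 * pi)|].
have S0 : lbound S 0 by move=> x [k [l [_ ->]]].
pose l1 := Num.floor (theta / (2 * pi)).
pose x1 := `|1%:R * theta - l1%:~R * (2 * pi)|.
have Sx1 : S x1 by exists 1%N, l1.
have hS : has_inf S by split; [exists x1|exists 0].
have x1lt : x1 < 2 * pi.
  have := floor_itv (theta / (2 * pi)); rewrite -/l1 => /andP[].
  rewrite ler_pdivlMr// ltr_pdivrMr// intrD => h1 h2.
  by rewrite /x1 ger0_norm; lra.
have c0 : 0 <= inf S by apply: lb_le_inf => //; exists x1.
have clt : inf S < 2 * pi by apply: le_lt_trans x1lt; apply: ge_inf => //; exists 0.
have [cd|dc] := ltP (inf S) d.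
  have e0 : 0 < d - inf S by rewrite subr_gt0.
  have [_ [k [l [k0 ->]]] h] := inf_adherent e0 hS.
  exists k, l; split => //; rewrite normr_gt0 subr_eq0 irr//=.
  by move: h; rewrite addrCA subrr addr0.
have c1 : 0 < inf S by exact: lt_le_trans dc.
pose e := Num.min (inf S / 2) (2 * pi - inf S).
have e0 : 0 < e by rewrite lt_min divr_gt0//= subr_gt0.
have [x Sx] := inf_adherent e0 hS; rewrite -ltrBlDl lt_min => /andP[xc xp].
have cx : inf S <= x by apply: ge_inf => //; exists 0.
have x0 : 0 < x by exact: lt_le_trans cx.
pose q := Num.trunc (2 * pi / x).
have /truncn_itv : 0 <= 2 * pi / x by rewrite divr_ge0// ltW.
rewrite -/q ler_pdivlMr// ltr_pdivrMr// => /andP[q1 q2].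
have q0 : (0 < q)%N by rewrite truncn_gt0 ler_pdivlMr// mul1r; lra.
have key j : (0 < j)%N -> S `|j%:R * x - 2 * pi|.
  move=> j0; case: Sx => k [l [k0 xE]].
  have [s0|s0] := leP 0 (k%:R * theta - l%:~R * (2 * pi)).
    exists (j * k)%N, (j%:Z * l + 1); split; first by rewrite muln_gt0 j0.
    by rewrite xE (ger0_norm s0) natrM intrD intrM; congr `|_|; ring.
  exists (j * k)%N, (j%:Z * l - 1); split; first by rewrite muln_gt0 j0.
  rewrite xE (ltr0_norm s0) natrM intrB intrM -normrN; congr `|_|; ring.
have hj j : (0 < j)%N -> inf S <= `|j%:R * x - 2 * pi|.
  by move=> j0; apply: ge_inf; [exists 0|exact: key].
have := hj _ q0; rewrite ler0_norm ?subr_le0// => h1.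
have p2 : 0 <= q.+1%:R * x - 2 * pi by rewrite subr_ge0 ltW.
have := hj q.+1 isT; rewrite (ger0_norm p2) -natr1 => h2.
by lra.
Qed.

(** The multiples of a small nonzero return x sweep the circle with steps smaller than the
    tolerance; going around it many times first makes the exponent at least K. *)
Lemma rotmx_dense (phi d : R) K : 0 < d ->
  exists2 k, (K <= k)%N & `|rotmx theta ^+ k - rotmx phi| < d.
Proof.
move=> d0; have := @entry_continuous_norm R _ _ _ phi d (@entry_continuous_rotmx R) d0.
case/nbhs_ballP => e /= e0 eP.
have [k [l [k0 /andP[x0 xe]]]] := small_return e0.
set x := _ - _ in x0 xe.
have p0 : 0 < 2 * pi :> R by rewrite mulr_gt0// pi_gt0.
suff [j [l' [jK h]]] : exists j (l' : int),
    (K <= j)%N /\ `|j%:R * x - (phi + l'%:~R * (2 * pi))| < e.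
  exists (j * k)%N; first by rewrite (leq_trans jK)// leq_pmulr.
  have -> : rotmx theta ^+ (j * k) = rotmx (j%:R * x - l'%:~R * (2 * pi)).
    rewrite rotmxX natrM -(rot_periodic _ (- (j%:Z * l + l'))) mulrNz intrD intrM.
    by congr rotmx; rewrite /x; ring.
  rewrite distrC; apply: (eP (j%:R * x - l'%:~R * (2 * pi))).
  by rewrite /ball/= distrC; move: h; rewrite opprD addrA addrAC.
(* The sign s covers the case of a return in the negative direction. *)
have main (y : R) : 0 < y -> y < e -> forall s : int, `|s| = 1 -> exists j (l' : int),
    (K <= j)%N /\ `|j%:R * y - s%:~R * (phi + l'%:~R * (2 * pi))| < e.
  move=> y0 ye s s1.
  pose L := (Num.trunc ((K%:R * y + `|phi|) / (2 * pi))).+1.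
  have hL : K%:R * y + `|phi| < L%:R * (2 * pi).
    by rewrite -ltr_pdivrMr//; exact: truncnS_gt.
  have sR : `|s%:~R| = 1 :> R by rewrite -intr_norm s1.
  pose z := s%:~R * phi + L%:R * (2 * pi).
  have hz : K%:R * y <= z.
    have : - (s%:~R * phi) <= `|phi|.
      by rewrite (le_trans (ler_norm _))// normrN normrM sR mul1r.
    by rewrite /z; lra.
  have z0 : 0 <= z by apply: le_trans hz; rewrite mulr_ge0// ltW.
  exists (Num.trunc (z / y)), (s * L%:Z); split.
    have zy : 0 <= z / y by rewrite divr_ge0// ltW.
    by rewrite truncn_ge_nat// ler_pdivlMr.
  have -> : s%:~R * (phi + (s * L%:Z)%:~R * (2 * pi)) = z.
    rewrite intrM mulrDr !mulrA -intrM.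
    have -> : s * s = 1 by rewrite -expr2 -(@real_normK _ s) ?num_real// s1.
    by rewrite mul1r /z -mulrA.
  have /truncn_itv : 0 <= z / y by rewrite divr_ge0// ltW.
  rewrite ler_pdivlMr// ltr_pdivrMr//; move: (Num.trunc (z / y)) => j /andP[h1 h2].
  by move: h2; rewrite -(natr1 j) => h2; rewrite ler0_norm; lra.
have [x1|x1] := leP 0 x.
  have [||j [l' [jK h]]] := main x _ _ 1 (normr1 _).
  - by rewrite -(ger0_norm x1).
  - by rewrite -(ger0_norm x1).
  by exists j, l'; split => //; move: h; rewrite mulr1z mul1r.
have [||j [l' [jK h]]] := main (- x) _ _ (-1) (normrN1 _).
- by rewrite oppr_gt0.
- by rewrite -(ltr0_norm x1).
exists j, l'; split => //; move: h; rewrite -normrN.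
by rewrite mulrN mulrN1z mulN1r opprD !opprK opprD.
Qed.

End RotationDensity.

(** * Products of a hyperbolic matrix with rotations *)

Section RotationWords.
Variables (R : realType) (mu beta : R).
Hypotheses (mu0 : 0 < mu) (mu1 : mu < 1).

Let D := mx2 mu beta 0 mu^-1.

Lemma upper_mx2X k : exists b, D ^+ k = mx2 (mu ^+ k) b 0 (mu ^- k).
Proof.
elim: k => [|k [b IH]]; first by exists 0; rewrite !expr0 invr1 [LHS]mx2_1.
exists (mu * b + beta * mu ^- k); rewrite exprS IH [LHS]mx2M.
by rewrite !exprS invfM; congr mx2; ring.
Qed.

(** A matrix of determinant 1 and trace 0 squares to -1, and the trace of D times a rotation
    is a combination of the cosine and the sine of the angle, which has a zero. *)
Lemma quarter_turn : exists phi, (D *m rotmx phi) ^+ 2 = - 1%:M.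
Proof.
pose t := mu + mu^-1.
have t0 : 0 < t by rewrite addr_gt0// invr_gt0.
pose r := Num.sqrt (beta ^+ 2 + t ^+ 2).
have r2 : r ^+ 2 = beta ^+ 2 + t ^+ 2.
  by rewrite sqr_sqrtr// addr_ge0// sqr_ge0.
have r0 : r != 0.
  by rewrite -sqrf_eq0 r2 gt_eqF// ltr_wpDl ?sqr_ge0// exprn_gt0.
have [|phi _ [cE sE]] := @polar R (- beta / r) (t / r).
  by rewrite !exprMn sqrrN -mulrDl exprVn r2 divff// -r2 sqrf_eq0.
have tr0 : (mu + mu^-1) * cos phi + beta * sin phi = 0.
  by rewrite -cE -sE -/t; ring.
exists phi; rewrite expr2 /rotmx [_ *m _]mx2M [LHS]mx2M mx2_1 mx2N.
have m1 : mu * mu^-1 = 1 by rewrite divff// gt_eqF.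
have := cos2Dsin2 phi; move: tr0 m1.
move: (cos phi) (sin phi) (mu^-1) => c s mi tr0 m1 cs.
have sE' : beta * s = - (mu + mi) * c by lra.
congr mx2.
- transitivity ((mu * c + beta * s) ^+ 2 + (- (mu * mi) * s ^+ 2 + (beta * s) * (mi * c))).
    by ring.
  rewrite sE' m1; transitivity (- (c ^+ 2 + s ^+ 2) + c ^+ 2 * (1 - mu * mi)); first by ring.
  by rewrite m1 cs; ring.
- transitivity ((mu * - s + beta * c) * ((mu + mi) * c + beta * s)); first by ring.
  by rewrite tr0 mulr0 oppr0.
- transitivity ((mi * s) * ((mu + mi) * c + beta * s)); first by ring.
  by rewrite tr0 mulr0 oppr0.
- transitivity (- (mu * mi) * s ^+ 2 + (beta * s) * (mi * c) + mi ^+ 2 * c ^+ 2).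
    by ring.
  rewrite sE' m1; transitivity (- (c ^+ 2 + s ^+ 2) + c ^+ 2 * (1 - mu * mi)); first by ring.
  by rewrite m1 cs; ring.
Qed.

Lemma frob_entry_continuous (M : R -> 'M[R]_2) :
  entry_continuous M -> continuous (fun v => frob (M v)).
Proof.
move=> cM v; rewrite /frob.
have sq i j : {for v, continuous (fun v => M v i j ^+ 2)}.
  apply: (@continuous_comp _ _ _ (fun v => M v i j) (fun x => x ^+ 2)); first exact: cM.
  exact: exprn_continuous.
by do 3?[apply: cvgD]; exact: sq.
Qed.

(** Turning the angle from the quarter turn to 0 lets the Frobenius norm of an even
    power of D times the rotation vary from its least possible value 2 to that of the
    power of D; matrices of equal norm differ by rotations. *)
Lemma rot_word K m : \det m = 1 -> frob m <= frob (D ^+ (2 * K)) ->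
  exists psi s t, m = rotmx s *m (D *m rotmx psi) ^+ (2 * K) *m rotmx t.
Proof.
move=> dm mK; have [phi phiE] := quarter_turn.
pose M v := (D *m rotmx (v * phi)) ^+ (2 * K).
have cM : entry_continuous M.
  apply: entry_continuousX; apply: entry_continuousM; first exact: entry_continuous_cst.
  move=> i j v; suff : {for v, continuous (fun v : R => rotmx (v * phi) i j)} by [].
  apply: (@continuous_comp R R R (fun v : R => v * phi) (fun x : R => rotmx x i j)).
    exact: mulrr_continuous.
  exact: entry_continuous_rotmx.
have f1 : frob (M 1) = 2.
  have -> : M 1 = (-1) ^+ K by rewrite /M mul1r exprM phiE.
  have I1 : frob (1%:M : 'M[R]_2) = 2 by rewrite mx2_1 /frob !mx2E; ring.
  have N1 : frob (- 1%:M : 'M[R]_2) = 2 by rewrite mx2_1 mx2N /frob !mx2E; ring.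
  by rewrite -signr_odd; case: (odd K); rewrite ?expr1 ?expr0.
have f0 : M 0 = D ^+ (2 * K) by rewrite /M mul0r rotmx0 mulmx1.
have [||v _ fv] := @IVT R (fun v => frob (M v)) 0 1 (frob m) ler01.
- by apply: continuous_subspaceT; exact: frob_entry_continuous.
- by rewrite f1 f0 ge_min le_max mK (frob_ge2 dm) orbT.
have dM : \det (M v) = 1.
  rewrite /M; elim: (2 * K)%N => [|k IH]; first by rewrite expr0 det1.
  by rewrite exprS [LHS]det_mulmx IH det_mulmx det_rotmx det_mx2 divff ?gt_eqF//; ring.
have [s [t h]] := rot_equivalent (etrans dm (esym dM)) (esym fv).
by exists (v * phi), s, t.
Qed.

(** The lower right entry mu^-k of the powers of D tends to infinity. *)
Lemma frobX_large (x : R) : exists2 K, (0 < K)%N & x <= frob (D ^+ (2 * K)).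
Proof.
have y0 : 0 < (1 + `|x|)^-1 by rewrite invr_gt0 ltr_wpDr.
have mu1' : `|mu| < 1 by rewrite gtr0_norm.
have /cvgrPdist_lt /(_ _ y0) [n _ /(_ n (leqnn n))] := cvg_expr mu1'.
rewrite /= sub0r normrN gtr0_norm ?exprn_gt0// => hn.
exists n.+1 => //; have [b ->] := upper_mx2X (2 * n.+1).
rewrite /frob !mx2E; set z := mu ^- _.
have z1 : 1 + `|x| <= z.
  rewrite -[leLHS]invrK lef_pV2 ?posrE ?exprn_gt0//.
  apply: le_trans (ltW hn); apply: ler_wiXn2l; [exact: ltW|exact: ltW|].
  by rewrite mul2n -addnn addSn ltnW// ltnS leq_addr.
have := ler_norm x; have := sqr_ge0 b; have := sqr_ge0 (mu ^+ (2 * n.+1)).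
have := normr_ge0 x; rewrite expr0n/=; move: (`|x|) (_ ^+ 2) (b ^+ 2) z1 => u v w; nra.
Qed.

(** The square of D is not a rotation: its diagonal entries differ. *)
Lemma frobX2_gt2 : 2 < frob (D ^+ 2).
Proof.
have [b ->] := upper_mx2X 2; rewrite /frob !mx2E.
have m1 : mu ^+ 2 * mu ^- 2 = 1 by rewrite divff// expf_eq0/= gt_eqF.
have m2 : mu ^+ 2 < 1 by rewrite expr_lt1// ltW.
have m3 : 0 < mu ^+ 2 by rewrite exprn_gt0.
have := sqr_ge0 b; move: m1 m2 m3; move: (mu ^+ 2) (mu ^- 2) => x y xy x1 x0 b0.
have xy0 : x - y != 0.
  by rewrite subr_eq0; apply/eqP => h; move: xy; rewrite -h; nra.
have : 0 < (x - y) ^+ 2 by rewrite lt_neqAle eq_sym sqrf_eq0 xy0 sqr_ge0.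
by nra.
Qed.

End RotationWords.

(** * Block form of the flow and of the horospheres *)

Section BlockMatrices.
Variable R : realType.
Implicit Types (a b t : R) (w : 'rV[R]_2) (z : 'cV[R]_2) (n : 'M[R]_2).

Definition blk a w z n : 'M[R]_3 := block_mx (a%:M : 'M[R]_1) w z n.

Lemma blkM a w z n a' w' z' n' : blk a w z n *m blk a' w' z' n' =
  blk (a * a' + (w *m z') 0 0) (a *: w' + w *m n')
      (a' *: z + n *m z') (z *m w' + n *m n').
Proof.
rewrite /blk (@mulmx_block _ 1 2 1 2 1 2).
have -> : a%:M *m a'%:M + w *m z' = (a * a' + (w *m z') 0 0)%:M.
  by rewrite [RHS]raddfD/= -mx11_scalar scalar_mxM.
by rewrite mul_scalar_mx mul_mx_scalar.
Qed.

Lemma blk1 : blk 1 0 0 1%:M = 1%:M.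
Proof. by rewrite /blk -(@scalar_mx_block _ 1 2). Qed.

Lemma blkP (A : 'M[R]_3) :
  A = blk (@ulsubmx R 1 2 1 2 A 0 0) (@ursubmx R 1 2 1 2 A) (@dlsubmx R 1 2 1 2 A)
        (@drsubmx R 1 2 1 2 A).
Proof. by rewrite /blk -mx11_scalar -[LHS](@submxK _ 1 2 1 2). Qed.

(** G is the flow, h the horospherical matrices it expands, u those it contracts, and nm the
    displacements, with which it commutes. *)
Definition G t := blk (expR (- (2 * t))) 0 0 (expR t)%:M.
Definition h z := blk 1 0 (- z) 1%:M.
Definition u w := blk 1 w 0 1%:M.
Definition nm n := blk 1 0 0 n.

Let zero00 (i j : 'I_1) : (0 : 'M[R]_1) i j = 0. Proof. by rewrite mxE. Qed.

Let blks := (zero00, mul0mx, mulmx0, mul1mx, mulmx1, scaler0, scale1r, mul_scalar_mx,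
  mul_mx_scalar, addr0, add0r, mulr1, mul1r).

Lemma GD s t : G (s + t) = G s *m G t.
Proof.
rewrite /G blkM !blks scale_scalar_mx -!expRD; congr blk.
by congr expR; ring.
Qed.

Lemma G0 : G 0 = 1%:M.
Proof. by rewrite /G mulr0 oppr0 expR0 blk1. Qed.

Lemma hD z z' : h (z + z') = h z *m h z'.
Proof. by rewrite /h blkM !blks opprD. Qed.

Lemma h0 : h 0 = 1%:M.
Proof. by rewrite /h oppr0 blk1. Qed.

Lemma u0 : u 0 = 1%:M. Proof. by rewrite /u blk1. Qed.

Lemma nmM n n' : nm (n *m n') = nm n *m nm n'.
Proof. by rewrite /nm blkM !blks. Qed.

Lemma nm1 : nm 1%:M = 1%:M. Proof. by rewrite /nm blk1. Qed.

Lemma nm_u n w : nm n *m u w = blk 1 w 0 n.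
Proof. by rewrite /nm /u blkM !blks. Qed.

Lemma G_h t z : G t *m h z = h (expR (3 * t) *: z) *m G t.
Proof.
rewrite /G /h !blkM !blks; congr blk; rewrite scalerN scalerN scalerA -expRD.
by congr (- (expR _ *: _)); ring.
Qed.

Lemma G_u t w : G t *m u w = u (expR (- (3 * t)) *: w) *m G t.
Proof.
rewrite /G /u !blkM !blks; congr blk; rewrite scalerA -expRD.
by congr (expR _ *: _); ring.
Qed.

Lemma G_nm t n : G t *m nm n = nm n *m G t.
Proof. by rewrite /G /nm !blkM !blks. Qed.

Lemma h_nm z n : h (n *m z) *m nm n = nm n *m h z.
Proof. by rewrite /h /nm !blkM !blks mulmxN. Qed.

Lemma u_nm w n : u w *m nm n = nm n *m u (w *m n).
Proof. by rewrite /u /nm !blkM !blks. Qed.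

Lemma det_upper_blk a w n : \det (blk a w 0 n) = a * \det n.
Proof. by rewrite /blk (@det_ublock _ 1 2) det_scalar1. Qed.

Lemma det_lower_blk a z n : \det (blk a 0 z n) = a * \det n.
Proof. by rewrite /blk (@det_lblock _ 1 2) det_scalar1. Qed.

Lemma det_G t : \det (G t) = 1.
Proof.
rewrite /G det_upper_blk det_scalar expr2 -!expRD.
by rewrite (_ : _ + _ = 0) ?expR0//; ring.
Qed.

Lemma det_h z : \det (h z) = 1.
Proof. by rewrite /h det_lower_blk det1 mulr1. Qed.

Lemma det_u w : \det (u w) = 1.
Proof. by rewrite /u det_upper_blk det1 mulr1. Qed.

Lemma det_nm n : \det (nm n) = \det n.
Proof. by rewrite /nm det_upper_blk mul1r. Qed.

Lemma norm_block_mx_le (m1 m2 n1 n2 : nat) (A : 'M[R]_(m1, n1)) (B : 'M[R]_(m1, n2))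
    (C : 'M[R]_(m2, n1)) (E : 'M[R]_(m2, n2)) (r : R) :
  0 <= r -> `|A| <= r -> `|B| <= r -> `|C| <= r -> `|E| <= r ->
  `|block_mx A B C E| <= r.
Proof.
move=> r0 ar br cr er; apply: mx_norm_le => // i j.
rewrite -(fintype.splitK i) -(fintype.splitK j).
case: (fintype.split i) => i'; case: (fintype.split j) => j' /=.
- by rewrite block_mxEul (le_trans (le_mx_norm _ _ _)).
- by rewrite block_mxEur (le_trans (le_mx_norm _ _ _)).
- by rewrite block_mxEdl (le_trans (le_mx_norm _ _ _)).
- by rewrite block_mxEdr (le_trans (le_mx_norm _ _ _)).
Qed.

Lemma norm_blk_le a w z n (r : R) : 0 <= r -> `|a| <= r -> `|w| <= r ->
  `|z| <= r -> `|n| <= r -> `|blk a w z n| <= r.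
Proof.
move=> r0 ar wr zr nr; apply: (@norm_block_mx_le 1 2 1 2) => //.
by apply: mx_norm_le => // i j; rewrite !ord1 mxE.
Qed.

Lemma norm_1mx_le1 (n : nat) : `|1%:M : 'M[R]_n| <= 1.
Proof. by apply: mx_norm_le => // i j; rewrite mxE; case: eqP; rewrite ?normr1 ?normr0. Qed.

Lemma norm_h_le z : `|h z| <= 1 + `|z|.
Proof.
apply: norm_blk_le; rewrite ?normr1 ?normr0 ?normrN ?lerDl ?lerDr ?addr_ge0//.
by rewrite (le_trans (norm_1mx_le1 2))// lerDl.
Qed.

Lemma norm_u_le w : `|u w| <= 1 + `|w|.
Proof.
apply: norm_blk_le; rewrite ?normr1 ?normr0 ?normrN ?lerDl ?lerDr ?addr_ge0//.
by rewrite (le_trans (norm_1mx_le1 2))// lerDl.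
Qed.

Lemma norm_nm_le n : `|nm n| <= 1 + `|n|.
Proof.
by apply: norm_blk_le; rewrite ?normr1 ?normr0 ?normrN ?lerDl ?lerDr ?addr_ge0.
Qed.

Lemma subr_block (m1 m2 n1 n2 : nat) (A A' : 'M[R]_(m1, n1)) (B B' : 'M[R]_(m1, n2))
    (C C' : 'M[R]_(m2, n1)) (E E' : 'M[R]_(m2, n2)) :
  block_mx A B C E - block_mx A' B' C' E'
  = block_mx (A - A') (B - B') (C - C') (E - E').
Proof. by rewrite opp_block_mx add_block_mx. Qed.

Lemma blkB a w z n a' w' z' n' :
  blk a w z n - blk a' w' z' n' = blk (a - a') (w - w') (z - z') (n - n').
Proof. by rewrite /blk (@subr_block 1 2 1 2) -raddfB. Qed.

Lemma norm_hB z z' : `|h z - h z'| <= `|z - z'|.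
Proof.
by rewrite /h blkB !subrr -opprD; apply: norm_blk_le; rewrite ?normr0 ?normrN.
Qed.

Lemma norm_uB w w' : `|u w - u w'| <= `|w - w'|.
Proof. by rewrite /u blkB !subrr; apply: norm_blk_le; rewrite ?normr0. Qed.

Lemma norm_nmB n n' : `|nm n - nm n'| <= `|n - n'|.
Proof. by rewrite /nm blkB !subrr; apply: norm_blk_le; rewrite ?normr0. Qed.

(** Any matrix with positive upper left entry is, up to a contracted and a displacement
    factor, on the orbit of a horospherical matrix: this is block Gaussian elimination, with
    the Schur complement as displacement. The scalar J is absorbed by a shift of time. *)
Lemma upper_factor (J : R) w z n : 0 < J ->
  h (J^-1 *: z) *m blk J w z n =
  G (- (ln J / 2)) *m (nm (Num.sqrt J *: (n - J^-1 *: (z *m w))) *m u (J^-1 *: w)).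
Proof.
move=> J0; have JN0 : J != 0 by rewrite gt_eqF.
have e1 : expR (ln J) = J by rewrite lnK.
have e2 : expR (- (ln J / 2)) * Num.sqrt J = 1.
  apply/eqP; rewrite -(@eqrXn2 _ 2)// ?mulr_ge0 ?expR_ge0 ?sqrtr_ge0//.
  rewrite exprMn sqr_sqrtr ?ltW// expr1n -expRM_natl -{2}e1 -expRD.
  by rewrite (_ : _ + _ = 0) ?expR0//; field.
rewrite nm_u /h /G !blkM !blks.
have -> : expR (- (2 * - (ln J / 2))) = J.
  by rewrite -[RHS]e1; congr expR; field.
rewrite !scalerA mulfV// scale1r e2 scale1r; congr blk.
- by rewrite scalerN scalerA mulfV// scale1r addNr.
- by rewrite mulNmx -scalemxAl addrC.
Qed.

Lemma flowE t : (flow t : 'M[R]_3) = G t.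
Proof.
rewrite [LHS]blkP; congr blk.
- by rewrite !mxE.
- by apply/matrixP => i j; rewrite !mxE !ord1.
- by apply/matrixP => i j; rewrite !mxE !ord1.
- by apply/matrixP => i j; rewrite !mxE (inj_eq (@rshift_inj 1 2)).
Qed.

End BlockMatrices.

(** * Quasi-periodic lattices and their homoclinic orbits *)

Section SameLattice.
Variable R : realType.
Implicit Types A B : 'M[R]_3.

(** A Z^3 = B Z^3. *)
Definition same_lattice A B :=
  exists2 C : 'M[int]_3, \det C = 1 & A = B *m intmx R C.

Lemma same_refl A : same_lattice A A.
Proof. by exists 1%:M; rewrite ?det1// /intmx map_mx1 mulmx1. Qed.

Lemma same_eq A B : A = B -> same_lattice A B.
Proof. by move=> ->; exact: same_refl. Qed.

Lemma same_trans A B C : same_lattice A B -> same_lattice B C -> same_lattice A C.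
Proof.
move=> [U dU ->] [V dV ->]; exists (V *m U); first by rewrite det_mulmx dU dV.
by rewrite /intmx map_mxM mulmxA.
Qed.

Lemma same_sym A B : same_lattice A B -> same_lattice B A.
Proof.
move=> [U dU ->]; have uU : U \in unitmx by rewrite unitmxE dU unitr1.
exists (invmx U); first by rewrite det_inv dU invr1.
by rewrite /intmx -mulmxA -map_mxM mulmxV// map_mx1 mulmx1.
Qed.

Lemma same_mull P A B : same_lattice A B -> same_lattice (P *m A) (P *m B).
Proof. by move=> [U dU ->]; exists U => //; rewrite mulmxA. Qed.

Lemma same_det A B : same_lattice A B -> \det A = \det B.
Proof. by move=> [U dU ->]; rewrite det_mulmx det_map_mx dU mulr1. Qed.

Lemma norm3M_le A B (a b : R) : `|A| <= a -> `|B| <= b -> `|A *m B| <= 3 * (a * b).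
Proof.
by move=> Aa Bb; rewrite (le_trans (normM_le _ _))// ler_wpM2l// ler_pM.
Qed.

Lemma norm3M_sub A A' B (a b : R) : `|A - A'| <= a -> `|B| <= b ->
  `|A *m B - A' *m B| <= 3 * (a * b).
Proof. by rewrite -mulmxBl; exact: norm3M_le. Qed.

End SameLattice.

(** A lattice g Z^3 that the flow brings back to itself up to a rotation of the expanding
    plane, together with another element of SL_3(R) stabilizing it, given by its blocks; the
    positive entry qp_j lets upper_factor apply to the latter. *)
Record quasi_periodic (R : realType) := QuasiPeriodic {
  qp_g : 'M[R]_3;
  qp_a : 'M[int]_3;
  qp_t : R;
  qp_theta : R;
  qp_gamma : 'M[int]_3;
  qp_j : R;
  qp_c12 : 'rV[R]_2;
  qp_c21 : 'cV[R]_2;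
  qp_c22 : 'M[R]_2;
  qp_det_g : \det qp_g = 1;
  qp_det_a : \det qp_a = 1;
  qp_t_gt0 : 0 < qp_t;
  qp_return : G qp_t *m qp_g = nm (rotmx qp_theta) *m qp_g *m intmx R qp_a;
  qp_det_gamma : \det qp_gamma = 1;
  qp_j_gt0 : 0 < qp_j;
  qp_sym : blk qp_j qp_c12 qp_c21 qp_c22 *m qp_g = qp_g *m intmx R qp_gamma
}.

Section Orbit.
Variables (R : realType) (Q : quasi_periodic R).
Let g := qp_g Q.
Let t0 := qp_t Q.
Let theta := qp_theta Q.
Let j := qp_j Q.
Let c12 := qp_c12 Q.
Let c21 := qp_c21 Q.
Let c22 := qp_c22 Q.
Let c := blk j c12 c21 c22.
Let t0_gt0 : 0 < t0 := qp_t_gt0 Q.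
Let j_gt0 : 0 < j := qp_j_gt0 Q.

Definition spin k := rotmx theta ^+ k.
(** The factors of the second symmetry provided by upper_factor, and the time sigma by which
    the excursion along it delays the orbit. *)
Definition w_lim := j^-1 *: c12.
Definition z_lim := j^-1 *: c21.
Definition kick := Num.sqrt j *: (c22 - j^-1 *: (c21 *m c12)).
Definition sigma := ln j / 2.

(** The orbit that leaves the periodic one along h z_lim, and comes back to it displaced by
    kick: homoclinic_past and homoclinic_future. *)
Definition homoclinic v := G v *m h z_lim *m g.

Lemma c_same : same_lattice g (c *m g).
Proof.
by apply: same_sym; exists (qp_gamma Q); [exact: qp_det_gamma|exact: qp_sym].
Qed.

Lemma det_c : \det c = 1.
Proof.
have := same_det c_same; rewrite det_mulmx /g qp_det_g mulr1 => ->//.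
Qed.

Lemma spin_det k : \det (spin k) = 1.
Proof. by rewrite /spin rotmxX det_rotmx. Qed.

Lemma spin_norm k : `|spin k| <= 1.
Proof. by rewrite /spin rotmxX norm_rotmx_le1. Qed.

Lemma G_return k : same_lattice (G (k%:R * t0) *m g) (nm (spin k) *m g).
Proof.
elim: k => [|k IH]; first by rewrite mul0r G0 mul1mx /spin expr0 nm1 mul1mx; exact: same_refl.
rewrite -natr1 mulrDl mul1r GD -mulmxA.
apply: (@same_trans _ _ (G (k%:R * t0) *m (nm (rotmx theta) *m g))).
  apply: same_mull; exists (qp_a Q); [exact: qp_det_a|exact: qp_return].
rewrite mulmxA G_nm /spin exprS nmM -!mulmxA; exact: same_mull.
Qed.

Lemma G_return_neg k :
  same_lattice (G (- (k%:R * t0)) *m g) (nm (rotmx (- (k%:R * theta))) *m g).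
Proof.
have {1}-> : g = nm (rotmx (- (k%:R * theta))) *m (nm (spin k) *m g).
  by rewrite mulmxA -nmM /spin rotmxX rotmxNK nm1 mul1mx.
rewrite mulmxA G_nm -mulmxA; apply: same_mull.
apply: (@same_trans _ _ (G (- (k%:R * t0)) *m (G (k%:R * t0) *m g))).
  by apply: same_mull; apply: same_sym; exact: G_return.
by apply: same_eq; rewrite mulmxA -GD addNr G0 mul1mx.
Qed.

Lemma G_norm_le t : 0 <= t <= t0 -> `|G t| <= expR t0.
Proof.
move=> /andP[t1 t2]; have e1 : expR t <= expR t0 by rewrite ler_expR.
have e0 : 1 <= expR t0 by rewrite -expR0 ler_expR ltW.
apply: norm_blk_le; rewrite ?normr0 ?expR_ge0// ?ger0_norm ?expR_ge0//.
  by rewrite ler_expR; lra.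
apply: mx_norm_le; first exact: expR_ge0.
by move=> i i'; rewrite mxE; case: eqP; rewrite ?normr0 ?expR_ge0// ger0_norm ?expR_ge0.
Qed.

(** Modulo one period and the rotations, the orbit is parametrized by a compact interval of
    times. *)
Lemma orbit_bounded : exists2 r, 0 < r &
  forall t, exists2 B, same_lattice (G t *m g) B & \det B = 1 /\ `|B| <= r.
Proof.
pose r := 3 * (expR t0 * (3 * ((1 + 1) * (`|g| + 1)))).
exists r; first by rewrite !mulr_gt0 ?expR_gt0// ltr_wpDl.
move=> t.
have key t' n : 0 <= t' <= t0 -> `|n| <= 1 -> \det n = 1 ->
    \det (G t' *m (nm n *m g)) = 1 /\ `|G t' *m (nm n *m g)| <= r.
  move=> tt nn dn; split; first by rewrite !det_mulmx det_G det_nm dn qp_det_g !mulr1.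
  apply: norm3M_le; first exact: G_norm_le.
  apply: norm3M_le; last by rewrite lerDl.
  by rewrite (le_trans (norm_nm_le _))// lerD2l.
have := floor_itv (t / t0); rewrite ler_pdivlMr// ltr_pdivrMr// intrD mulrDl mul1r.
case: (Num.floor _) => k /andP[k1 k2].
  exists (G (t - k%:R * t0) *m (nm (spin k) *m g)).
    apply: (@same_trans _ _ (G (t - k%:R * t0) *m (G (k%:R * t0) *m g))).
      by apply: same_eq; rewrite mulmxA -GD subrK.
    by apply: same_mull; exact: G_return.
  apply: key; [|exact: spin_norm|exact: spin_det].
  by apply/andP; split; [rewrite subr_ge0|rewrite lerBlDl ltW].
exists (G (t + k.+1%:R * t0) *m (nm (rotmx (- (k.+1%:R * theta))) *m g)).
  apply: (@same_trans _ _ (G (t + k.+1%:R * t0) *m (G (- (k.+1%:R * t0)) *m g))).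
    by apply: same_eq; rewrite mulmxA -GD addrK.
  by apply: same_mull; exact: G_return_neg.
apply: key; [|exact: norm_rotmx_le1|exact: det_rotmx].
by move: k1 k2; rewrite NegzE mulrNz /= => k1 k2; apply/andP; split; lra.
Qed.

Lemma kick_factor : h z_lim *m c = G (- sigma) *m (nm kick *m u w_lim).
Proof. exact: upper_factor. Qed.

Lemma det_kick : \det kick = 1.
Proof.
have := congr1 determinant kick_factor.
by rewrite !det_mulmx det_h det_c det_G det_nm det_u !mul1r mulr1 => <-.
Qed.

(** The horospherical factor tends to 1 as v tends to -oo. *)
Lemma homoclinic_past v :
  homoclinic v = h (expR (3 * v) *: z_lim) *m (G v *m g).
Proof. by rewrite /homoclinic G_h mulmxA. Qed.

(** The contracted factor tends to 1 as v tends to +oo; replacing g by c g, the other basis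
    of the same lattice, is what exchanges the two descriptions. *)
Lemma homoclinic_future v : same_lattice (homoclinic v)
  (nm kick *m u (expR (- (3 * (v - sigma))) *: w_lim) *m (G (v - sigma) *m g)).
Proof.
apply: (@same_trans _ _ (G v *m h z_lim *m (c *m g))).
  by apply: same_mull; exact: c_same.
apply: same_eq.
rewrite mulmxA -[_ *m h _ *m c]mulmxA kick_factor mulmxA -GD mulmxA G_nm.
by rewrite -[nm kick *m _ *m _]mulmxA G_u !mulmxA.
Qed.

Lemma homoclinic_bounded : exists2 r, 0 < r &
  forall v, exists2 B, same_lattice (homoclinic v) B & \det B = 1 /\ `|B| <= r.
Proof.
have [r r0 rP] := orbit_bounded.
pose r1 := 3 * ((1 + `|z_lim|) * r).
pose r2 := 3 * (3 * ((1 + `|kick|) * (1 + expR (3 * `|sigma|) * `|w_lim|)) * r).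
have r10 : 0 <= r1 by rewrite !mulr_ge0 ?addr_ge0// ltW.
have r20 : 0 <= r2 by rewrite !mulr_ge0 ?addr_ge0 ?mulr_ge0 ?expR_ge0// ltW.
exists (r1 + r2 + 1); first by rewrite ltr_wpDl// addr_ge0.
move=> v; have [v0|v0] := leP v 0.
  have [B sB [dB Br]] := rP v.
  exists (h (expR (3 * v) *: z_lim) *m B).
    by rewrite homoclinic_past; exact: same_mull.
  split; first by rewrite det_mulmx det_h dB mulr1.
  apply: (@le_trans _ _ r1); last by lra.
  apply: norm3M_le => //; rewrite (le_trans (norm_h_le _))// lerD2l normrZ.
  by rewrite ger0_norm ?expR_ge0// ler_piMl// -[leRHS]expR0 ler_expR; lra.
have [B sB [dB Br]] := rP (v - sigma).
exists (nm kick *m u (expR (- (3 * (v - sigma))) *: w_lim) *m B).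
  by apply: same_trans (homoclinic_future v) _; exact: same_mull.
split; first by rewrite !det_mulmx det_nm det_kick det_u dB !mulr1.
apply: (@le_trans _ _ r2); last by lra.
apply: norm3M_le => //; apply: norm3M_le; first exact: norm_nm_le.
rewrite (le_trans (norm_u_le _))// lerD2l normrZ ger0_norm ?expR_ge0//.
rewrite ler_wpM2r// ler_expR; have := ler_norm sigma; lra.
Qed.

End Orbit.

(** * Concatenation of excursions *)

Section Step.
Variables (R : realType) (Q : quasi_periodic R).
Let g := qp_g Q.
Let t0 := qp_t Q.
Let j := qp_j Q.
Let c12 := qp_c12 Q.
Let c21 := qp_c21 Q.
Let c22 := qp_c22 Q.
Let R_ k := spin Q k.

(** The moment t of the orbit of the lattice h_x Z^3 at which an excursion has just ended:
    the lattice is then g Z^3 displaced by n and moved by the factor u w, which the flow is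
    going to contract. *)
Record state := State { sx : 'cV[R]_2; st : R; sw : 'rV[R]_2; sn : 'M[R]_2 }.

Definition valid s := \det (sn s) = 1 /\
  same_lattice (G (st s) *m h (sx s)) (nm (sn s) *m u (sw s) *m g).

(** Seen after k more periods, the contracted factor is u (wk k s) and the displacement is
    edge k s. Multiplying by the second symmetry and factoring by upper_factor, with upper
    left entry Jk k s, yields the next excursion. *)
Definition wk k s := expR (- (3 * (k%:R * t0))) *: (sw s *m R_ k).
Definition Jk k s := j + (wk k s *m c21) 0 0.
Definition edge k s := sn s *m R_ k.
Definition turn_back k s := c22 - (Jk k s)^-1 *: (c21 *m (c12 + wk k s *m c22)).

Definition step k s := State
  (sx s + expR (- (3 * (st s + k%:R * t0))) *: ((Jk k s)^-1 *: (edge k s *m c21)))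
  (st s + k%:R * t0 + ln (Jk k s) / 2)
  ((Jk k s)^-1 *: (c12 + wk k s *m c22))
  (edge k s *m (Num.sqrt (Jk k s) *: turn_back k s)).

(** Seen from the end of the previous excursion, the change of x made by step is a
    horospherical factor that remains small as long as tau is well below k periods. *)
Lemma step_near k s tau : valid s ->
  same_lattice (G (st s + tau) *m h (sx (step k s)))
    (h (expR (3 * (tau - k%:R * t0)) *: ((Jk k s)^-1 *: (edge k s *m c21))) *m
     (nm (sn s) *m u (expR (- (3 * tau)) *: sw s)) *m (G tau *m g)).
Proof.
move=> [_ sv]; rewrite /step /=.
set z := _^-1 *: _; set x := expR _ *: z.
apply: (@same_trans _ _ (h (expR (3 * (st s + tau)) *: x) *m
    (G tau *m (nm (sn s) *m u (sw s) *m g)))).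
  apply: (@same_trans _ _ (h (expR (3 * (st s + tau)) *: x) *m
      (G tau *m (G (st s) *m h (sx s))))); last by do 2!apply: same_mull.
  by apply: same_eq; rewrite (addrC (sx s)) hD mulmxA G_h (addrC (st s)) GD !mulmxA.
apply: same_eq; rewrite /x scalerA -expRD.
have -> : 3 * (st s + tau) + - (3 * (st s + k%:R * t0)) = 3 * (tau - k%:R * t0).
  by ring.
by rewrite !mulmxA; congr (_ *m _); rewrite -!mulmxA; congr (_ *m _);
  rewrite -G_u !mulmxA G_nm.
Qed.

(** Seen from the time of the next excursion, the contracted factor is negligible and the
    orbit is that of homoclinic, displaced by edge k s. *)
Lemma step_far k s v : valid s ->
  same_lattice (G (st s + k%:R * t0 + v) *m h (sx (step k s)))
    (nm (edge k s) *m h (expR (3 * v) *: ((Jk k s)^-1 *: c21)) *m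
     u (expR (- (3 * v)) *: wk k s) *m (G v *m g)).
Proof.
move=> vs; rewrite -addrA; apply: same_trans (step_near k _ vs) _.
have -> : 3 * (k%:R * t0 + v - k%:R * t0) = 3 * v by ring.
set z := expR (3 * v) *: _; set w := expR _ *: sw s.
apply: (@same_trans _ _ (h z *m (nm (sn s) *m u w) *m (G v *m (nm (R_ k) *m g)))).
  rewrite addrC GD -mulmxA -[X in same_lattice _ X]mulmxA.
  by rewrite -[G v *m _ *m g]mulmxA; do 3!apply: same_mull; exact: G_return.
apply: same_eq.
have -> : z = edge k s *m (expR (3 * v) *: ((Jk k s)^-1 *: c21)).
  by rewrite /z -!scalemxAr.
have -> : expR (- (3 * v)) *: wk k s = w *m R_ k.
  rewrite /wk /w -scalemxAl scalerA -expRD; congr (expR _ *: _); ring.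
rewrite -h_nm /edge nmM -!mulmxA; congr (_ *m (_ *m _)).
by rewrite !mulmxA -u_nm -!mulmxA; congr (_ *m _); rewrite !mulmxA G_nm.
Qed.

Lemma step_valid k s : valid s -> 0 < Jk k s -> valid (step k s).
Proof.
move=> vs J0; have [dn _] := vs.
pose X := nm (edge k s) *m u (wk k s) *m blk j c12 c21 c22.
have XE : X = blk (Jk k s) (c12 + wk k s *m c22) (edge k s *m c21) (edge k s *m c22).
  by rewrite /X nm_u blkM mul1r scale1r mul0mx add0r scaler0 add0r.
have sE : Num.sqrt (Jk k s) *: (edge k s *m c22 -
    (Jk k s)^-1 *: ((edge k s *m c21) *m (c12 + wk k s *m c22))) = sn (step k s).
  by rewrite /= /turn_back -scalemxAr mulmxBr -scalemxAr mulmxA.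
have := upper_factor (c12 + wk k s *m c22) (edge k s *m c21) (edge k s *m c22) J0.
rewrite -XE sE => key; split.
  have : forall n' w', h ((Jk k s)^-1 *: (edge k s *m c21)) *m X =
      G (- (ln (Jk k s) / 2)) *m (nm n' *m u w') -> \det n' = 1.
    move=> n' w' /(congr1 determinant); rewrite !det_mulmx det_G !det_h !det_nm !det_u.
    by rewrite (det_c Q) [\det (edge k s)]det_mulmx dn spin_det !mulr1 !mul1r => <-.
  by apply; exact: key.
have := step_far k 0 vs; rewrite addr0 !mulr0 oppr0 expR0 !scale1r G0 mul1mx.
rewrite -h_nm -scalemxAr -2![X in same_lattice _ X]mulmxA => h1.
rewrite /= [_ + ln _ / 2]addrC GD -mulmxA.
apply: same_trans (same_mull _ h1) _.
apply: (@same_trans _ _ (G (ln (Jk k s) / 2) *m (h ((Jk k s)^-1 *: (edge k s *m c21)) *m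
    (nm (edge k s) *m (u (wk k s) *m (blk j c12 c21 c22 *m g)))))).
  by do 4!apply: same_mull; exact: c_same.
apply: same_eq.
have -> : forall A B C E F g' : 'M[R]_3, A *m (B *m (C *m (E *m (F *m g')))) =
    A *m (B *m (C *m E *m F)) *m g' by move=> *; rewrite !mulmxA.
by rewrite -/X key mulmxA -GD subrr G0 mul1mx.
Qed.

End Step.

Section Edges.
Variables (R : realType) (Q : quasi_periodic R) (f : 'M[R]_3 -> R).
Hypothesis f_int : lattice_invariant f.
Hypothesis f_unif : unif_continuous_on_balls f.
Hypothesis f_bounded : bounded_on_balls f.

Lemma f_same A B : same_lattice A B -> \det B = 1 -> f A = f B.
Proof. by move=> [C dC ->] dB; exact: f_int. Qed.

Lemma f_unif_mul (r e : R) : 0 < e -> exists2 d, 0 < d &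
  forall P P' B, \det P = 1 -> \det P' = 1 -> \det B = 1 -> `|P| <= r ->
    `|B| <= r -> `|P - P'| < d -> `|f (P *m B) - f (P' *m B)| < e.
Proof.
move=> e0; have [d d0 dP] := f_unif (3 * (r * r)) e0.
have r1 : 0 < 3 * (`|r| + 1) by rewrite mulr_gt0// ltr_wpDl.
exists (d / (3 * (`|r| + 1))); first by rewrite divr_gt0.
move=> P P' B dP1 dP' dB Pr Br PP'; apply: dP; rewrite ?det_mulmx ?dP1 ?dP' ?dB ?mulr1//.
  exact: norm3M_le.
apply: le_lt_trans (norm3M_sub (lexx _) Br) _.
move: PP'; rewrite ltr_pdivlMr// => PP'; apply: le_lt_trans PP'.
have := ler_norm r; have := normr_ge0 (P - P'); nra.
Qed.

(** The cost of an excursion made with the displacement e. *)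
Definition edge_max (e : 'M[R]_2) : R := sup (range (fun v => f (nm e *m homoclinic Q v))).

Let has_sup_edge e : \det e = 1 -> has_sup (range (fun v => f (nm e *m homoclinic Q v))).
Proof.
move=> de; split; first by exists (f (nm e *m homoclinic Q 0)), 0.
have [r r0 rP] := homoclinic_bounded Q.
have [b bP] := f_bounded (3 * ((1 + `|e|) * r)).
exists b => _ [v _ <-]; have [B sB [dB Br]] := rP v.
have dn : \det (nm e *m B) = 1 by rewrite det_mulmx det_nm de dB mulr1.
rewrite (f_same (same_mull (nm e) sB)) // bP// norm3M_le//.
exact: norm_nm_le.
Qed.

Lemma edge_max_ge e v : \det e = 1 -> f (nm e *m homoclinic Q v) <= edge_max e.
Proof. by move=> de; apply: ub_le_sup; [case: (has_sup_edge de)|exists v]. Qed.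

Lemma edge_max_adherent e d : \det e = 1 -> 0 < d ->
  exists v, edge_max e - d < f (nm e *m homoclinic Q v).
Proof.
by move=> /has_sup_edge hs d0; have [_ [v _ <-] hv] := sup_adherent d0 hs; exists v.
Qed.

Lemma edge_max_le e b : (forall v, f (nm e *m homoclinic Q v) <= b) -> edge_max e <= b.
Proof.
move=> H; apply: ge_sup; first by exists (f (nm e *m homoclinic Q 0)), 0.
by move=> _ [v _ <-].
Qed.

Lemma edge_max_unif (r d : R) : 0 < d -> exists2 d', 0 < d' &
  forall e e', \det e = 1 -> \det e' = 1 -> `|e| <= r -> `|e - e'| < d' ->
    edge_max e' <= edge_max e + d.
Proof.
move=> d0; have [r1 r10 rP] := homoclinic_bounded Q.
have [d' d'0 dP] := f_unif_mul (1 + `|r| + r1) d0.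
exists d' => // e e' de de' er ee'; apply: edge_max_le => v.
have [B sB [dB Br]] := rP v.
have H e1 : \det e1 = 1 -> f (nm e1 *m homoclinic Q v) = f (nm e1 *m B).
  move=> de1; apply: f_same; first exact: same_mull.
  by rewrite det_mulmx det_nm de1 dB mulr1.
have := edge_max_ge v de; rewrite !H// => he.
have : `|f (nm e *m B) - f (nm e' *m B)| < d.
  apply: dP; rewrite ?det_nm//.
  - rewrite (le_trans (norm_nm_le _))//; have := ler_norm r; lra.
  - have := normr_ge0 r; lra.
  - exact: le_lt_trans (norm_nmB _ _) _.
rewrite ltr_distlC => /andP[_ h2]; lra.
Qed.

End Edges.

(** * Heights during one excursion *)

Section StepEstimates.
Variables (R : realType) (Q : quasi_periodic R) (f : 'M[R]_3 -> R).
Hypothesis f_int : lattice_invariant f.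
Hypothesis f_unif : unif_continuous_on_balls f.
Let t0 := qp_t Q.
Let j := qp_j Q.
Let c21 := qp_c21 Q.
Let wl := w_lim Q.
Let zl := z_lim Q.
Let D := kick Q.
Let sg := sigma Q.

(** On the first part of the way to the next excursion the orbit follows the end of the
    previous one, because of step_near and homoclinic_future. The representative B with
    bounded norm is recorded because the height is uniformly continuous only on bounded
    sets. *)
Lemma tail_close (r : R) : exists r', forall e : R, 0 < e ->
  exists2 d, 0 < d & forall s e0 k tau,
  valid Q s -> \det e0 = 1 -> `|sn s| <= r -> 0 <= tau ->
  `|expR (3 * (tau - k%:R * t0)) *: ((Jk Q k s)^-1 *: (edge Q k s *m c21))| < d ->
  `|sn s - e0 *m D| < d -> `|sw s - wl| < d ->
  `|f (G (st s + tau) *m h (sx (step Q k s))) - f (nm e0 *m homoclinic Q (tau + sg))| < e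
  /\ exists2 B, same_lattice (G (st s + tau) *m h (sx (step Q k s))) B &
       \det B = 1 /\ `|B| <= r'.
Proof.
have [r0 r00 rP] := orbit_bounded Q.
pose CN := 1 + (`|wl| + 1) + `|r|.
have CN1 : 1 <= CN by rewrite /CN; have := normr_ge0 wl; have := normr_ge0 r; lra.
pose r1 := 6 * CN + r0.
exists (3 * ((6 * CN) * r0)) => e e_gt0.
have [d d_gt0 dP] := f_unif_mul f_unif r1 e_gt0.
pose del := Num.min 1 (d / (3 * CN + 2)).
have C2 : 0 < 3 * CN + 2 by lra.
have del0 : 0 < del by rewrite lt_min ltr01 divr_gt0.
have del1 : del <= 1 by rewrite ge_min lexx.
have deld : del * (3 * CN + 1) < d.
  have : del * (3 * CN + 2) <= d by rewrite -ler_pdivlMr// ge_min lexx orbT.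
  by lra.
exists del => // s e0 k tau vs de0 nr tau0.
set y := _ *: _ => yd nd wd.
have [dn _] := vs.
have [B sB [dB Br]] := rP tau.
have E1 : expR (- (3 * tau)) <= 1 by rewrite -[leRHS]expR0 ler_expR; lra.
pose w1 := expR (- (3 * tau)) *: sw s; pose w2 := expR (- (3 * tau)) *: wl.
have w12 : `|w1 - w2| <= del.
  rewrite -scalerBr normrZ ger0_norm ?expR_ge0//.
  by rewrite (le_trans _ (ltW wd))// ler_piMl.
have w1C : `|w1| <= `|wl| + 1.
  rewrite normrZ ger0_norm ?expR_ge0//; apply: (@le_trans _ _ `|sw s|).
    by rewrite ler_piMl.
  rewrite -(subrK wl (sw s)) (le_trans (ler_normD _ _))// addrC lerD2l.
  by rewrite (le_trans (ltW wd)).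
pose N1 := nm (sn s) *m u w1; pose N2 := nm (e0 *m D) *m u w2.
have NC : `|N1| <= CN.
  rewrite /N1 nm_u; apply: norm_blk_le; rewrite ?normr1 ?normr0 /CN;
    have := normr_ge0 wl; have := normr_ge0 r; have := ler_norm r; lra.
have N12 : `|N1 - N2| <= del.
  rewrite /N1 /N2 !nm_u blkB !subrr; apply: norm_blk_le; rewrite ?normr0//; exact: ltW.
have h2 : `|h y| <= 2 by rewrite (le_trans (norm_h_le _))//; lra.
have hN : `|h y *m N1| <= 6 * CN.
  by rewrite (le_trans (norm3M_le h2 NC))// mulrA -natrM.
have dN1 : \det N1 = 1 by rewrite det_mulmx det_nm det_u dn mulr1.
have dN2 : \det N2 = 1 by rewrite det_mulmx det_nm det_u det_mulmx de0 det_kick !mulr1.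
have rep : same_lattice (G (st s + tau) *m h (sx (step Q k s))) (h y *m N1 *m B).
  by apply: same_trans (step_near k tau vs) _; exact: same_mull.
have dhN : \det (h y *m N1) = 1 by rewrite det_mulmx det_h dN1 mulr1.
have dhNB : \det (h y *m N1 *m B) = 1 by rewrite det_mulmx dhN dB mulr1.
have dN2B : \det (N2 *m B) = 1 by rewrite det_mulmx dN2 dB mulr1.
split; last first.
  by exists (h y *m N1 *m B) => //; split=> //; exact: norm3M_le.
rewrite (f_same f_int rep dhNB).
have rep2 : same_lattice (nm e0 *m homoclinic Q (tau + sg)) (N2 *m B).
  apply: same_trans (same_mull _ (homoclinic_future Q _)) _.
  rewrite -/sg addrK; apply: same_trans (same_mull (N2) sB).
  by apply: same_eq; rewrite /N2 nmM !mulmxA.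
rewrite (f_same f_int rep2 dN2B).
apply: dP => //.
- by apply: le_trans hN _; rewrite /r1; lra.
- by apply: le_trans Br _; rewrite /r1; lra.
rewrite -(subrKA N1) (le_lt_trans (ler_normD _ _))//.
have -> : h y *m N1 - N1 = (h y - h 0) *m N1 by rewrite mulmxBl h0 mul1mx.
apply: le_lt_trans deld; rewrite mulrDr mulr1 lerD//.
rewrite (_ : del * (3 * CN) = 3 * (del * CN)); last by ring.
apply: norm3M_le => //; rewrite (le_trans (norm_hB _ _))// subr0; exact: ltW.
Qed.

(** Near an excursion the orbit follows the homoclinic one, by step_far. *)
Lemma peak_close (r : R) : exists rho : R -> R, forall A e, 0 < e ->
  exists2 d, 0 < d & forall s k v,
  valid Q s -> `|sn s| <= r -> expR (3 * v) <= A ->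
  `|(Jk Q k s)^-1 - j^-1| < 1 -> `|expR (- (3 * v)) *: wk Q k s| < 1 ->
  (exists2 B, same_lattice (G (st s + k%:R * t0 + v) *m h (sx (step Q k s))) B &
       \det B = 1 /\ `|B| <= rho A) /\
  (`|(Jk Q k s)^-1 - j^-1| < d -> `|expR (- (3 * v)) *: wk Q k s| < d ->
  `|f (G (st s + k%:R * t0 + v) *m h (sx (step Q k s)))
    - f (nm (edge Q k s) *m homoclinic Q v)| < e).
Proof.
have [r0 r00 rP] := orbit_bounded Q.
pose Cn := 1 + 2 * `|r|.
have Cn1 : 1 <= Cn by rewrite /Cn; have := normr_ge0 r; lra.
exists (fun A => 3 * (3 * (3 * (Cn * (1 + `|A| * ((`|j^-1| + 1) * `|c21|))) * 2) * r0)).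
move=> A e e_gt0.
pose Cy := 1 + `|A| * ((`|j^-1| + 1) * `|c21|).
have Cy1 : 1 <= Cy by rewrite /Cy lerDl !mulr_ge0// addr_ge0.
pose CP := 3 * (3 * (Cn * Cy) * 2).
have CP0 : 0 <= CP by rewrite !mulr_ge0//; lra.
have [d d_gt0 dP] := f_unif_mul f_unif (CP + r0) e_gt0.
pose K := 3 * (Cn * (3 * Cy + `|A| * `|c21|)).
have K0 : 0 <= K by rewrite !mulr_ge0 ?addr_ge0 ?mulr_ge0//; lra.
have C2 : 0 < K + 1 by lra.
pose del := d / (K + 1).
have del0 : 0 < del by rewrite divr_gt0.
have deld : del * K < d.
  have : del * (K + 1) <= d by rewrite -ler_pdivlMr.
  by lra.
exists del => // s k v vs nr vA Jd.
set w1 := _ *: wk _ _ _ => w11.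
have [dn _] := vs.
have [B sB [dB Br]] := rP v.
pose y := expR (3 * v) *: ((Jk Q k s)^-1 *: c21).
pose y' := expR (3 * v) *: zl.
have vA' : expR (3 * v) <= `|A| by rewrite (le_trans vA)// ler_norm.
have yy' : `|(Jk Q k s)^-1 - j^-1| < del -> `|y - y'| <= del * (`|A| * `|c21|).
  move=> {}Jd; rewrite -scalerBr normrZ ger0_norm ?expR_ge0// -scalerBl normrZ mulrCA.
  rewrite ler_pM ?mulr_ge0 ?expR_ge0//; first exact: ltW.
  by rewrite ler_wpM2r.
have yC : `|h y| <= Cy.
  rewrite (le_trans (norm_h_le _))// lerD2l normrZ ger0_norm ?expR_ge0//.
  rewrite ler_pM ?expR_ge0// normrZ ler_wpM2r//.
  rewrite -(subrK j^-1 (Jk Q k s)^-1) (le_trans (ler_normD _ _))// addrC lerD2l.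
  by rewrite (le_trans (ltW Jd)).
have u2 : `|u w1| <= 2 by rewrite (le_trans (norm_u_le _))//; lra.
have nC : `|nm (edge Q k s)| <= Cn.
  rewrite (le_trans (norm_nm_le _))// lerD2l (le_trans (normM_le _ _))// ler_wpM2l//.
  rewrite (le_trans _ (ler_norm r))// (le_trans _ nr)// ler_piMr//; exact: spin_norm.
pose P := nm (edge Q k s) *m h y *m u w1.
pose P' := nm (edge Q k s) *m h y'.
have PC : `|P| <= CP by apply: norm3M_le => //; exact: norm3M_le.
have de : \det (edge Q k s) = 1 by rewrite det_mulmx dn spin_det mulr1.
have dP1 : \det P = 1 by rewrite !det_mulmx det_nm det_h det_u de !mulr1.
have dP' : \det P' = 1 by rewrite !det_mulmx det_nm det_h de !mulr1.
have rep : same_lattice (G (st s + k%:R * t0 + v) *m h (sx (step Q k s))) (P *m B).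
  by apply: same_trans (step_far k v vs) _; exact: same_mull.
have dPB : \det (P *m B) = 1 by rewrite det_mulmx dP1 dB mulr1.
have dPB' : \det (P' *m B) = 1 by rewrite det_mulmx dP' dB mulr1.
split; first by exists (P *m B) => //; split=> //; exact: norm3M_le.
move=> /yy' {}yy' w1d.
rewrite (f_same f_int rep dPB).
have rep2 : same_lattice (nm (edge Q k s) *m homoclinic Q v) (P' *m B).
  by rewrite homoclinic_past mulmxA; exact: same_mull.
rewrite (f_same f_int rep2 dPB').
apply: dP => //.
- by apply: le_trans PC _; lra.
- by apply: le_trans Br _; lra.
apply: le_lt_trans deld.
have -> : P - P' = nm (edge Q k s) *m (h y *m (u w1 - u 0) + (h y - h y')).
  by rewrite /P /P' u0 mulmxDr !mulmxBr !mulmxA mulmx1 addrA subrK.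
rewrite (_ : del * K = 3 * (Cn * (3 * (Cy * del) + del * (`|A| * `|c21|)))); last first.
  by rewrite /K; ring.
apply: norm3M_le => //; rewrite (le_trans (ler_normD _ _))// lerD//.
  apply: norm3M_le => //; rewrite (le_trans (norm_uB _ _))// subr0; exact: ltW.
exact: le_trans (norm_hB _ _) _.
Qed.

End StepEstimates.

Section MatrixLimits.
Variables (R : realType) (T : Type) (F : set_system T).
Context {FF : Filter F}.

Lemma cvg_mulmx_cst m n p (A : T -> 'M[R]_(m, n)) (a : 'M[R]_(m, n)) (B : 'M[R]_(n, p)) :
  A x @[x --> F] --> a -> (A x *m B) @[x --> F] --> a *m B.
Proof.
move=> /cvgrPdist_lt Aa; apply/cvgrPdist_lt => e e0.
have C0 : 0 < n%:R * `|B| + 1 by rewrite ltr_wpDl// mulr_ge0.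
have : \forall x \near F, `|a - A x| < e / (n%:R * `|B| + 1) by apply: Aa; rewrite divr_gt0.
apply: filterS => x; rewrite ltr_pdivlMr// => h.
rewrite -mulmxBl; apply: le_lt_trans h; apply: le_trans (normM_le _ _) _.
by rewrite mulrDr mulr1 mulrCA lerDl.
Qed.

Lemma cst_cvg_mulmx m n p (A : T -> 'M[R]_(n, p)) (a : 'M[R]_(n, p)) (B : 'M[R]_(m, n)) :
  A x @[x --> F] --> a -> (B *m A x) @[x --> F] --> B *m a.
Proof.
move=> /cvgrPdist_lt Aa; apply/cvgrPdist_lt => e e0.
have C0 : 0 < n%:R * `|B| + 1 by rewrite ltr_wpDl// mulr_ge0.
have : \forall x \near F, `|a - A x| < e / (n%:R * `|B| + 1) by apply: Aa; rewrite divr_gt0.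
apply: filterS => x; rewrite ltr_pdivlMr// => h.
rewrite -mulmxBr; apply: le_lt_trans h; apply: le_trans (normM_le _ _) _.
by rewrite mulrDr mulr1 mulrA mulrC lerDl.
Qed.

Lemma cvg_entry m n (A : T -> 'M[R]_(m, n)) (a : 'M[R]_(m, n)) i j :
  A x @[x --> F] --> a -> A x i j @[x --> F] --> a i j.
Proof.
move=> /cvgrPdist_lt Aa; apply/cvgrPdist_lt => e e0.
apply: filterS (Aa e e0) => x; apply: le_lt_trans.
by have := le_mx_norm (a - A x) i j; rewrite !mxE.
Qed.

End MatrixLimits.

Section StepLimits.
Variables (R : realType) (Q : quasi_periodic R).
Let t0 := qp_t Q.
Let j := qp_j Q.
Let c21 := qp_c21 Q.
Let c12 := qp_c12 Q.
Let c22 := qp_c22 Q.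

(** As the contracted factor tends to 1, the product factored in step tends to a
    displacement of the second symmetry, and its factors to those of the latter. *)
Lemma step_limits (d : R) : 0 < d -> exists2 eta, 0 < eta & forall k s,
  `|wk Q k s| < eta -> [/\ 0 < Jk Q k s, `|(Jk Q k s)^-1 - j^-1| < d,
    `|ln (Jk Q k s) / 2 - sigma Q| < d, `|sw (step Q k s) - w_lim Q| < d &
    `|Num.sqrt (Jk Q k s) *: turn_back Q k s - kick Q| < d].
Proof.
move=> d0; have j0 : 0 < j := qp_j_gt0 Q.
have jN0 : j != 0 by rewrite gt_eqF.
pose J (w : 'rV[R]_2) := j + (w *m c21) 0 0.
pose W w := (J w)^-1 *: (c12 + w *m c22).
pose N w := Num.sqrt (J w) *: (c22 - (J w)^-1 *: (c21 *m (c12 + w *m c22))).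
have gen (F : set_system 'rV[R]_2) (FF : Filter F) : w @[w --> F] --> (0 : 'rV[R]_2) ->
    \forall w \near F, [/\ 0 < J w, `|(J w)^-1 - j^-1| < d,
     `|ln (J w) / 2 - sigma Q| < d, `|W w - w_lim Q| < d & `|N w - kick Q| < d].
  move=> w0.
  have cJ : J w @[w --> F] --> j.
    rewrite -[X in _ --> X]addr0; apply: cvgD; first exact: cvg_cst.
    have -> : 0 = ((0 : 'rV[R]_2) *m c21) 0 0 by rewrite mul0mx mxE.
    by apply: cvg_entry; exact: cvg_mulmx_cst.
  have cJV : (J w)^-1 @[w --> F] --> j^-1 by exact: cvgV.
  have cb : (c12 + w *m c22) @[w --> F] --> c12.
    rewrite -[X in _ --> X]addr0; apply: cvgD; first exact: cvg_cst.
    by rewrite -[X in _ --> X](mul0mx _ c22); exact: cvg_mulmx_cst.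
  have cW : W w @[w --> F] --> w_lim Q by exact: cvgZ.
  have cln : ln (J w) / 2 @[w --> F] --> sigma Q.
    apply: cvgMr_tmp; apply: (cvg_comp _ _ cJ); exact: continuous_ln.
  have cS : Num.sqrt (J w) @[w --> F] --> Num.sqrt j.
    by apply: (cvg_comp _ _ cJ); exact: sqrt_continuous.
  have cN : N w @[w --> F] --> kick Q.
    apply: cvgZ => //; apply: cvgB; first exact: cvg_cst.
    by apply: cvgZ => //; exact: cst_cvg_mulmx.
  have e1 : \forall w \near F, 0 < J w by apply: cvgr_gt cJ _ j0.
  near=> w; split.
  - by near: w.
  - by near: w; apply: cvgr_distC_lt.
  - by near: w; apply: cvgr_distC_lt.
  - by near: w; apply: cvgr_distC_lt.
  - by near: w; apply: cvgr_distC_lt.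
have := gen (nbhs (0 : 'rV[R]_2)) (nbhs_filter _) cvg_id.
move=> /nbhs_ballP[eta /= eta0 H]; exists eta => // k s ks.
by apply: (H (wk Q k s)); rewrite mx_norm_ball /= sub0r normrN.
Unshelve. all: by end_near. Qed.

Lemma decay (C d : R) : 0 < d -> exists K, forall k, (K <= k)%N ->
  expR (- (k%:R * t0)) * C < d.
Proof.
move=> d0; have t0_gt0 : 0 < t0 := qp_t_gt0 Q.
exists (Num.trunc ((`|C| / d) / t0)).+1 => k hk.
have h1 : `|C| / d < k%:R * t0.
  rewrite -ltr_pdivrMr//; apply: lt_le_trans (truncnS_gt _) _.
  by rewrite ler_nat.
rewrite expRN mulrC ltr_pdivrMr ?expR_gt0//.
apply: le_lt_trans (ler_norm _) _; rewrite mulrC -ltr_pdivrMr//.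
by apply: lt_le_trans h1 _; apply: le_trans (expR_ge1Dx _); rewrite lerDr.
Qed.

End StepLimits.

Section StepHeights.
Variables (R : realType) (Q : quasi_periodic R) (f : 'M[R]_3 -> R).
Hypothesis f_int : lattice_invariant f.
Hypothesis f_unif : unif_continuous_on_balls f.
Hypothesis f_bounded : bounded_on_balls f.
Let t0 := qp_t Q.
Let j := qp_j Q.
Let c21 := qp_c21 Q.
Let E := edge_max Q f.

Definition near_bounded T x r := exists2 B, same_lattice (G T *m h x) B &
  \det B = 1 /\ `|B| <= r :> R.

Lemma norm_edge_le k (s : state R) (r : R) : `|sn s| <= r -> `|edge Q k s| <= 2 * r.
Proof.
move=> nr; rewrite (le_trans (normM_le _ _))// ler_wpM2l// (le_trans _ nr)//.
by rewrite ler_piMr// spin_norm.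
Qed.

(** After an excursion with displacement e0, wait for a large number k of periods and make
    the next one: the point x moves by an amount negligible even after expansion up to time
    st s, the heights between the two moments are at most the costs of the two excursions,
    and the new homoclinic orbit is followed on an interval of prescribed length V. The
    interval of times is cut after half of the waiting time, where tail_close gives way to
    peak_close. *)
Lemma step_heights (r : R) : exists r' (rho : R -> R), forall e : R, 0 < e ->
  exists2 d, 0 < d & forall s e0 V,
  valid Q s -> \det e0 = 1 -> `|sn s| <= r ->
  `|sn s - e0 *m kick Q| < d -> `|sw s - w_lim Q| < d ->
  exists K, forall k, (K <= k)%N -> [/\ 0 < Jk Q k s,
    st s + 1 <= st (step Q k s) /\
      st s + k%:R * t0 <= st (step Q k s) + (1 - sigma Q),
    expR (3 * st s) * `|sx (step Q k s) - sx s| <= e,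
    forall T, st s <= T <= st (step Q k s) ->
      near_bounded T (sx (step Q k s)) r' /\
      f (G T *m h (sx (step Q k s))) <= Num.max (E e0) (E (edge Q k s)) + e &
    forall v, `|v| <= V ->
      near_bounded (st s + k%:R * t0 + v) (sx (step Q k s)) (rho v) /\
      `|f (G (st s + k%:R * t0 + v) *m h (sx (step Q k s)))
        - f (nm (edge Q k s) *m homoclinic Q v)| < e].
Proof.
have ar1 (a : R) : 0 <= a -> 0 - 3 * a <= - a by lra.
have ar2 (a s : R) : - a < s - 2 -> 2 - s < a by lra.
have ar3 (a s l : R) : 2 - s < a -> s - 1 < l -> 1 <= a + l by lra.
have ar4 (a t : R) : 0 <= a -> 3 * t + - (3 * (t + a)) <= - a by lra.
have ar5 (a x : R) : 0 <= a -> x <= a / 2 -> 3 * (x - a) <= - a by lra.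
have ar6 (a t l s T : R) : T <= t + a + l -> l < s + 1 -> T - (t + a) <= s + 1 by lra.
have ar7 (a t T : R) : 0 <= a -> a / 2 < T - t -> - (3 * (T - (t + a))) - 3 * a <= - a.
  by lra.
have ar8 (a v V : R) : 0 <= a -> - v <= V -> - (3 * v) - 3 * a <= - a + 3 * V by lra.
have ar9 (s l : R) : s - 1 < l -> 0 <= l + (1 - s) by lra.
have [r1 tailP] := tail_close Q f_int f_unif r.
have [rho0 peakP] := peak_close Q f_int f_unif r.
pose A0 := expR (3 * (sigma Q + 1)).
exists (Num.max r1 (rho0 A0)), (fun v => rho0 (expR (3 * v))) => e e0.
have [d1 d10 tailP1] := tailP e e0.
have [d2 d20 peakP2] := peakP A0 e e0.
exists d1 => // s e1 V vs de1 nr nd wd.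
have [d3 d30 peakP3] := peakP (expR (3 * V)) e e0.
pose d := Num.min 1 (Num.min d2 d3).
have d_gt0 : 0 < d by rewrite !lt_min ltr01 d20 d30.
have [eta eta0 limP] := step_limits Q d_gt0.
pose Cz := (`|j^-1| + 1) * (2 * (2 * r * `|c21|)).
have r0 : 0 <= r by exact: le_trans nr.
have Cz0 : 0 <= Cz by rewrite !mulr_ge0// ?addr_ge0.
have [K1 K1P] := decay Q (2 * `|sw s|) eta0.
have [K2 K2P] := decay Q Cz d10.
have [K3 K3P] := decay Q Cz e0.
have [K4 K4P] := decay Q 1 (expR_gt0 (sigma Q - 2)).
have [K5 K5P] := decay Q (2 * `|sw s|) d_gt0.
have [K6 K6P] := decay Q (expR (3 * V) * (2 * `|sw s|)) d_gt0.
exists (maxn K1 (maxn K2 (maxn K3 (maxn K4 (maxn K5 K6))))) => k.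
rewrite !geq_max => /and5P[/K1P k1 /K2P k2 /K3P k3 /K4P k4 /andP[/K5P k5 /K6P k6]].
set a := k%:R * t0 in k1 k2 k3 k4 k5 k6.
have a0 : 0 <= a by rewrite mulr_ge0// ltW// qp_t_gt0.
have a2 : 2 - sigma Q < a.
  by move: k4; rewrite mulr1 ltr_expR; exact: ar2.
have swk : `|sw s *m spin Q k| <= 2 * `|sw s|.
  by rewrite (le_trans (normM_le _ _))// ler_wpM2l// ler_piMr// spin_norm.
have wkE b : `|expR b *: wk Q k s| <= expR (b - 3 * a) * (2 * `|sw s|).
  rewrite /wk scalerA -expRD normrZ ger0_norm ?expR_ge0//.
  by rewrite ler_wpM2l// expR_ge0.
have wk1 : `|wk Q k s| < eta.
  have := wkE 0; rewrite expR0 scale1r => /le_lt_trans; apply; apply: le_lt_trans k1.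
  by rewrite ler_wpM2r ?mulr_ge0// ler_expR; exact: ar1.
have [J0 JV lnJ _ _] := limP k s wk1.
have JV1 : `|(Jk Q k s)^-1 - j^-1| < 1.
  by apply: lt_le_trans JV _; rewrite ge_min lexx.
have JV2 : `|(Jk Q k s)^-1 - j^-1| < d2.
  by apply: lt_le_trans JV _; rewrite !ge_min lexx !orbT.
have JV3 : `|(Jk Q k s)^-1 - j^-1| < d3.
  by apply: lt_le_trans JV _; rewrite !ge_min lexx !orbT.
have lnJ1 : `|ln (Jk Q k s) / 2 - sigma Q| < 1.
  by apply: lt_le_trans lnJ _; rewrite ge_min lexx.
have {lnJ lnJ1} [l1 l2] : sigma Q - 1 < ln (Jk Q k s) / 2 /\
    ln (Jk Q k s) / 2 < sigma Q + 1.
  by move: lnJ1; rewrite ltr_distl => /andP[].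
have zC : `|(Jk Q k s)^-1 *: (edge Q k s *m c21)| <= Cz.
  rewrite normrZ ler_pM//.
    rewrite -(subrK j^-1 (Jk Q k s)^-1) (le_trans (ler_normD _ _))// addrC lerD2l.
    exact: ltW.
  by rewrite (le_trans (normM_le _ _))// ler_wpM2l// ler_wpM2r// norm_edge_le.
have dd w : `|w| < d -> [/\ `|w| < 1, `|w| < d2 & `|w| < d3 :> R].
  by rewrite !lt_min => /and3P.
split => //.
- split; first by rewrite /= -addrA lerD2l -/t0 -/a; exact: ar3 l1.
  by rewrite /= -/t0 -/a -addrA lerDl; exact: ar9.
- rewrite /= addrC addKr normrZ ger0_norm ?expR_ge0// mulrA -expRD.
  rewrite -/c21 -/t0 -/a; apply: ltW; apply: le_lt_trans k3.
  by rewrite ler_pM ?expR_ge0// ler_expR; exact: ar4.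
- move=> T /andP[T1 T2].
  have [Ta|Ta] := leP (T - st s) (a / 2).
    have tau0 : 0 <= T - st s by rewrite subr_ge0.
    have hz : `|expR (3 * (T - st s - k%:R * t0)) *:
        ((Jk Q k s)^-1 *: (edge Q k s *m c21))| < d1.
      rewrite normrZ ger0_norm ?expR_ge0//; apply: le_lt_trans k2.
      by rewrite ler_pM ?expR_ge0// ler_expR -/a; exact: ar5.
    have := tailP1 s e1 k (T - st s) vs de1 nr tau0 hz nd wd.
    rewrite addrCA subrr addr0 => -[close [B sB [dB Br]]]; split.
      by exists B => //; split => //; rewrite le_max Br.
    have := edge_max_ge Q f_int f_bounded (T - st s + sigma Q) de1.
    move: close; rewrite ltr_distl => /andP[_ close] le1.
    by apply: (le_trans (ltW close)); rewrite lerD2r le_max (le_trans le1).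
  pose v := T - (st s + a).
  have TE : T = st s + a + v by rewrite /v addrC subrK.
  have vA : expR (3 * v) <= A0.
    by rewrite ler_expR ler_pM2l//; move: T2; rewrite /= -/t0 -/a /v; move/ar6; apply.
  have [w1 w2 _] : [/\ `|expR (- (3 * v)) *: wk Q k s| < 1,
      `|expR (- (3 * v)) *: wk Q k s| < d2 & `|expR (- (3 * v)) *: wk Q k s| < d3].
    apply: dd; apply: le_lt_trans (wkE _) _; apply: le_lt_trans k5.
    by rewrite ler_wpM2r ?mulr_ge0// ler_expR /v; exact: ar7.
  have [[B sB [dB Br]] close] := peakP2 s k v vs nr vA JV1 w1.
  have {close} := close JV2 w2; rewrite -/t0 -/a -TE => close.
  rewrite -/t0 -/a -TE in sB; split.
    by exists B => //; split => //; rewrite le_max Br orbT.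
  have de : \det (edge Q k s) = 1 by rewrite det_mulmx (proj1 vs) spin_det mulr1.
  have := edge_max_ge Q f_int f_bounded v de.
  move: close; rewrite ltr_distl => /andP[_ close] le1.
  apply: (le_trans (ltW close)); rewrite lerD2r; apply: le_trans le1 _.
  by rewrite le_max lexx orbT.
- move=> v vV.
  have vV3 : expR (3 * v) <= expR (3 * V).
    by rewrite ler_expR ler_pM2l// (le_trans (ler_norm _)).
  have [w1 _ w3] : [/\ `|expR (- (3 * v)) *: wk Q k s| < 1,
      `|expR (- (3 * v)) *: wk Q k s| < d2 & `|expR (- (3 * v)) *: wk Q k s| < d3].
    apply: dd; apply: le_lt_trans (wkE _) _; apply: le_lt_trans k6.
    rewrite mulrA -expRD ler_wpM2r ?mulr_ge0// ler_expR.
    by apply: ar8 => //; apply: le_trans vV; rewrite -normrN ler_norm.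
  have [_ close] := peakP3 s k v vs nr vV3 JV1 w1.
  have [d' _ P'] := peakP (expR (3 * v)) e e0.
  have [bd _] := P' s k v vs nr (lexx _) JV1 w1.
  by split; [exact: bd|exact: close].
Qed.

End StepHeights.

(** * The limit superior along a chain of excursions *)

Section Chains.
Variables (R : realType) (Q : quasi_periodic R) (f : 'M[R]_3 -> R).
Hypothesis f_int : lattice_invariant f.
Hypothesis f_unif : unif_continuous_on_balls f.
Hypothesis f_bounded : bounded_on_balls f.
Let t0 := qp_t Q.
Let E := edge_max Q f.

Lemma nested_limit (a b : nat -> R) :
  (forall n m, (n <= m)%N -> `|a m - a n| <= b n) ->
  exists l, forall n, `|l - a n| <= b n.
Proof.
move=> ab.
have b0 n : 0 <= b n by apply: le_trans (ab n n (leqnn n)).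
have key n m : a n - b n <= a m + b m.
  have [/ab|/ltnW/ab] := leqP n m; rewrite ler_distl => /andP[h1 h2].
    by apply: le_trans h1 _; rewrite lerDl.
  by rewrite lerBlDr; apply: le_trans h2 _; rewrite lerDl.
have hs : has_sup (range (fun n => a n - b n)).
  split; first by exists (a 0%N - b 0%N), 0%N.
  by exists (a 0%N + b 0%N) => _ [n _ <-].
exists (sup (range (fun n => a n - b n))) => n; rewrite ler_distl; apply/andP; split.
  by apply: ub_le_sup; [case: hs|exists n].
by apply: ge_sup; [case: hs|move=> _ [m _ <-]].
Qed.

Lemma nested_limit_col (a : nat -> 'cV[R]_2) (b : nat -> R) :
  (forall n m, (n <= m)%N -> `|a m - a n| <= b n) ->
  exists l, forall n, `|l - a n| <= b n.
Proof.
move=> ab.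
have H i : exists l, forall n, `|l - a n i 0| <= b n.
  apply: nested_limit => n m nm; apply: le_trans (ab n m nm).
  by have := le_mx_norm (a m - a n) i 0; rewrite !mxE.
have [l lP] := choice H.
exists (\col_i l i) => n; apply: mx_norm_le.
  by apply: le_trans (ab n n (leqnn n)).
by move=> i i'; rewrite !ord1 !mxE.
Qed.

Lemma half_pow_cvg (e : R) : 0 < e -> exists N, forall i, (N <= i)%N -> 2^-1 ^+ i < e.
Proof.
move=> e0; have h1 : `|2^-1| < 1 :> R by rewrite ger0_norm ?invr_ge0// invf_lt1// ltr1n.
have /cvgrPdist_lt /(_ _ e0) [N _ NP] := cvg_expr h1.
by exists N => i /NP /=; rewrite sub0r normrN ger0_norm// exprn_ge0// invr_ge0.
Qed.

(** What one step of the construction, taken at stage i from the pair of a state and of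
    the edge that led to it, must achieve. *)
Definition good_step (s r' : R) (rho : R -> R) i (p : state R * 'M[R]_2) k :=
  let p' := step Q k p.1 in
  [/\ \det (edge Q k p.1) = 1,
    st p.1 + 1 <= st p' /\ st p.1 + k%:R * t0 <= st p' + (1 - sigma Q),
    expR (3 * st p.1) * `|sx p' - sx p.1| <= 2^-1 ^+ i,
    E (edge Q k p.1) <= s + 2^-1 ^+ i /\
    forall T, st p.1 <= T <= st p' -> near_bounded T (sx p') r' /\
      f (G T *m h (sx p')) <= Num.max (E p.2) (E (edge Q k p.1)) + 2^-1 ^+ i &
    forall v, `|v| <= i%:R ->
      near_bounded (st p.1 + k%:R * t0 + v) (sx p') (rho v) /\
      `|f (G (st p.1 + k%:R * t0 + v) *m h (sx p'))
        - f (nm (edge Q k p.1) *m homoclinic Q v)| < 2^-1 ^+ i].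

Definition limsup_height x (s : R) :=
  (forall e, 0 < e -> exists T0, forall T, T0 <= T -> f (G T *m h x) <= s + e) /\
  (forall e, 0 < e -> forall T0, exists2 T, T0 <= T & s - e < f (G T *m h x)).

(** Moving x to x' multiplies the lattice at time T by a horospherical matrix expanded by
    exp (3 T). *)
Lemma near_bounded_h (r e : R) : 0 < e -> exists2 d, 0 < d & forall T x x',
  near_bounded T x' r -> `|expR (3 * T) *: (x - x')| < d ->
  `|f (G T *m h x') - f (G T *m h x)| < e.
Proof.
move=> e0; have [d d0 dP] := f_unif_mul f_unif (1 + `|r|) e0.
exists d => // T x x' [B sB [dB Br]] xd.
have -> : G T *m h x = h (expR (3 * T) *: (x - x')) *m (G T *m h x').
  by rewrite mulmxA -G_h -mulmxA -hD subrK.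
rewrite (f_same f_int sB dB) (f_same f_int (same_mull _ sB)); last first.
  by rewrite det_mulmx det_h dB mulr1.
rewrite -[B in f B]mul1mx -h0.
apply: dP; rewrite ?det_h//.
- by rewrite h0 (le_trans (norm_1mx_le1 _ 3))// lerDl.
- by rewrite (le_trans Br)// (le_trans (ler_norm _))// lerDr.
- by apply: le_lt_trans (norm_hB _ _) _; rewrite sub0r normrN.
Qed.

(** If every stage of the invariant I can be continued by a good step, the successive points
    converge so fast that the limit x has, up to time st of stage i, the heights of stage i.
    Costs at most s + 2^-i give the upper bound. The lower bound comes from the stages in
    targets, whose excursions follow more and more of the homoclinic orbit displaced by e0,
    of cost at least s. *)
Lemma chain_limsup (s r' : R) (rho : R -> R) (I : nat -> state R * 'M[R]_2 -> Prop)
    (e0 : 'M[R]_2) (targets : nat -> Prop) p0 :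
  I 0%N p0 ->
  (forall i p, I i p -> exists2 k, I i.+1 (step Q k p.1, edge Q k p.1) &
    good_step s r' rho i p k /\ (targets i -> `|edge Q k p.1 - e0| < 2^-1 ^+ i)) ->
  (forall N, exists2 i, (N <= i)%N & targets i) ->
  \det e0 = 1 -> s <= E e0 ->
  exists x, limsup_height x s.
Proof.
have arU (a b M p e : R) : a - e / 3 < b -> b <= M + p -> M <= s + e / 3 ->
    p < e / 3 -> a <= s + e by lra.
have arL1 (T0 v t' n t'' a : R) : T0 - v - t' <= n -> t' + n <= t'' -> 0 <= a ->
    T0 <= t'' + a + v by lra.
have arL2 (t' a b v c : R) : t' + a <= b + c -> t' + a + v - b <= v + c by lra.
have arL3 (a b c d p e : R) : b < a + e / 4 -> d < c + e / 4 -> c - p < b ->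
    p < e / 4 -> s - e / 4 < d -> s - e < a by lra.
move=> I0 IS targ de0 sE.
pose nxt k (p : state R * 'M[R]_2) := (step Q k p.1, edge Q k p.1).
have /choice[F FP] : forall ip : nat * (state R * 'M[R]_2), exists k, I ip.1 ip.2 ->
    I ip.1.+1 (nxt k ip.2) /\ (good_step s r' rho ip.1 ip.2 k /\
      (targets ip.1 -> `|edge Q k ip.2.1 - e0| < 2^-1 ^+ ip.1)).
  move=> [i p] /=; have [Ip|nI] := pselect (I i p).
    by have [k Ik gk] := IS i p Ip; exists k.
  by exists 0%N => /nI.
(* Stages are pairs of a state and of the displacement of the excursion that led to it. *)
pose q := fix q i := if i is i'.+1 then nxt (F (i', q i')) (q i') else p0.
have qI i : I i (q i) by elim: i => [//|i /(FP (i, q i))[]].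
pose k i := F (i, q i).
have gd i : good_step s r' rho i (q i) (k i) by have [_ []] := FP (i, q i) (qI i).
have tg i : targets i -> `|edge Q (k i) (q i).1 - e0| < 2^-1 ^+ i.
  by have [_ []] := FP (i, q i) (qI i).
pose t i := st (q i).1; pose x_ i := sx (q i).1.
have xE i : x_ i.+1 = sx (step Q (k i) (q i).1) by [].
have tE i : t i.+1 = st (step Q (k i) (q i).1) by [].
have t1 i : t i + 1 <= t i.+1 by have [_ []] := gd i.
have tmon n m : (n <= m)%N -> t n <= t m.
  elim: m => [|m IH]; first by rewrite leqn0 => /eqP ->.
  rewrite leq_eqVlt => /predU1P[->//|]; rewrite ltnS => /IH h; apply: (le_trans h).
  by apply: le_trans (t1 m); rewrite lerDl.
have tbig i : t 0%N + i%:R <= t i.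
  elim: i => [|i IH]; first by rewrite addr0.
  by apply: le_trans (t1 i); rewrite -natr1 addrA lerD2r.
have pw0 i : 0 <= (2^-1 : R) ^+ i by rewrite exprn_ge0// invr_ge0.
have xd n m : (n <= m)%N ->
    `|x_ m - x_ n| <= expR (- (3 * t n)) * (2 * 2^-1 ^+ n - 2 * 2^-1 ^+ m).
  elim: m => [|m IH].
    by rewrite leqn0 => /eqP ->; rewrite !subrr normr0 mulr0.
  rewrite leq_eqVlt => /predU1P[<-|]; first by rewrite !subrr normr0 mulr0.
  rewrite ltnS => nm; rewrite -(subrKA (x_ m)) (le_trans (ler_normD _ _))//.
  have step1 : `|x_ m.+1 - x_ m| <= expR (- (3 * t n)) * 2^-1 ^+ m.
    have [_ _ h1 _ _] := gd m; rewrite expRN -ler_pdivrMl ?invr_gt0 ?expR_gt0// invrK.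
    apply: le_trans h1; apply: ler_wpM2r => //.
    by rewrite ler_expR ler_pM2l// tmon.
  have -> : expR (- (3 * t n)) * (2 * 2^-1 ^+ n - 2 * 2^-1 ^+ m.+1) =
     expR (- (3 * t n)) * 2^-1 ^+ m +
     expR (- (3 * t n)) * (2 * 2^-1 ^+ n - 2 * 2^-1 ^+ m).
    by rewrite exprS; field.
  by rewrite lerD// IH.
have [x xP] : exists x, forall n, `|x - x_ n| <= expR (- (3 * t n)) * (2 * 2^-1 ^+ n).
  apply: nested_limit_col => n m nm; apply: le_trans (xd n m nm) _.
  by rewrite ler_wpM2l ?expR_ge0// lerBlDr lerDl mulr_ge0.
have xT i T : `|expR (3 * T) *: (x - x_ i.+1)| <= expR (3 * (T - t i.+1)) * 2^-1 ^+ i.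
  rewrite normrZ ger0_norm ?expR_ge0//.
  apply: le_trans (ler_wpM2l (expR_ge0 _) (xP i.+1)) _.
  rewrite mulrA -expRD exprS mulrA divff// mul1r ler_wpM2r// ler_expR.
  by rewrite le_eqVlt; apply/orP; left; apply/eqP; ring.
exists x; split => e e_gt0.
  have e30 : 0 < e / 3 by rewrite divr_gt0.
  have [d d0 dP] := near_bounded_h r' e30.
  have [N1 N1P] := half_pow_cvg d0; have [N2 N2P] := half_pow_cvg e30.
  pose N := (maxn N1 N2).+1; exists (t N) => T TN.
  have [i iN /andP[i1 i2]] : exists2 i, (N <= i)%N & t i <= T <= t i.+1.
    have ex : exists n, T <= t (N + n)%N.
      exists (Num.trunc (T - t 0%N)).+1; apply: le_trans (tbig _).
      rewrite -lerBlDl; apply: (le_trans (ltW (truncnS_gt _))).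
      by rewrite ler_nat leq_addl.
    case: (ex_minnP ex) => m mT mmin.
    case: m mT mmin => [|m] mT mmin.
      exists N => //; rewrite TN /=; apply: le_trans (tmon _ _ (leqnSn _)).
      by rewrite addn0 in mT.
    exists (N + m)%N; first exact: leq_addr.
    rewrite -addnS mT andbT leNgt; apply/negP => /ltW h.
    by have := mmin _ h; rewrite ltnn.
  case: i iN i1 i2 => [//|i]; rewrite /N ltnS geq_max => /andP[/N1P iN1 iN2] i1 i2.
  have [_ _ _ [Ei _] _] := gd i.
  have [_ _ _ [Ei1 traj] _] := gd i.+1.
  have [|nb] := traj T; first by rewrite -tE; apply/andP.
  rewrite -xE => fT.
  have : `|f (G T *m h (x_ i.+2)) - f (G T *m h x)| < e / 3.
    rewrite xE; apply: (dP T x _ nb); rewrite -xE; apply: le_lt_trans (xT _ _) _.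
    apply: le_lt_trans iN1; rewrite exprS mulrA ler_piMl// mulr_ile1 ?expR_ge0//.
      by rewrite -[leRHS]expR0 ler_expR pmulr_rle0// subr_le0.
    by rewrite invf_le1// ler1n.
  have p1 : 2^-1 ^+ i < e / 3 by exact: N2P.
  have p2 : 2^-1 ^+ i.+1 < e / 3 by apply: N2P; exact: leqW.
  rewrite ltr_distl => /andP[h1 _].
  have h2 : Num.max (E (q i.+1).2) (E (edge Q (k i.+1) (q i.+1).1)) <= s + e / 3.
    rewrite ge_max; apply/andP; split.
      by apply: le_trans Ei _; rewrite lerD2l ltW.
    by apply: le_trans Ei1 _; rewrite lerD2l ltW.
  exact: arU h1 fT h2 p2.
move=> T0.
have e40 : 0 < e / 4 by rewrite divr_gt0.
have [v vE] := edge_max_adherent Q f_int f_bounded de0 e40.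
have [r1 r10 rP] := homoclinic_bounded Q.
have [B sB [dB Br]] := rP v.
have [d1 d10 dP1] := near_bounded_h (rho v) e40.
have [d2 d20 dP2] := f_unif_mul f_unif (1 + (`|e0| + 1) + r1) e40.
have d30 : 0 < d1 / expR (3 * (v + (1 - sigma Q))) by rewrite divr_gt0// expR_gt0.
have [N1 N1P] := half_pow_cvg d30.
have [N2 N2P] := half_pow_cvg d20.
have [N3 N3P] := half_pow_cvg e40.
pose N4 := (Num.trunc `|v|).+1.
pose N5 := (Num.trunc (T0 - v - t 0%N)).+1.
have [i] := targ (maxn N1 (maxn N2 (maxn N3 (maxn N4 N5)))).
rewrite !geq_max => /and5P[/N1P i1 /N2P i2 /N3P i3 i4 i5] ti.
have [de [_ tk] _ _ peak] := gd i.
have vi : `|v| <= i%:R.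
  by apply: (le_trans (ltW (truncnS_gt _))); rewrite ler_nat.
have [nb fv] := peak v vi.
pose T := st (q i).1 + (k i)%:R * t0 + v.
exists T.
  have a0 : 0 <= (k i)%:R * t0 by rewrite mulr_ge0// ltW// qp_t_gt0.
  have h1 := tbig i.
  have h2 : T0 - v - t 0%N <= i%:R.
    by apply: (le_trans (ltW (truncnS_gt _))); rewrite ler_nat.
  exact: arL1 h2 h1 a0.
have h1 : `|f (G T *m h (x_ i.+1)) - f (G T *m h x)| < e / 4.
  rewrite xE; apply: (dP1 T x _ nb); rewrite -xE; apply: le_lt_trans (xT _ _) _.
  move: i1; rewrite ltr_pdivlMr ?expR_gt0// mulrC => i1; apply: le_lt_trans i1.
  rewrite ler_wpM2r// ler_expR ler_pM2l//.
  exact: arL2 tk.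
have H e1 : \det e1 = 1 -> f (nm e1 *m homoclinic Q v) = f (nm e1 *m B).
  move=> de1; apply: (f_same f_int); first exact: same_mull.
  by rewrite det_mulmx det_nm de1 dB mulr1.
have h2 : `|f (nm e0 *m homoclinic Q v) - f (nm (edge Q (k i) (q i).1) *m homoclinic Q v)|
    < e / 4.
  rewrite !H//; apply: dP2; rewrite ?det_nm//.
  - by rewrite (le_trans (norm_nm_le _))//; have := normr_ge0 e0; lra.
  - by rewrite (le_trans Br)//; have := normr_ge0 e0; lra.
  - apply: le_lt_trans (norm_nmB _ _) _; rewrite distrC; apply: lt_trans i2; exact: tg.
have vE' : s - e / 4 < f (nm e0 *m homoclinic Q v).
  by apply: le_lt_trans vE; rewrite lerB.
move: h1 h2 fv; rewrite !ltr_distl => /andP[_ h1] /andP[_ h2] /andP[h3 _].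
exact: arL3 h1 h2 h3 i3 vE'.
Qed.

End Chains.

(** * Reaching prescribed displacements *)

Lemma frob_perturb (R : realType) (Y : 'M[R]_2) : `|Y| <= 1 ->
  frob (1%:M + Y) <= 2 + 8 * `|Y|.
Proof.
have Yij i j : - `|Y| <= Y i j <= `|Y| by rewrite -ler_norml le_mx_norm.
rewrite /frob !mxE /=.
move: (`|Y|) (Yij 0 0) (Yij 0 1) (Yij 1 0) (Yij 1 1) => d.
move: (Y 0 0) (Y 0 1) (Y 1 0) (Y 1 1) => a b c e.
move=> /andP[a1 a2] /andP[b1 b2] /andP[c1 c2] /andP[e1 e2] d1.
have sq x : - d <= x -> x <= d -> x ^+ 2 <= d by move=> x1 x2; nra.
have := sq a a1 a2; have := sq b b1 b2; have := sq c c1 c2; have := sq e e1 e2.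
rewrite !mulr1n !mulr0n !add0r => *; lra.
Qed.

Section Control.
Variables (R : realType) (Q : quasi_periodic R) (f : 'M[R]_3 -> R).
Hypothesis f_int : lattice_invariant f.
Hypothesis f_unif : unif_continuous_on_balls f.
Hypothesis f_bounded : bounded_on_balls f.
Hypothesis irr : forall k (l : int), (0 < k)%N ->
  k%:R * qp_theta Q != l%:~R * (2 * pi).
Variables (mu beta : R).
Hypotheses (mu0 : 0 < mu) (mu1 : mu < 1).
Hypothesis kickE : kick Q = mx2 mu beta 0 mu^-1.
Let D := kick Q.
Let t0 := qp_t Q.

Lemma norm2_le (A B : 'M[R]_2) (a b : R) :
  `|A| <= a -> `|B| <= b -> `|A *m B| <= 2 * (a * b).
Proof. by move=> Aa Bb; rewrite (le_trans (normM_le _ _))// ler_wpM2l// ler_pM. Qed.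

Lemma norm_mul_rot (A : 'M[R]_2) x : `|A *m rotmx x| <= 2 * `|A|.
Proof.
by rewrite (le_trans (norm2_le (lexx _) (norm_rotmx_le1 x)))// mulr1.
Qed.

(** Density of the powers of the rotation allows any turn phi; waiting long enough makes the
    contracted factor negligible, so that the excursion multiplies by D up to d. *)
Lemma control (s : state R) (phi d : R) K0 : valid Q s -> 0 < d ->
  exists2 k, (K0 <= k)%N & [/\ `|edge Q k s - sn s *m rotmx phi| < d,
    `|sn (step Q k s) - edge Q k s *m D| < d,
    `|sw (step Q k s) - w_lim Q| < d & 0 < Jk Q k s].
Proof.
move=> vs d0; pose C := 4 * `|sn s| + 1.
have C1 : 1 <= C by rewrite lerDr mulr_ge0.
have C0 : 0 < C by exact: lt_le_trans C1.
pose d1 := d / C.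
have d10 : 0 < d1 by rewrite divr_gt0.
have d1d : d1 <= d by rewrite ler_pdivrMr// ler_peMr// ltW.
have [eta eta0 limP] := step_limits Q d10.
have [K1 K1P] := decay Q (2 * `|sw s|) eta0.
have [k] := rotmx_dense irr phi (maxn K0 K1) d10.
rewrite geq_max => /andP[k0 /K1P k1] kd; exists k => //.
have wks : `|wk Q k s| < eta.
  apply: le_lt_trans k1; rewrite /wk normrZ ger0_norm ?expR_ge0//.
  rewrite ler_pM ?expR_ge0//.
    have : 0 <= k%:R * t0 by rewrite mulr_ge0// ltW// qp_t_gt0.
    by move=> a0; rewrite ler_expR lerN2 ler_peMl// ler1n.
  by rewrite (le_trans (normM_le _ _))// ler_wpM2l// ler_piMr// spin_norm.
have [J0 _ _ wd nd] := limP k s wks.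
have small (X : 'M[R]_2) : `|X| < d1 -> 4 * `|sn s| * `|X| < d.
  rewrite ltr_pdivlMr// => h; apply: le_lt_trans h; rewrite mulrC ler_wpM2l//.
  by rewrite lerDl.
split => //.
- rewrite -mulmxBr; apply: le_lt_trans (small _ kd).
  rewrite (le_trans (normM_le _ _))// mulrA ler_wpM2r// ler_wpM2r//.
  by rewrite ler_nat.
- rewrite /= -mulmxBr; apply: le_lt_trans (small _ nd).
  rewrite (le_trans (normM_le _ _))// mulrA ler_wpM2r//.
  apply: (@le_trans _ _ (2 * (2 * `|sn s|))); last by rewrite mulrA -natrM.
  by rewrite ler_wpM2l// norm_edge_le.
- exact: lt_le_trans d1d.
Qed.

Lemma det_edge k s : valid Q s -> \det (edge Q k s) = 1.
Proof. by move=> [dn _]; rewrite det_mulmx dn spin_det mulr1. Qed.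

(** Limits of displacements just left by an excursion: the contracted factor is required to
    be near its limit, as in step_heights. *)
Definition attainable n := forall d, 0 < d -> exists2 s, valid Q s &
  `|sn s - n| < d /\ `|sw s - w_lim Q| < d.

Lemma attainable_step n phi :
  (forall d, 0 < d -> exists2 s, valid Q s & `|sn s - n| < d) ->
  attainable (n *m rotmx phi *m D).
Proof.
move=> An d d0; pose d1 := d / (12 * (`|D| + 1)).
have C0 : 0 < `|D| + 1 by rewrite ltr_wpDl.
have d10 : 0 < d1 by rewrite divr_gt0// mulr_gt0.
have d1E : d = 12 * (d1 * `|D|) + 12 * d1 by rewrite /d1; field; rewrite gt_eqF.
have dD0 : 0 <= d1 * `|D| by rewrite mulr_ge0// ltW.
have [s vs sd] := An _ d10.
have [k _ [h1 h2 h3 J0]] := control phi 0 vs d10.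
exists (step Q k s); first exact: step_valid.
split; last by apply: (lt_trans h3); lra.
pose X := edge Q k s - sn s *m rotmx phi + (sn s - n) *m rotmx phi.
have XE : edge Q k s - n *m rotmx phi = X by rewrite /X mulmxBl addrA subrK.
have -> : sn (step Q k s) - n *m rotmx phi *m D =
    sn (step Q k s) - edge Q k s *m D + X *m D by rewrite -XE mulmxBl addrA subrK.
rewrite (le_lt_trans (ler_normD _ _))//.
have Xd : `|X| <= 3 * d1.
  rewrite (le_trans (ler_normD _ _))// (_ : 3 * d1 = d1 + 2 * d1); last by ring.
  apply: lerD; first exact: ltW.
  by apply: (le_trans (norm_mul_rot _ _)); rewrite ler_wpM2l// ltW.
by have := norm2_le Xd (lexx `|D|); lra.
Qed.

Lemma attainable_word n phi psi K : (0 < K)%N ->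
  (forall d, 0 < d -> exists2 s, valid Q s & `|sn s - n| < d) ->
  exists2 n', attainable n' & n *m rotmx phi *m (D *m rotmx psi) ^+ K = n' *m rotmx psi.
Proof.
move=> K0 An; case: K K0 => // K _; elim: K => [|K [n' An' IH]].
  exists (n *m rotmx phi *m D); first exact: attainable_step.
  by rewrite expr1 mulmxA.
exists (n' *m rotmx psi *m D).
  apply: attainable_step => d d0; have [s vs [h1 _]] := An' d d0.
  by exists s.
by rewrite exprSr [X in _ *m X = _]/(_ *m _) mulmxA IH mulmxA.
Qed.

(** By rot_word the quotient of m by the initial displacement is a product of rotations and
    factors D, once the number of factors is large enough for frobX_large to apply. *)
Lemma attainable_any m s0 : \det m = 1 -> valid Q s0 ->
  exists phi n, attainable n /\ m = n *m rotmx phi.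
Proof.
move=> dm vs0; pose n0 := sn s0; have dn0 : \det n0 = 1 by case: vs0.
have u0 : n0 \in unitmx by rewrite unitmxE dn0 unitr1.
have dX : \det (invmx n0 *m m) = 1 by rewrite det_mulmx det_inv dn0 dm invr1 mulr1.
have [K K0 hK] := frobX_large beta mu0 mu1 (frob (invmx n0 *m m)).
have [psi [x [y XE]]] := rot_word mu0 dX hK.
have An0 d : 0 < d -> exists2 s, valid Q s & `|sn s - n0| < d.
  by move=> d0; exists s0; rewrite ?subrr ?normr0.
have K20 : (0 < 2 * K)%N by rewrite muln_gt0.
have [n An nE] := attainable_word x psi K20 An0.
exists (psi + y), n; split => //.
rewrite rotmxD mulmxA -nE -[m](mulKVmx u0) XE -kickE.
by rewrite /n0 !mulmxA.
Qed.

Lemma norm_invmx2 (A : 'M[R]_2) : \det A = 1 -> `|invmx A| <= `|A|.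
Proof.
move=> dA; have uA : A \in unitmx by rewrite unitmxE dA unitr1.
have -> : invmx A = mx2 (A 1 1) (- A 0 1) (- A 1 0) (A 0 0).
  have AV : A *m mx2 (A 1 1) (- A 0 1) (- A 1 0) (A 0 0) = 1%:M.
    move: dA; rewrite {1 2}(mx2P A) det_mx2 => dA.
    by rewrite mx2M mx2_1; congr mx2; lra.
  by rewrite -[LHS]mulmx1 -AV mulKmx.
by apply: mx2_norm_le; rewrite ?normrN ?le_mx_norm.
Qed.

(** Near the identity the Frobenius norm is close to 2, hence below that of the square of D:
    two factors D are enough to correct a small error exactly, by rot_word. *)
Lemma two_turns m : \det m = 1 -> exists2 d, 0 < d & forall A, \det A = 1 ->
  `|A - m| < d -> exists x y z, m = A *m rotmx x *m D *m rotmx y *m D *m rotmx z.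
Proof.
move=> dm; have g2 := frobX2_gt2 beta mu0 mu1.
pose gap := frob (D ^+ 2) - 2.
have gap0 : 0 < gap by rewrite subr_gt0 /D kickE.
pose M := 2 * (`|m| + 1).
have M0 : 0 < M by rewrite mulr_gt0// ltr_wpDl.
pose d := Num.min 1 (Num.min 1 (gap / 8) / M).
have d0 : 0 < d by rewrite !lt_min ltr01 divr_gt0// lt_min ltr01 divr_gt0.
exists d => // A dA; rewrite lt_min => /andP[A1]; rewrite ltr_pdivlMr// => Am.
have uA : A \in unitmx by rewrite unitmxE dA unitr1.
have dX : \det (invmx A *m m) = 1 by rewrite det_mulmx det_inv dA dm invr1 mulr1.
have hX : frob (invmx A *m m) <= frob ((mx2 mu beta 0 mu^-1) ^+ (2 * 1)).
  pose Y := invmx A *m (m - A).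
  have AM : `|A| <= `|m| + 1.
    rewrite -(subrK m A) (le_trans (ler_normD _ _))// addrC lerD2l.
    exact: ltW.
  have Yg : `|Y| <= Num.min 1 (gap / 8).
    apply: le_trans (ltW Am); rewrite distrC.
    rewrite (le_trans (norm2_le (norm_invmx2 dA) (lexx _)))//.
    rewrite /M mulrA [leRHS]mulrC ler_wpM2r// ler_wpM2l//.
  have -> : invmx A *m m = 1%:M + Y.
    by rewrite /Y mulmxBr mulVmx// addrC subrK.
  move: Yg; rewrite le_min => /andP[Y1 Yg].
  rewrite muln1 -kickE (le_trans (frob_perturb Y1))//.
  by rewrite addrC -lerBrDr -/D -/gap mulrC -ler_pdivlMr.
have [y [x [z XE]]] := rot_word mu0 dX hX.
exists x, y, (y + z); rewrite rotmxD -[m in LHS](mulKVmx uA) XE -kickE muln1.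
by rewrite expr2 !mulmxA.
Qed.

End Control.

(** * Steering around a star of displacements *)

Section Steering.
Variables (R : realType) (Q : quasi_periodic R) (f : 'M[R]_3 -> R).
Hypothesis f_int : lattice_invariant f.
Hypothesis f_unif : unif_continuous_on_balls f.
Hypothesis f_bounded : bounded_on_balls f.
Hypothesis irr : forall k (l : int), (0 < k)%N ->
  k%:R * qp_theta Q != l%:~R * (2 * pi).
Variables (mu beta : R).
Hypotheses (mu0 : 0 < mu) (mu1 : mu < 1).
Hypothesis kickE : kick Q = mx2 mu beta 0 mu^-1.
Let D := kick Q.
Let Di := invmx D.
Let E := edge_max Q f.
Let dD : \det D = 1 := det_kick Q.
Let uD : D \in unitmx. Proof. by rewrite unitmxE dD unitr1. Qed.

Variables (phis : R) (m : 'M[R]_2) (s : R).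
Let W := D *m rotmx phis.
Hypothesis W2 : W ^+ 2 = - 1%:M.
Hypothesis dm : \det m = 1.
Hypothesis star1 : forall x, E (m *m rotmx x) <= s.
Hypothesis star2 : forall x, E (m *m rotmx x *m W) <= s.

Lemma WD : W *m D = rotmx (pi - phis).
Proof.
have : W *m W *m rotmx (- phis) = W *m D.
  by rewrite {2}/W -!mulmxA rotmxKN mulmx1.
move=> <-; have -> : W *m W = - 1%:M by rewrite -W2 expr2.
by rewrite mulNmx mul1mx addrC rotmxDpi.
Qed.

(** An excursion that ends at m up to a rotation starts at m D^-1 up to rotations; the
    relation W^2 = -1 rewrites this as m W, where the cost is bounded by s. *)
Lemma DiE x : rotmx x *m Di = rotmx (x - (pi - phis)) *m W.
Proof.
rewrite rotmxD -mulmxA; congr (_ *m _).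
rewrite /Di -[RHS](mulmxK uD) -[X in _ = X *m _]mulmxA WD rotmxNK mul1mx //.
Qed.

(** One step of the steering multiplies errors by at most C. *)
Let C := 8 * (`|D| + `|Di| + 1).
Let C8 : 8 <= C.
Proof. by rewrite /C; have := normr_ge0 D; have := normr_ge0 Di; lra. Qed.
Let CD : 8 * `|D| + 8 <= C.
Proof. by rewrite /C; have := normr_ge0 Di; lra. Qed.
Let CDi : 8 * `|Di| + 8 <= C.
Proof. by rewrite /C; have := normr_ge0 D; lra. Qed.
Let r := C * (`|m| + 1).

(** For the round b of four excursions, a bound on the initial error such that, even
    multiplied by C^3, it changes the costs by little and can be corrected by two_turns. *)
Lemma tolerance b : exists eta, [/\ 0 < eta, C ^+ 3 * eta <= 1,
  C ^+ 3 * eta <= 2^-1 ^+ (b * 4 + 4) &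
  (forall x e, \det e = 1 -> `|m *m rotmx x - e| < C ^+ 3 * eta ->
     E e <= s + 2^-1 ^+ (b * 4 + 4)) /\
  (forall x e, \det e = 1 -> `|m *m rotmx x *m W - e| < C ^+ 3 * eta ->
     E e <= s + 2^-1 ^+ (b * 4 + 4)) /\
  (forall A, \det A = 1 -> `|A - m| < C ^+ 3 * eta ->
     exists x y z, m = A *m rotmx x *m D *m rotmx y *m D *m rotmx z)].
Proof.
have e0 : 0 < (2^-1 : R) ^+ (b * 4 + 4) by rewrite exprn_gt0// invr_gt0.
have [d1 d10 d1P] := two_turns mu0 mu1 kickE dm.
have [d2 d20 d2P] := edge_max_unif Q f_int f_unif f_bounded (2 * `|m|) e0.
have [d3 d30 d3P] := edge_max_unif Q f_int f_unif f_bounded (2 * (2 * `|m| * `|W|)) e0.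
pose d := Num.min 1 (Num.min (2^-1 ^+ (b * 4 + 4)) (Num.min d1 (Num.min d2 d3))).
have d0 : 0 < d by rewrite !lt_min ltr01 e0 d10 d20 d30.
have C0 : 0 < C ^+ 3 by rewrite exprn_gt0// (lt_le_trans _ C8).
exists (d / C ^+ 3).
have -> : C ^+ 3 * (d / C ^+ 3) = d by rewrite mulrC divfK// gt_eqF.
have dW : \det W = 1 by rewrite det_mulmx dD det_rotmx mulr1.
split; first by rewrite divr_gt0.
- by rewrite ge_min lexx.
- by rewrite !ge_min lexx orbT.
split; [|split].
- move=> x e de; rewrite !lt_min => /and5P[_ _ _ h _].
  apply: le_trans (d2P _ _ _ de _ h) _; rewrite ?det_mulmx ?det_rotmx ?dm ?mulr1//.
    exact: norm_mul_rot.
  by rewrite lerD2r.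
- move=> x e de; rewrite !lt_min => /and5P[_ _ _ _ h].
  apply: le_trans (d3P _ _ _ de _ h) _.
  + by rewrite !det_mulmx det_rotmx dm dD det_rotmx !mulr1.
  + by apply: norm2_le => //; exact: norm_mul_rot.
  by rewrite lerD2r.
- move=> A dA; rewrite !lt_min => /and5P[_ _ h _ _]; exact: d1P.
Qed.

Section Phases.
Variable eta : nat -> R.
Hypothesis eta_gt0 : forall b, 0 < eta b.
Hypothesis eta_le1 : forall b, C ^+ 3 * eta b <= 1.
Hypothesis eta_le : forall b, C ^+ 3 * eta b <= 2^-1 ^+ (b * 4 + 4).
Hypothesis eta_out : forall b x e, \det e = 1 ->
  `|m *m rotmx x - e| < C ^+ 3 * eta b -> E e <= s + 2^-1 ^+ (b * 4 + 4).
Hypothesis eta_in : forall b x e, \det e = 1 ->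
  `|m *m rotmx x *m W - e| < C ^+ 3 * eta b -> E e <= s + 2^-1 ^+ (b * 4 + 4).
Hypothesis eta_turn : forall b A, \det A = 1 -> `|A - m| < C ^+ 3 * eta b ->
  exists x y z, m = A *m rotmx x *m D *m rotmx y *m D *m rotmx z.

(** The position in a round of four excursions. Phases 0 and 1 perform the loop
    m -> m D -> m W D, whose edges are m and m W; in phases 2 and 3 the error accumulated
    meanwhile is corrected to one below the tolerance of the next round, by excursions whose
    edges lie near rotations of m and near rotations of m followed by W. *)
Definition phase b p (n : 'M[R]_2) := match p with
  | 0%N => exists x, `|n *m rotmx x - m| < eta b
  | 1%N => `|n - m *m D| < C * eta b
  | 2%N => exists x, `|n *m rotmx x - m| < C ^+ 2 * eta b
  | _ => exists x y, `|n *m rotmx x *m D *m rotmx y - m| < eta b.+1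
  end.

Let eta_small b : [/\ eta b <= C * eta b, C * eta b <= C ^+ 2 * eta b,
  C ^+ 2 * eta b <= C ^+ 3 * eta b & 8 * (C ^+ 2 * eta b) <= C ^+ 3 * eta b].
Proof.
have e0 := eta_gt0 b; have C80 := C8.
have h1 : 0 < C * eta b by rewrite mulr_gt0// (lt_le_trans _ C80).
have h2 : 0 < C ^+ 2 * eta b by rewrite mulr_gt0// exprn_gt0// (lt_le_trans _ C80).
have step x : 0 < x -> 8 * x <= C * x by move=> x0; rewrite ler_wpM2r// ltW.
have s1 := step _ e0; have s2 := step _ h1; have s3 := step _ h2.
rewrite mulrA -expr2 in s2; rewrite mulrA -exprS in s3.
by split; lra.
Qed.

Lemma norm_unrot (n : 'M[R]_2) x : `|n| <= 2 * `|n *m rotmx x|.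
Proof. by rewrite -{1}[n]mulmx1 -(rotmxKN x) mulmxA norm_mul_rot. Qed.

Lemma norm_near (A B : 'M[R]_2) d : `|A - B| <= d -> `|A| <= `|B| + d.
Proof.
by move=> h; rewrite -{1}(subrK B A) (le_trans (ler_normD _ _))// addrC lerD2l.
Qed.

Lemma phase_bounded b p n : phase b p n -> `|n| <= r.
Proof.
have m0 := normr_ge0 m; have C80 := C8.
have [s1 s2 s3 _] := eta_small b; have e1 := eta_le1 b.
have Cm : 2 * (`|m| + 1) <= r by rewrite /r ler_wpM2r//; lra.
have rotated x : `|n *m rotmx x - m| <= 1 -> `|n| <= r.
  move=> /norm_near h; apply: le_trans Cm; apply: le_trans (norm_unrot n x) _.
  by rewrite ler_wpM2l.
case: p => [|[|[|p]]] /=.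
- by move=> [x h]; apply: (rotated x); apply: le_trans (ltW h) _; lra.
- move=> h; have h1 : `|n - m *m D| <= 1 by apply: le_trans (ltW h) _; lra.
  apply: le_trans (norm_near h1) _.
  have := norm2_le (lexx `|m|) (lexx `|D|); have := CD; have := normr_ge0 D.
  rewrite /r; move: (`|m|) (`|D|) m0 => x y *; nra.
- by move=> [x h]; apply: (rotated x); apply: le_trans (ltW h) _; lra.
move=> [x [y h]].
have h1 : `|n *m rotmx x *m D *m rotmx y - m| <= 1.
  apply: le_trans (ltW h) _.
  by have [t1 t2 t3 _] := eta_small b.+1; have := eta_le1 b.+1; lra.
apply: le_trans (norm_unrot n x) _.
have -> : n *m rotmx x = n *m rotmx x *m D *m rotmx y *m rotmx (- y) *m Di.
  by rewrite -[_ *m rotmx y *m _]mulmxA rotmxKN mulmx1 mulmxK.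
have h2 := norm_near h1.
have h3 := norm_mul_rot (n *m rotmx x *m D *m rotmx y) (- y).
have := norm2_le h3 (lexx `|Di|); have := CDi; have := normr_ge0 Di.
rewrite /r; move: (`|m|) (`|Di|) (`|n *m rotmx x *m D *m rotmx y|) m0 h2 => u v w *.
nra.
Qed.

(** In each phase some angle x is such that an excursion with edge e close to n turned by x
    leads to the next phase, at a cost at most s up to 2^-(4b + 4). *)
Lemma phase_step b p n : (p < 4)%N -> \det n = 1 -> phase b p n ->
  exists x d, 0 < d /\ forall e n', \det e = 1 ->
    `|e - n *m rotmx x| < d -> `|n' - e *m D| < d ->
    [/\ E e <= s + 2^-1 ^+ (b * 4 + 4),
        if p == 3%N then phase b.+1 0 n' else phase b p.+1 n',
        p = 0%N -> `|e - m| < 2^-1 ^+ (b * 4 + 4) &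
        p = 1%N -> `|e - m *m W| < 2^-1 ^+ (b * 4 + 4)].
Proof.
have C80 := C8; have D0 := normr_ge0 D; have Di0 := normr_ge0 Di.
have CD' := CD; have CDi' := CDi.
have [s1 s2 s3 s4] := eta_small b; have e1 := eta_le b; have e0 := eta_gt0 b.
case: p => [|[|[|[|//]]]] _ dn /=.
- move=> [x h]; pose d := eta b - `|n *m rotmx x - m|.
  have d0 : 0 < d by rewrite subr_gt0.
  exists x, d; split => // e n' de en ne.
  have em : `|e - m| < eta b.
    rewrite -(subrKA (n *m rotmx x)) (le_lt_trans (ler_normD _ _))//.
    by move: en; rewrite /d; lra.
  split => //.
  + apply: (@eta_out b 0) => //; rewrite rotmx0 mulmx1 distrC.
    by apply: lt_le_trans em _; lra.
  + rewrite -(subrKA (e *m D)) -mulmxBl (le_lt_trans (ler_normD _ _))//.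
    have := norm2_le (ltW em) (lexx `|D|).
    have : d <= eta b by rewrite /d gerBl.
    have : 0 <= (C - (8 * `|D| + 8)) * eta b by rewrite mulr_ge0 ?subr_ge0// ltW.
    have : 0 <= eta b * `|D| by rewrite mulr_ge0// ltW.
    lra.
  + by move=> _; apply: lt_le_trans em _; lra.
- move=> h; exists phis, (eta b); split => // e n' de en ne.
  have em : `|e - m *m W| < (2 * C + 1) * eta b.
    rewrite -(subrKA (n *m rotmx phis)) (le_lt_trans (ler_normD _ _))//.
    rewrite /W mulmxA -mulmxBl.
    by have := norm_mul_rot (n - m *m D) phis; lra.
  have C2 : (2 * C + 1) * eta b <= C ^+ 2 * eta b.
    have : 0 <= (C - 8) * (C * eta b).
      by rewrite mulr_ge0 ?subr_ge0// mulr_ge0// ltW// (lt_le_trans _ C80).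
    by lra.
  split => //.
  + apply: (@eta_in b 0) => //; rewrite rotmx0 mulmx1 distrC.
    by apply: lt_le_trans em _; lra.
  + exists (- (pi - phis)).
    have -> : n' *m rotmx (- (pi - phis)) - m =
        (n' - e *m D + (e - m *m W) *m D) *m rotmx (- (pi - phis)).
      rewrite mulmxBl addrA subrK -[m *m W *m D]mulmxA WD mulmxBl.
      by rewrite -[m *m _ *m _]mulmxA rotmxKN mulmx1.
    apply: le_lt_trans (norm_mul_rot _ _) _.
    have := ler_normD (n' - e *m D) ((e - m *m W) *m D).
    have := norm2_le (ltW em) (lexx `|D|).
    have : 0 <= (C - (8 * `|D| + 8)) * (C * eta b).
      by rewrite mulr_ge0 ?subr_ge0// mulr_ge0 ?ltW// (lt_le_trans _ C80).
    have : 0 <= (C - 8) * (eta b * `|D|).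
      by rewrite mulr_ge0 ?subr_ge0// mulr_ge0// ltW.
    have : 0 <= (C - (8 * `|D| + 8)) * eta b by rewrite mulr_ge0 ?subr_ge0// ltW.
    have : 0 <= (C - 8) * eta b by rewrite mulr_ge0 ?subr_ge0// ltW.
    lra.
  + by move=> _; apply: lt_le_trans em _; lra.
- move=> [x h].
  have dA : \det (n *m rotmx x) = 1 by rewrite det_mulmx dn det_rotmx mulr1.
  have [|x1 [y [z mE]]] := eta_turn dA (b := b); first by apply: lt_le_trans h _.
  have K0 : 0 < 8 * `|D| * (1 + 2 * `|D|) + 1.
    by rewrite ltr_wpDl// !mulr_ge0// addr_ge0// mulr_ge0.
  pose d := Num.min (eta b) (eta b.+1 / (8 * `|D| * (1 + 2 * `|D|) + 1)).
  have d0 : 0 < d by rewrite lt_min e0 divr_gt0.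
  have dK : d * (8 * `|D| * (1 + 2 * `|D|) + 1) <= eta b.+1.
    by rewrite -ler_pdivlMr// ge_min lexx orbT.
  have de0 : d <= eta b by rewrite ge_min lexx.
  exists (x + x1), d; split => // e n' de en ne.
  split => //.
  + apply: (@eta_out b x1) => //; rewrite distrC.
    have -> : e - m *m rotmx x1 = e - n *m rotmx (x + x1) + (n *m rotmx x - m) *m rotmx x1.
      by rewrite mulmxBl rotmxD mulmxA addrA subrK.
    apply: le_lt_trans (ler_normD _ _) _.
    by have := norm_mul_rot (n *m rotmx x - m) x1; lra.
  + exists y, z; rewrite [X in _ - X]mE -!mulmxBl.
    set X := n' - _.
    have Xd : `|X| <= d + 2 * (d * `|D|).
      have -> : X = n' - e *m D + (e - n *m rotmx (x + x1)) *m D.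
        by rewrite /X mulmxBl rotmxD !mulmxA addrA subrK.
      apply: le_trans (ler_normD _ _) _; apply: lerD; first exact: ltW.
      exact: norm2_le (ltW en) (lexx _).
    apply: le_lt_trans (norm_mul_rot _ _) _.
    have := norm2_le (le_trans (norm_mul_rot X y) (ler_wpM2l (ler0n _ 2) Xd)) (lexx `|D|).
    lra.
move=> [x [y h]]; have e20 := eta_gt0 b.+1.
have [t1 t2 t3 t4] := eta_small b.+1.
set X := _ - m in h.
pose gap := eta b.+1 - `|X|.
have gap0 : 0 < gap by rewrite subr_gt0.
have K0 : 0 < 3 + 4 * `|D| by lra.
pose d := Num.min (eta b.+1) (gap / (3 + 4 * `|D|)).
have d0 : 0 < d by rewrite lt_min e20 divr_gt0.
have dK : d * (3 + 4 * `|D|) <= gap by rewrite -ler_pdivlMr// ge_min lexx orbT.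
have de1 : d <= eta b.+1 by rewrite ge_min lexx.
exists x, d; split => // e n' de en ne; split => //.
- have E1 : E e <= s + 2^-1 ^+ (b.+1 * 4 + 4).
    apply: (@eta_in b.+1 (- y - (pi - phis))) => //; rewrite distrC.
    have -> : e - m *m rotmx (- y - (pi - phis)) *m W =
        e - n *m rotmx x + X *m rotmx (- y) *m Di.
      rewrite -[m *m _ *m W]mulmxA -DiE /X mulmxBl -[_ *m rotmx y *m _]mulmxA rotmxKN.
      by rewrite mulmx1 mulmxBl mulmxK// addrA subrK mulmxA.
    apply: le_lt_trans (ler_normD _ _) _.
    have := norm2_le (norm_mul_rot X (- y)) (lexx `|Di|).
    have : 0 <= (C - (8 * `|Di| + 8)) * eta b.+1 by rewrite mulr_ge0 ?subr_ge0// ltW.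
    have : 0 <= (eta b.+1 - `|X|) * `|Di| by rewrite mulr_ge0// subr_ge0 ltW.
    lra.
  apply: le_trans E1 _; rewrite lerD2l.
  apply: ler_wiXn2l; [by rewrite invr_ge0|by rewrite invf_le1// ler1n|].
  by rewrite leq_add2r leq_mul2r leqnSn.
- exists y; have -> : n' *m rotmx y - m =
      (n' - e *m D + (e - n *m rotmx x) *m D) *m rotmx y + X.
    have -> : n' - e *m D + (e - n *m rotmx x) *m D = n' - n *m rotmx x *m D.
      by rewrite mulmxBl addrA subrK.
    by rewrite mulmxBl /X addrA subrK.
  apply: le_lt_trans (ler_normD _ _) _.
  have := norm_mul_rot (n' - e *m D + (e - n *m rotmx x) *m D) y.
  have := ler_normD (n' - e *m D) ((e - n *m rotmx x) *m D).
  have := norm2_le (ltW en) (lexx `|D|).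
  by move: dK; rewrite /gap; lra.
Qed.

End Phases.

(** The chain with phase i mod 4 at stage i. If the cost s is attained at m, the targets are
    the stages of phase 0, and those of phase 1 if it is attained at m W. *)
Lemma steering_limsup s0 : valid Q s0 -> s <= E m \/ s <= E (m *m W) ->
  exists x, limsup_height f x s.
Proof.
move=> vs0 smax.
have /choice[eta etaP] := tolerance.
have eta_gt0 b : 0 < eta b by have [] := etaP b.
have eta_le1 b : C ^+ 3 * eta b <= 1 by have [] := etaP b.
have eta_le b : C ^+ 3 * eta b <= 2^-1 ^+ (b * 4 + 4) by have [] := etaP b.
have eta_out b x e : \det e = 1 -> `|m *m rotmx x - e| < C ^+ 3 * eta b ->
    E e <= s + 2^-1 ^+ (b * 4 + 4) by have [_ _ _ [H _]] := etaP b; exact: H.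
have eta_in b x e : \det e = 1 -> `|m *m rotmx x *m W - e| < C ^+ 3 * eta b ->
    E e <= s + 2^-1 ^+ (b * 4 + 4) by have [_ _ _ [_ [H _]]] := etaP b; exact: H.
have eta_turn b A : \det A = 1 -> `|A - m| < C ^+ 3 * eta b ->
    exists x y z, m = A *m rotmx x *m D *m rotmx y *m D *m rotmx z.
  by have [_ _ _ [_ [_ H]]] := etaP b; exact: H.
have [r' [rho stepP]] := step_heights Q f_int f_unif f_bounded r.
have half0 i : 0 < (2^-1 : R) ^+ i by rewrite exprn_gt0// invr_gt0.
have /choice[dd ddP] : forall i, exists d, 0 < d /\ forall s e0 V,
    valid Q s -> \det e0 = 1 -> `|sn s| <= r ->
    `|sn s - e0 *m kick Q| < d -> `|sw s - w_lim Q| < d ->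
    exists K, forall k, (K <= k)%N -> [/\ 0 < Jk Q k s,
    st s + 1 <= st (step Q k s) /\
      st s + k%:R * qp_t Q <= st (step Q k s) + (1 - sigma Q),
    expR (3 * st s) * `|sx (step Q k s) - sx s| <= 2^-1 ^+ i,
    forall T, st s <= T <= st (step Q k s) ->
      near_bounded T (sx (step Q k s)) r' /\
      f (G T *m h (sx (step Q k s))) <= Num.max (E e0) (E (edge Q k s)) + 2^-1 ^+ i &
    forall v, `|v| <= V ->
      near_bounded (st s + k%:R * qp_t Q + v) (sx (step Q k s)) (rho v) /\
      `|f (G (st s + k%:R * qp_t Q + v) *m h (sx (step Q k s)))
        - f (nm (edge Q k s) *m homoclinic Q v)| < 2^-1 ^+ i].
  by move=> i; have [d d0 dP] := stepP _ (half0 i); exists d.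
pose I i (p : state R * 'M[R]_2) := [/\ valid Q p.1, \det p.2 = 1,
  `|sn p.1 - p.2 *m D| < dd i, `|sw p.1 - w_lim Q| < dd i &
  phase eta (i %/ 4) (i %% 4) (sn p.1)].
have dd0 i : 0 < dd i by have [] := ddP i.
have IS i p : I i p -> exists2 k, I i.+1 (step Q k p.1, edge Q k p.1) &
    good_step Q f s r' rho i p k /\
    [/\ (i %% 4 = 0)%N -> `|edge Q k p.1 - m| < 2^-1 ^+ i &
        (i %% 4 = 1)%N -> `|edge Q k p.1 - m *m W| < 2^-1 ^+ i].
  move=> [vp dp np wp php]; have [_ ddiP] := ddP i.
  have nr := phase_bounded eta_gt0 eta_le1 php.
  have [K KP] := ddiP p.1 p.2 i%:R vp dp nr np wp.
  have p4 : (i %% 4 < 4)%N by rewrite ltn_mod.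
  have [x [d [d0 dP]]] := phase_step eta_gt0 eta_le eta_out eta_in eta_turn p4
    (proj1 vp) php.
  have d10 : 0 < Num.min d (dd i.+1) by rewrite lt_min d0 dd0.
  have [k kK [k1 k2 k3 J0]] := control irr x K vp d10.
  move: k1 k2 k3; rewrite !lt_min => /andP[k1 _] /andP[k2 k2'] /andP[_ k3'].
  have de := det_edge k vp.
  have [Ee ph' t0 t1] := dP _ _ de k1 k2.
  have [_ g1 g2 g3 g4] := KP k kK.
  have pw : 2^-1 ^+ (i %/ 4 * 4 + 4) <= (2^-1 : R) ^+ i.
    apply: ler_wiXn2l; [by rewrite invr_ge0|by rewrite invf_le1// ler1n|].
    by rewrite {1}(divn_eq i 4) leq_add2l ltnW.
  exists k; last first.
    split; last first.
      by split=> [/t0|/t1] h; apply: lt_le_trans h pw.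
    split => //; split; last exact: g3.
    by apply: le_trans Ee _; rewrite lerD2l.
  split => //; first exact: step_valid.
  rewrite [i.+1](_ : _ = i %/ 4 * 4 + (i %% 4).+1)%N; last by rewrite addnS -divn_eq.
  move: ph'; case: eqP => [->|p3].
    by rewrite -[(3.+1)%N]/(1 * 4)%N -mulnDl addn1 mulnK// modnMl.
  have p3' : ((i %% 4).+1 < 4)%N.
    by rewrite ltn_neqAle p4 andbT; apply/eqP => h; apply: p3; case: h.
  by rewrite divnMDl// modnMDl (divn_small p3') addn0 (modn_small p3').
have [phi [n [An mE]]] := attainable_any irr mu0 mu1 kickE dm vs0.
have [p0 p0I] : exists p0, I 0%N p0.
  have d10 : 0 < Num.min (dd 0%N) (eta 0%N / 2) by rewrite lt_min dd0 divr_gt0.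
  have [s1 vs1 [h1 h2]] := An _ d10.
  move: h1 h2; rewrite !lt_min => /andP[_ h1] /andP[h2 _].
  have ds1 : \det (sn s1) = 1 by case: vs1.
  exists (s1, sn s1 *m Di); split => //=.
  - by rewrite det_mulmx ds1 det_inv dD invr1 mulr1.
  - by rewrite mulmxKV// subrr normr0.
  - exists phi; rewrite mE -mulmxBl; apply: le_lt_trans (norm_mul_rot _ _) _.
    by rewrite mulrC -ltr_pdivlMr.
have dW : \det (m *m W) = 1 by rewrite !det_mulmx dm dD det_rotmx !mulr1.
case: smax => sE.
  apply: (@chain_limsup _ Q f f_int f_unif f_bounded s r' rho I m
    (fun i => i %% 4 = 0)%N p0 p0I _ _ dm sE).
    by move=> i p /IS[k Ik [gk [tk _]]]; exists k.
  by move=> N; exists (N * 4)%N; [rewrite leq_pmulr|rewrite modnMl].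
apply: (@chain_limsup _ Q f f_int f_unif f_bounded s r' rho I (m *m W)
  (fun i => i %% 4 = 1)%N p0 p0I _ _ dW sE).
  by move=> i p /IS[k Ik [gk [_ tk]]]; exists k.
move=> N; exists (N * 4 + 1)%N; last by rewrite modnMDl.
by rewrite (leq_trans (leq_pmulr N (isT : 0 < 4)%N))// leq_addr.
Qed.

End Steering.

(** * Existence of stars of prescribed height *)

Section ColumnVectors.
Variable R : realType.

Definition col3 (p : R) (y : 'cV[R]_2) : 'cV[R]_3 := col_mx (p%:M : 'M[R]_1) y.

Lemma col3P (v : 'cV[R]_3) : exists p y, v = col3 p y.
Proof.
exists (@usubmx R 1 2 1 v 0 0), (@dsubmx R 1 2 1 v).
by rewrite /col3 -mx11_scalar -[LHS](@vsubmxK _ 1 2 1).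
Qed.

Lemma blk_col3 a w z n p y :
  blk a w z n *m col3 p y = col3 (a * p + (w *m y) 0 0) (p *: z + n *m y).
Proof.
rewrite /blk /col3 (@mul_block_col _ 1 2 1 2 1).
have -> : (a%:M : 'M[R]_1) *m p%:M + w *m y = (a * p + (w *m y) 0 0)%:M.
  by rewrite [RHS]raddfD/= -mx11_scalar scalar_mxM.
by rewrite mul_mx_scalar.
Qed.

Lemma norm_col3_lt p y (e : R) : `|p| < e -> `|y| < e -> `|col3 p y| < e.
Proof.
move=> pe ye; apply: (@le_lt_trans _ _ (Num.max `|p| `|y|)); last by rewrite gt_max pe.
have gen (A : 'M[R]_(1, 1)) (B : 'M[R]_(2, 1)) (c : R) :
    0 <= c -> `|A| <= c -> `|B| <= c -> `|col_mx A B| <= c.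
  move=> c0 Ac Bc; apply: mx_norm_le => // i k; rewrite -(fintype.splitK i).
  case: (fintype.split i) => i' /=.
    by rewrite col_mxEu (le_trans (le_mx_norm _ _ _)).
  by rewrite col_mxEd (le_trans (le_mx_norm _ _ _)).
apply: gen; rewrite ?le_max ?normr_ge0 ?lexx ?orbT//.
apply/orP; left; apply: mx_norm_le => // i k; rewrite !ord1 mxE eqxx mulr1n //.
Qed.

End ColumnVectors.

Section Target.
Variables (R : realType) (Q : quasi_periodic R) (f : 'M[R]_3 -> R).
Hypothesis f_int : lattice_invariant f.
Hypothesis f_unif : unif_continuous_on_balls f.
Hypothesis f_bounded : bounded_on_balls f.
Hypothesis f_proper : proper_on_lattices f.
Variable W : 'M[R]_2.
Hypothesis dW : \det W = 1.
Let E := edge_max Q f.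
Let D := kick Q.

(** The costs of the two excursions of the loop based at n. *)
Definition vertex_height n := Num.max (E n) (E (n *m W)).
Definition star_height n := sup (range (fun x => vertex_height (n *m rotmx x))).

Lemma vertex_height_unif (r d : R) : 0 < d -> exists2 d', 0 < d' &
  forall n n', \det n = 1 -> \det n' = 1 -> `|n| <= r -> `|n - n'| < d' ->
    vertex_height n' <= vertex_height n + d.
Proof.
move=> d0.
have [d1 d10 d1P] := edge_max_unif Q f_int f_unif f_bounded r d0.
have [d2 d20 d2P] := edge_max_unif Q f_int f_unif f_bounded (2 * (`|r| * `|W|)) d0.
have W0 : 0 < 2 * (`|W| + 1) by rewrite mulr_gt0// ltr_wpDl.
exists (Num.min d1 (d2 / (2 * (`|W| + 1)))); first by rewrite lt_min d10 divr_gt0.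
move=> n n' dn dn' nr; rewrite lt_min ltr_pdivlMr// => /andP[h1 h2].
rewrite /vertex_height ge_max; apply/andP; split.
  by apply: le_trans (d1P _ _ dn dn' nr h1) _; rewrite lerD2r le_max lexx.
apply: (@le_trans _ _ (E (n *m W) + d)); last by rewrite lerD2r le_max lexx orbT.
apply: d2P; rewrite ?det_mulmx ?dn ?dn' ?dW ?mulr1//.
  by apply: norm2_le => //; rewrite (le_trans nr)// ler_norm.
rewrite -mulmxBl; apply: le_lt_trans h2; apply: le_trans (norm2_le (lexx _) (lexx _)) _.
by rewrite mulrCA ler_wpM2l// ler_wpM2l// lerDl.
Qed.

Lemma vertex_height_bounded (r : R) : exists b, forall n, \det n = 1 -> `|n| <= r ->
  vertex_height n <= b.
Proof.
have edge_bd (r1 : R) : exists b, forall n, \det n = 1 -> `|n| <= r1 -> E n <= b.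
  have [r2 r20 rP] := homoclinic_bounded Q.
  have [b bP] := f_bounded (3 * ((1 + `|r1|) * r2)).
  exists b => n dn nr; apply: edge_max_le => v; have [B sB [dB Br]] := rP v.
  have dnB : \det (nm n *m B) = 1 by rewrite det_mulmx det_nm dn dB mulr1.
  rewrite (f_same f_int (same_mull _ sB) dnB); apply: bP => //.
  apply: norm3M_le => //; rewrite (le_trans (norm_nm_le _))// lerD2l.
  by rewrite (le_trans nr)// ler_norm.
have [b1 b1P] := edge_bd r; have [b2 b2P] := edge_bd (2 * (r * `|W|)).
exists (Num.max b1 b2) => n dn nr; rewrite /vertex_height ge_max !le_max b1P//=.
apply/orP; right; apply: b2P; first by rewrite det_mulmx dn dW mulr1.
exact: norm2_le.
Qed.

Let has_sup_star n : \det n = 1 -> has_sup (range (fun x => vertex_height (n *m rotmx x))).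
Proof.
move=> dn; split; first by exists (vertex_height (n *m rotmx 0)), 0.
have [b bP] := vertex_height_bounded (2 * `|n|).
exists b => _ [x _ <-]; apply: bP; first by rewrite det_mulmx dn det_rotmx mulr1.
exact: norm_mul_rot.
Qed.

Lemma star_height_ge n x : \det n = 1 -> vertex_height (n *m rotmx x) <= star_height n.
Proof. by move=> dn; apply: ub_le_sup; [case: (has_sup_star dn)|exists x]. Qed.

Lemma star_height_unif (r d : R) : 0 < d -> exists2 d', 0 < d' &
  forall n n', \det n = 1 -> \det n' = 1 -> `|n| <= r -> `|n - n'| < d' ->
    star_height n' <= star_height n + d.
Proof.
move=> d0; have [d1 d10 d1P] := vertex_height_unif (2 * r) d0.
exists (d1 / 2); first by rewrite divr_gt0.
move=> n n' dn dn' nr nn'; apply: ge_sup.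
  by exists (vertex_height (n' *m rotmx 0)), 0.
move=> _ [x _ <-]; apply: (@le_trans _ _ (vertex_height (n *m rotmx x) + d)).
  apply: d1P; rewrite ?det_mulmx ?dn ?dn' ?det_rotmx ?mulr1//.
    by rewrite (le_trans (norm_mul_rot _ _))// ler_wpM2l.
  rewrite -mulmxBl; apply: le_lt_trans (norm_mul_rot _ _) _.
  by rewrite mulrC -ltr_pdivlMr.
by rewrite lerD2r star_height_ge.
Qed.

Definition stretch v : 'M[R]_2 := mx2 (expR (- v)) 0 0 (expR v).

Lemma det_stretch v : \det (stretch v) = 1.
Proof. by rewrite det_mx2 -expRD addNr expR0 mul0r subr0. Qed.

Lemma entry_continuous_stretch : entry_continuous stretch.
Proof.
move=> i k x; have -> : (fun x => stretch x i k) = (fun x =>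
   if i == 0 then if k == 0 then expR (- x) else 0
   else if k == 0 then 0 else expR x) by apply/funext => y; rewrite mxE.
case: (i == 0); case: (k == 0); try exact: cvg_cst; last exact: continuous_expR.
apply: (@continuous_comp R R R (fun x => - x) (@expR R)); first exact: opp_continuous.
exact: continuous_expR.
Qed.

(** Exchanging the roles of n and n' turns the one-sided estimate into continuity. *)
Lemma unif_path_continuous (p : R -> 'M[R]_2) (H : 'M[R]_2 -> R) :
  entry_continuous p -> (forall v, \det (p v) = 1) ->
  (forall r d : R, 0 < d -> exists2 d', 0 < d' &
    forall n n', \det n = 1 -> \det n' = 1 -> `|n| <= r -> `|n - n'| < d' ->
      H n' <= H n + d) ->
  continuous (fun v => H (p v)).
Proof.
move=> cp dp HP v; apply/cvgrPdist_le => e e0.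
have [d d0 dP] := HP (`|p v| + 1) e e0.
have dm0 : 0 < Num.min d 1 by rewrite lt_min d0 ltr01.
have := entry_continuous_norm v cp dm0; apply: filterS => w.
rewrite lt_min => /andP[h1 h2].
rewrite ler_distl; apply/andP; split.
  by rewrite lerBlDr; apply: dP => //; rewrite lerDl.
apply: dP => //; last by rewrite distrC.
by apply: norm_near; rewrite distrC ltW.
Qed.

Lemma expR_small (C e : R) : 0 < e -> exists2 v, 0 <= v & expR (- v) * C < e.
Proof.
move=> e0; exists (`|C| / e); first by rewrite divr_ge0// ltW.
rewrite expRN mulrC ltr_pdivrMr ?expR_gt0//.
apply: le_lt_trans (ler_norm _) _; rewrite mulrC -ltr_pdivrMr//.
by apply: lt_le_trans (expR_ge1Dx _); rewrite ltrDr.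
Qed.

(** Along the orbit a lattice vector turns into the expanding plane, where the stretch
    makes it short. *)
Lemma star_height_unbounded s : exists2 v, 0 <= v & s < star_height (stretch v).
Proof.
have [e e0 eP] := f_proper s.
pose v0 : 'cV[int]_3 := delta_mx 0 0.
have v0N0 : v0 != 0.
  by apply/eqP => /matrixP /(_ 0 0); rewrite !mxE eqxx.
have [a [y gv]] := col3P (qp_g Q *m intmx R v0).
have [tau tau0 htau] := expR_small (`|a + (w_lim Q *m y) 0 0|) e0.
pose Y := D *m (expR tau *: y).
have [x [x1 x2]] := @rotate_vector R (Num.sqrt (Y 0 0 ^+ 2 + Y 1 0 ^+ 2)) 0 (Y 0 0) (Y 1 0)
  ltac:(by rewrite sqr_sqrtr ?addr_ge0 ?sqr_ge0// expr0n addr0).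
have [v v_ge0 hv] := expR_small (Num.sqrt (Y 0 0 ^+ 2 + Y 1 0 ^+ 2)) e0.
exists v => //; apply: lt_le_trans (star_height_ge x (det_stretch v)).
pose n := stretch v *m rotmx x.
have dn : \det n = 1 by rewrite det_mulmx det_stretch det_rotmx mulr1.
rewrite /vertex_height lt_max -/n; apply/orP; left.
apply: lt_le_trans (edge_max_ge Q f_int f_bounded (tau + sigma Q) dn).
have sB := same_mull (nm n) (homoclinic_future Q (tau + sigma Q)).
rewrite addrK in sB.
rewrite (f_same f_int sB); last first.
  by rewrite !det_mulmx !det_nm dn det_kick det_u det_G qp_det_g !mulr1.
apply: (eP _ v0) => //.
  by rewrite !det_mulmx !det_nm dn det_kick det_u det_G qp_det_g !mulr1.
have z00 : (0 : 'M[R]_1) 0 0 = 0 by rewrite mxE.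
rewrite -!mulmxA gv blk_col3 mul0mx z00 addr0 scaler0 add0r mul_scalar_mx.
rewrite blk_col3 mul1r scaler0 add0r mul1mx.
rewrite /nm !blk_col3 !mul1r !scaler0 !add0r !mul0mx !z00 !addr0.
apply: norm_col3_lt.
  rewrite -scalemxAr -scalemxAl mxE mxE mulrA -expRD.
  have -> : expR (tau + - (3 * tau)) = expR (- (2 * tau)) by congr expR; ring.
  rewrite -mulrDr normrM ger0_norm ?expR_ge0//; apply: le_lt_trans htau.
  by rewrite ler_wpM2r// ler_expR; lra.
rewrite -/D -/Y /n -mulmxA; clearbody Y.
have -> : stretch v *m (rotmx x *m Y) =
    (\col_i if i == 0 then expR (- v) * Num.sqrt (Y 0 0 ^+ 2 + Y 1 0 ^+ 2) else 0).
  apply/matrixP => i k; rewrite !ord1 /stretch /rotmx mulmxA mx2M !mxE.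
  rewrite big_ord_recl big_ord1 !mxE /= x1.
  have -> : lift ord0 ord0 = 1 :> 'I_2 by apply: val_inj.
  case: i => -[|[|//]] i2 /=; first by ring.
  by transitivity (expR v * (sin x * Y 0 0 + cos x * Y 1 0)); [ring|rewrite -x2 mulr0].
apply: (@le_lt_trans _ _ (expR (- v) * Num.sqrt (Y 0 0 ^+ 2 + Y 1 0 ^+ 2))) => //.
have q0 : 0 <= expR (- v) * Num.sqrt (Y 0 0 ^+ 2 + Y 1 0 ^+ 2).
  by rewrite mulr_ge0 ?expR_ge0// sqrtr_ge0.
by apply: mx_norm_le => // i k; rewrite mxE; case: ifP; rewrite ?normr0// ger0_norm.
Qed.

(** The intermediate value theorem gives a stretch of star height s, and the supremum is
    attained because the angles may be restricted to a compact interval. *)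
Lemma target_exists s : star_height 1%:M < s -> exists m, [/\ \det m = 1,
  (forall x, E (m *m rotmx x) <= s), (forall x, E (m *m rotmx x *m W) <= s) &
  s <= E m \/ s <= E (m *m W)].
Proof.
move=> s1; have [V V0 hV] := star_height_unbounded s.
have st0 : stretch 0 = 1%:M by rewrite /stretch oppr0 expR0 mx2_1.
have [||v _ vs] := @IVT R (fun v => star_height (stretch v)) 0 V s V0.
- apply: continuous_subspaceT; apply: unif_path_continuous.
  + exact: entry_continuous_stretch.
  + exact: det_stretch.
  + exact: star_height_unif.
- by rewrite st0 ge_min le_max (ltW s1) (ltW hV) orbT.
pose n := stretch v; have dn : \det n = 1 := det_stretch v.
have pi0 : - pi <= pi :> R by rewrite ge0_cp// pi_ge0.
have [|x xpi xmax] := @EVT_max R (fun x => vertex_height (n *m rotmx x)) (- pi) pi pi0.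
  apply: continuous_subspaceT; apply: unif_path_continuous.
  + by apply: entry_continuousM; [exact: entry_continuous_cst|exact: entry_continuous_rotmx].
  + by move=> y; rewrite det_mulmx dn det_rotmx mulr1.
  + exact: vertex_height_unif.
have xs : vertex_height (n *m rotmx x) = s.
  apply/eqP; rewrite eq_le -{1}vs star_height_ge//= -vs; apply: ge_sup.
    by exists (vertex_height (n *m rotmx 0)), 0.
  move=> _ [y _ <-]; have [t tpi ->] := rot_reduce y.
  by apply: xmax; rewrite in_itv.
have le_s y : vertex_height (n *m rotmx x *m rotmx y) <= s.
  by rewrite -mulmxA -rotmxD -vs star_height_ge.
exists (n *m rotmx x); split.
- by rewrite det_mulmx dn det_rotmx mulr1.
- by move=> y; have := le_s y; rewrite /vertex_height ge_max => /andP[].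
- by move=> y; have := le_s y; rewrite /vertex_height ge_max => /andP[].
- by have : s <= vertex_height (n *m rotmx x) by [rewrite xs]; rewrite le_max => /orP.
Qed.

End Target.

(** * The lattice of a complex cubic field *)

(** Infinite descent modulo 2: x^3 = x^2 + 1 has no solution modulo 2. *)
Lemma cubic_no_nat_root (m n : nat) : (0 < n)%N -> (m ^ 3 <> m ^ 2 * n + n ^ 3)%N.
Proof.
have [N] := ubnP n; elim: N => // N IH in m n *; rewrite ltnS => nN n0 h.
have : odd (m ^ 3) = odd (m ^ 2 * n + n ^ 3) by rewrite h.
rewrite oddD oddM !oddX /=; case mo: (odd m); case no: (odd n) => // _.
have me : m = (m./2 * 2)%N by rewrite muln2 even_halfK// mo.
have ne : n = (n./2 * 2)%N by rewrite muln2 even_halfK// no.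
have n20 : (0 < n./2)%N by rewrite half_gt0; case: n n0 no {h nN ne} => [|[|n]].
apply: (IH m./2 n./2) => //.
  by apply: leq_trans nN; rewrite {2}ne muln2 -addnn -{1}[n./2]addn0 ltn_add2l.
apply/eqP; rewrite -(@eqn_pmul2r (2 ^ 3))// mulnDl; apply/eqP.
rewrite -expnMn -me -[(_ * n./2 * _)%N]/(m./2 ^ 2 * n./2 * (2 ^ 2 * 2))%N.
by rewrite mulnACA -expnMn -me -ne -expnMn -ne.
Qed.

Section SmallVectors.
Variable R : realType.
Implicit Types a b c d : R.

Definition rv2 a b : 'rV[R]_2 := \row_i if i == 0 then a else b.
Definition cv2 a b : 'cV[R]_2 := \col_i if i == 0 then a else b.

Lemma rv2_mx2 a b x y z t : rv2 a b *m mx2 x y z t = rv2 (a * x + b * z) (a * y + b * t).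
Proof.
apply/matrixP => i k; rewrite !mxE big_ord_recl big_ord1 !mxE /=.
by case: k => -[|[|//]].
Qed.

Lemma mx2_cv2 a b x y z t : mx2 x y z t *m cv2 a b = cv2 (x * a + y * b) (z * a + t * b).
Proof.
apply/matrixP => i k; rewrite !mxE big_ord_recl big_ord1 !mxE /=.
by case: i => -[|[|//]].
Qed.

Lemma rv2_cv2 a b c d : (rv2 a b *m cv2 c d) 0 0 = a * c + b * d.
Proof. by rewrite !mxE big_ord_recl big_ord1 !mxE /=. Qed.

Lemma cv2_rv2 a b c d : cv2 a b *m rv2 c d = mx2 (a * c) (a * d) (b * c) (b * d).
Proof.
apply/matrixP => i k; rewrite !mxE big_ord1 !mxE.
by case: i => -[|[|//]] ?; case: k => -[|[|//]] ?.
Qed.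

Lemma scale_rv2 x a b : x *: rv2 a b = rv2 (x * a) (x * b).
Proof. by apply/rowP => i; rewrite !mxE; case: ifP. Qed.

Lemma scale_cv2 x a b : x *: cv2 a b = cv2 (x * a) (x * b).
Proof. by apply/colP => i; rewrite !mxE; case: ifP. Qed.

Lemma scale_mx2 x a b c d : x *: mx2 a b c d = mx2 (x * a) (x * b) (x * c) (x * d).
Proof. by apply/matrixP => i k; rewrite !mxE; case: ifP; case: ifP. Qed.

Lemma add_rv2 a b c d : rv2 a b + rv2 c d = rv2 (a + c) (b + d).
Proof. by apply/rowP => i; rewrite !mxE; case: ifP. Qed.

Lemma add_cv2 a b c d : cv2 a b + cv2 c d = cv2 (a + c) (b + d).
Proof. by apply/colP => i; rewrite !mxE; case: ifP. Qed.

Lemma add_mx2 a b c d a' b' c' d' :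
  mx2 a b c d + mx2 a' b' c' d' = mx2 (a + a') (b + b') (c + c') (d + d').
Proof. by apply/matrixP => i k; rewrite !mxE; case: ifP; case: ifP. Qed.

End SmallVectors.

Section IntegerMatrices.
Variable R : realType.

Lemma blk_inj (a : R) w z n a' w' z' n' : blk a w z n = blk a' w' z' n' ->
  [/\ a = a', w = w', z = z' & n = n'].
Proof.
move=> /(@eq_block_mx _ 1 2 1 2) [/matrixP/(_ 0 0)]; rewrite !mxE !mulr1n.
by move=> -> -> -> ->.
Qed.

Definition iblk (a : int) (w : 'rV[int]_2) (z : 'cV[int]_2) (n : 'M[int]_2) : 'M[int]_3 :=
  block_mx (a%:M : 'M[int]_1) w z n.

Lemma intmx_iblk a w z n : intmx R (iblk a w z n) =
  blk a%:~R (intmx R w) (intmx R z) (intmx R n).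
Proof. by rewrite /intmx /iblk (@map_block_mx _ _ _ 1 2 1 2) map_scalar_mx. Qed.

Definition irv2 (a b : int) : 'rV[int]_2 := \row_i if i == 0 then a else b.
Definition icv2 (a b : int) : 'cV[int]_2 := \col_i if i == 0 then a else b.

Lemma intmx_irv2 a b : intmx R (irv2 a b) = rv2 a%:~R b%:~R.
Proof. by apply/rowP => i; rewrite !mxE; case: ifP. Qed.

Lemma intmx_icv2 a b : intmx R (icv2 a b) = cv2 a%:~R b%:~R.
Proof. by apply/colP => i; rewrite !mxE; case: ifP. Qed.

Lemma intmx_icv2_irv2 a b c d : intmx R (icv2 a b *m irv2 c d) =
  mx2 (a%:~R * c%:~R) (a%:~R * d%:~R) (b%:~R * c%:~R) (b%:~R * d%:~R).
Proof. by rewrite /intmx map_mxM -/(intmx R _) -/(intmx R _) intmx_irv2 intmx_icv2 cv2_rv2. Qed.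

Lemma intmx_det_eq1 (C : 'M[int]_3) : \det (intmx R C) = 1 -> \det C = 1.
Proof. by rewrite det_map_mx -[1]/(1%:~R) => /eqP; rewrite eqr_int => /eqP. Qed.

End IntegerMatrices.

(** The real root kappa and the complex roots p + iq, p - iq of x^3 = x^2 + 1; the number d
    normalizes the determinant. *)
Section CubicLattice.
Variables (R : realType) (kappa p q d : R).
Hypothesis kappa1 : 1 < kappa < 2.
Hypothesis kappa3 : kappa ^+ 3 = kappa ^+ 2 + 1.
Hypothesis pE : p = (1 - kappa) / 2.
Hypothesis q0 : 0 < q.
Hypothesis q2 : q ^+ 2 = kappa ^+ 2 - kappa - p ^+ 2.
Hypothesis dE : d = q * ((kappa - p) ^+ 2 + q ^+ 2).

Let kappa0 : 0 < kappa. Proof. by case/andP: kappa1 => /(lt_trans ltr01). Qed.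
Let kappaN0 : kappa != 0. Proof. by rewrite gt_eqF. Qed.
Let kappaV : kappa^-1 = kappa ^+ 2 - kappa.
Proof.
apply: (mulfI kappaN0); rewrite divff// mulrBr -exprS kappa3; ring.
Qed.

Let p0 : p < 0. Proof. by rewrite pE; case/andP: kappa1; lra. Qed.

Let norm_mu : kappa * (p ^+ 2 + q ^+ 2) = 1.
Proof. by rewrite q2 addrC subrK mulrBr -!exprS kappa3; ring. Qed.

Let re_mu3 : p ^+ 3 - 3 * p * q ^+ 2 - p ^+ 2 + q ^+ 2 = 1.
Proof.
have k31 : kappa ^+ 3 - kappa ^+ 2 = 1 by rewrite kappa3; ring.
by rewrite -[RHS]k31 q2 pE; field.
Qed.

Let im_mu3 : 3 * p ^+ 2 * q - q ^+ 3 = 2 * p * q.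
Proof.
have -> : q ^+ 3 = q ^+ 2 * q by rewrite exprSr.
by rewrite q2 pE; field.
Qed.

Let d0 : 0 < d.
Proof. by rewrite dE mulr_gt0// ltr_wpDl ?sqr_ge0// exprn_gt0. Qed.
Let dN0 : d != 0. Proof. by rewrite gt_eqF. Qed.

(** Rows: the real embedding, divided by d, and the real and imaginary parts of the complex
    embedding of the basis 1, x, x^2. *)
Definition cubic_g := blk d^-1 (rv2 (kappa / d) (kappa ^+ 2 / d)) (cv2 1 0)
  (mx2 p (p ^+ 2 - q ^+ 2) q (2 * p * q)).

(** Multiplication by 1/x = x^2 - x in the basis 1, x, x^2. *)
Definition cubic_a := iblk 0 (irv2 1 0) (icv2 (-1) 1) (icv2 1 0 *m irv2 0 1).

(** The time in which the flow expands by |p + iq|^-1 and contracts by kappa^-1. *)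
Definition cubic_t := ln kappa / 2.

Let expR_t2 : expR (- (2 * cubic_t)) = kappa^-1.
Proof.
have -> : 2 * cubic_t = ln kappa by rewrite /cubic_t; field.
by rewrite expRN lnK.
Qed.

Let expR_t : expR cubic_t ^+ 2 = kappa.
Proof.
rewrite expr2 -expRD; have -> : cubic_t + cubic_t = ln kappa by rewrite /cubic_t; field.
by rewrite lnK.
Qed.

Lemma cubic_det : \det cubic_g = 1.
Proof.
have dV0 : 0 < d^-1 by rewrite invr_gt0.
have := congr1 determinant (upper_factor (rv2 (kappa / d) (kappa ^+ 2 / d)) (cv2 1 0)
  (mx2 p (p ^+ 2 - q ^+ 2) q (2 * p * q)) dV0).
rewrite !det_mulmx det_h det_G det_nm det_u detZ (sqr_sqrtr (ltW dV0)) !mul1r mulr1 => ->.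
rewrite cv2_rv2 scale_mx2 invrK mx2N add_mx2 det_mx2.
rewrite !(mul1r, mul0r, mulr0, oppr0, addr0) ![d * (_ / d)]mulrC !divfK//.
by rewrite (_ : _ - _ = d) ?mulVf// dE; ring.
Qed.

Lemma cubic_return : exists theta, [/\ cos theta = expR cubic_t * p,
  sin theta = expR cubic_t * q &
  G cubic_t *m cubic_g = nm (rotmx theta) *m cubic_g *m intmx R cubic_a].
Proof.
have [|theta _ [cE sE]] := @polar R (expR cubic_t * p) (expR cubic_t * q).
  by rewrite !exprMn -mulrDr expR_t norm_mu.
exists theta; split => //.
rewrite /cubic_a intmx_iblk intmx_irv2 intmx_icv2 intmx_icv2_irv2 /rotmx -cE -sE.
rewrite /G /nm /cubic_g !blkM expR_t2; set e := expR _.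
rewrite !(mul0mx, mulmx0, scaler0, add0r, addr0, mul1r, scale1r, mul_scalar_mx).
rewrite !(rv2_mx2, mx2_cv2, rv2_cv2, cv2_rv2, scale_rv2, scale_cv2, scale_mx2, mx2M,
  add_rv2, add_cv2, add_mx2).
rewrite [(0 : 'M[R]_1) _ _]mxE kappaV.
have kk : kappa ^+ 3 - kappa ^+ 2 = 1 by rewrite kappa3; ring.
congr blk.
- rewrite !(mulr1z, mulrN1z, mulr0z). field. done.
- congr rv2; rewrite !(mulr1z, mulrN1z, mulr0z).
    by transitivity ((kappa ^+ 3 - kappa ^+ 2) / d); [|rewrite kk]; field.
  by transitivity ((kappa ^+ 3 - kappa ^+ 2) * kappa / d); [|rewrite kk]; field.
- congr cv2; rewrite !(mulr1z, mulrN1z, mulr0z).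
    by transitivity (e * (p ^+ 3 - 3 * p * q ^+ 2 - p ^+ 2 + q ^+ 2)); [rewrite re_mu3|]; ring.
  transitivity (e * ((3 * p ^+ 2 * q - q ^+ 3) - 2 * p * q)); last by ring.
  by rewrite im_mu3; ring.
- by congr mx2; rewrite !(mulr1z, mulrN1z, mulr0z); ring.
Qed.

Lemma det_cubic_a : \det cubic_a = 1.
Proof.
have [theta [_ _ /(congr1 determinant)]] := cubic_return.
rewrite !det_mulmx det_G det_nm det_rotmx cubic_det !mul1r => /esym.
exact: intmx_det_eq1.
Qed.

(** The elementary matrix that adds the first column to the second. *)
Definition cubic_gamma := iblk 1 (irv2 1 0) 0 1%:M.

Lemma det_cubic_gamma : \det cubic_gamma = 1.
Proof. by rewrite /cubic_gamma /iblk (@det_ublock _ 1 2) !det1. Qed.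

(** The second row of the inverse of cubic_g is (-2pq, v1, v2), and conjugating cubic_gamma
    by cubic_g adds to 1 the product of the first column of cubic_g with that row. *)
Let v1 := 2 * p * q / d.
Let v2 := (kappa ^+ 2 - p ^+ 2 + q ^+ 2) / d.
Let j := 1 - v1.

Let j1 : 1 < j.
Proof. by rewrite /j /v1 ltrDl oppr_gt0 pmulr_llt0 ?invr_gt0// pmulr_llt0// pmulr_rlt0. Qed.

Lemma cubic_sym :
  blk j (rv2 (v1 / d) (v2 / d)) (cv2 (- (2 * p * q)) 0) (mx2 (1 + v1) v2 0 1) *m cubic_g
  = cubic_g *m intmx R cubic_gamma.
Proof.
rewrite /cubic_gamma intmx_iblk intmx_irv2 /intmx map_mx0 map_mx1 /cubic_g !blkM.
rewrite !(mul0mx, mulmx0, scaler0, add0r, addr0, mulmx1, mulr1z, scale1r).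
rewrite !(rv2_mx2, mx2_cv2, rv2_cv2, cv2_rv2, scale_rv2, scale_cv2, scale_mx2, mx2M,
  add_rv2, add_cv2, add_mx2) mxE /j /v1 /v2.
have q2N0 : (kappa - p) ^+ 2 + q ^+ 2 != 0 by apply: contra_neq dN0 => dz; rewrite dE dz mulr0.
have qN0 : q != 0 by rewrite gt_eqF.
rewrite dE.
congr blk.
- by field; rewrite q2N0 qN0.
- by congr rv2; field; rewrite q2N0 qN0.
- by congr cv2; field; rewrite q2N0 qN0.
- by congr mx2; field; rewrite q2N0 qN0.
Qed.

Lemma cubic_kick : Num.sqrt j *: (mx2 (1 + v1) v2 0 1 -
    j^-1 *: (cv2 (- (2 * p * q)) 0 *m rv2 (v1 / d) (v2 / d))) =
  mx2 (Num.sqrt j)^-1 (v2 / Num.sqrt j) 0 (Num.sqrt j)^-1^-1.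
Proof.
have j0 : 0 < j by apply: lt_trans j1.
have jN0 : j != 0 by rewrite gt_eqF.
have sN0 : Num.sqrt j != 0 by rewrite gt_eqF// sqrtr_gt0.
have sE : Num.sqrt j * j^-1 = (Num.sqrt j)^-1.
  by apply: (mulfI sN0); rewrite mulrA -expr2 sqr_sqrtr ?ltW// !divff.
have -> : cv2 (- (2 * p * q)) 0 *m rv2 (v1 / d) (v2 / d) = mx2 (- v1 * v1) (- v1 * v2) 0 0.
  by rewrite cv2_rv2 !mul0r; congr mx2; rewrite /v1; field.
rewrite scale_mx2 mx2N add_mx2 scale_mx2 !mulr0 oppr0 !addr0 mulr0 mulr1 invrK; congr mx2.
- by rewrite -sE; congr (_ * _); rewrite /j; field.
- by rewrite -sE [RHS]mulrCA; congr (_ * _); rewrite /j; field.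
Qed.

(** The upper left entry of the inverse of cubic_g. *)
Let e := q * (p ^+ 2 + q ^+ 2).

Let e0 : 0 < e.
Proof. by rewrite mulr_gt0// ltr_wpDl ?sqr_ge0// exprn_gt0. Qed.

Lemma cubic_unit : cubic_g \in unitmx.
Proof. by rewrite unitmxE cubic_det unitr1. Qed.

Lemma cubic_inv : exists w z n, invmx cubic_g = blk e w z n.
Proof.
set X := invmx _; 
suff -> : e = @ulsubmx R 1 2 1 2 X 0 0 by do 3!eexists; exact: blkP.
have qN0 : q != 0 by rewrite gt_eqF.
have : cubic_g *m blk e 0 (cv2 (- (2 * p * q)) q) 0 = blk 1 0 0 0.
  rewrite /cubic_g !blkM rv2_cv2 mx2_cv2 scale_cv2 add_cv2 !(mulmx0, addr0, scaler0).
  congr blk; last by apply/colP => i; rewrite !mxE /e; case: ifP => _; ring.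
  rewrite /e dE; field; rewrite qN0 andbT; apply: contra_neq dN0 => dz.
  by rewrite dE dz mulr0.
move/(congr1 (mulmx X)); rewrite mulmxA mulVmx ?cubic_unit// mul1mx.
rewrite [in RHS](blkP X) !blkM => /blk_inj[-> _ _ _].
by rewrite mulr1 mulmx0 [X in _ + X]mxE addr0.
Qed.

(** Applied to the inverse of cubic_g, upper_factor says that the orbit of some h_x Z^3
    passes through a displaced copy of the lattice of cubic_g, up to a contracted factor. *)
Lemma cubic_start (Q : quasi_periodic R) : qp_g Q = cubic_g -> exists s, valid Q s.
Proof.
move=> gE; have [w [z [n XE]]] := cubic_inv.
have /(congr1 (fun A => A *m cubic_g)) := upper_factor w z n e0.
rewrite -XE -mulmxA mulVmx ?cubic_unit// mulmx1 => hE.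
set x0 := _ *: z in hE; set n0 := _ *: _ in hE; set w0 := _ *: w in hE.
have E : G (ln e / 2) *m h x0 = nm n0 *m u w0 *m cubic_g.
  by rewrite hE !mulmxA -GD subrr G0 mul1mx.
exists (State x0 (ln e / 2) w0 n0); split; last by apply: same_eq; rewrite gE.
by move: E => /(congr1 determinant); rewrite !det_mulmx det_G det_h det_nm det_u cubic_det !mulr1.
Qed.

(** If a power of the rotation were trivial, the time G t would be an integer matrix in the
    basis cubic_g; two entries of its first row would then be proportional to kappa and
    kappa^2, and kappa would be rational. *)
Lemma cubic_irrational (Q : quasi_periodic R) : qp_g Q = cubic_g ->
  forall k (l : int), (0 < k)%N -> k%:R * qp_theta Q != l%:~R * (2 * pi).
Proof.
move=> gE k l k0; apply/eqP => kl.
have spin1 : spin Q k = 1%:M.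
  by rewrite /spin rotmxX kl -[_ * _]add0r rot_periodic rotmx0.
have [C _] := G_return Q k.
rewrite spin1 nm1 mul1mx gE => /(congr1 (mulmx (invmx cubic_g))).
rewrite [RHS]mulmxA mulVmx ?cubic_unit// mul1mx.
have [b [z [n XE]]] := cubic_inv; rewrite XE.
have := mulVmx cubic_unit; rewrite XE /G /cubic_g -blk1.
set t := k%:R * _; set w := rv2 _ _; set m := mx2 _ _ _ _.
move=> XgE; rewrite blkM in XgE; have [_ bE _ _] := blk_inj XgE.
rewrite !blkM [intmx R C]blkP => /blk_inj[_ + _ _].
pose delta := expR (- (2 * t)) - expR t.
rewrite !(mul0mx, mul_scalar_mx, addr0, add0r) -scalemxAr.
have -> : b *m m = - (e *: w) by apply/eqP; rewrite -addr_eq0 addrC bE.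
move/rowP => uC.
have t0 : 0 < t by rewrite mulr_gt0 ?ltr0n// qp_t_gt0.
have delta0 : delta != 0 by rewrite subr_eq0 lt_eqF// ltr_expR; lra.
have wC i : e * delta * w 0 i = (C (@lshift 1 2 0) (@rshift 1 2 i))%:~R.
  have := uC i; rewrite !mxE => <-; rewrite /delta; ring.
have := wC 1; have := wC 0; rewrite !mxE /=.
set m1 := C _ _; set m2 := C _ _ => m1E m2E.
have m21 : m2%:~R = kappa * m1%:~R by rewrite -m1E -m2E; ring.
have m1N0 : m1 != 0.
  have eN0 : e != 0 by rewrite gt_eqF.
  by rewrite -(@intr_eq0 R) -m1E (mulf_neq0 (mulf_neq0 eN0 delta0))// mulf_neq0 ?invr_eq0.
apply: (@cubic_no_nat_root `|m2|%N `|m1|%N); first by rewrite absz_gt0.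
apply/eqP; rewrite -(@eqr_nat R) natrD natrM !natrX !natr_absz !intr_norm m21 normrM.
rewrite (gtr0_norm kappa0) exprMn kappa3; apply/eqP; ring.
Qed.

Lemma cubic_quasi_periodic : exists (Q : quasi_periodic R) (mu beta : R),
  [/\ 0 < mu < 1, kick Q = mx2 mu beta 0 mu^-1,
    forall k (l : int), (0 < k)%N -> k%:R * qp_theta Q != l%:~R * (2 * pi) &
    exists s, valid Q s].
Proof.
have [theta [_ _ ret]] := cubic_return.
have t0 : 0 < cubic_t by rewrite divr_gt0// ln_gt0//; case/andP: kappa1.
have j0 : 0 < j by apply: lt_trans j1.
pose Q := QuasiPeriodic cubic_det det_cubic_a t0 ret det_cubic_gamma j0 cubic_sym.
exists Q, (Num.sqrt j)^-1, (v2 / Num.sqrt j); split.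
- by rewrite invr_gt0 sqrtr_gt0 j0 invf_lt1 ?sqrtr_gt0// -sqrtr1 ltr_sqrt.
- exact: cubic_kick.
- exact: cubic_irrational.
- exact: cubic_start.
Qed.

End CubicLattice.

Section Existence.
Variable R : realType.

Let poly_continuous : continuous (fun x : R => x ^+ 3 - x ^+ 2 - 1).
Proof.
move=> x; apply: cvgB; last exact: cvg_cst.
by apply: cvgB; [exact: exprn_continuous|exact: exprn_continuous].
Qed.

Lemma quasi_periodic_exists : exists (Q : quasi_periodic R) (mu beta : R),
  [/\ 0 < mu < 1, kick Q = mx2 mu beta 0 mu^-1,
    forall k (l : int), (0 < k)%N -> k%:R * qp_theta Q != l%:~R * (2 * pi) &
    exists s, valid Q s].
Proof.
have [|||kappa + k3] := @IVT R (fun x => x ^+ 3 - x ^+ 2 - 1) 1 2 0.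
- by rewrite ler1n.
- exact: continuous_subspaceT.
- by rewrite ge_min le_max; apply/andP; split; apply/orP; [left|right]; lra.
rewrite in_itv /= => /andP[k1 k2].
have k12 : 1 < kappa < 2.
  rewrite !lt_neqAle k1 k2 !andbT eq_sym.
  by apply/andP; split; apply/eqP => kE; move: k3; rewrite kE; lra.
have kk : kappa ^+ 2 * (kappa - 1) = 1 by rewrite mulrBr -exprSr mulr1; lra.
pose p := (1 - kappa) / 2.
have r0 : 0 < kappa ^+ 2 - kappa - p ^+ 2 by rewrite /p; case/andP: k12 => *; nra.
apply: (@cubic_quasi_periodic R kappa p (Num.sqrt (kappa ^+ 2 - kappa - p ^+ 2)) _) => //.
- by lra.
- by rewrite sqrtr_gt0.
- by rewrite sqr_sqrtr// ltW.
Qed.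

End Existence.

(** * From limit bounds to the spectrum *)

Lemma limsup_heightE (R : realType) (F : lattice_space 3 R -> R) x s :
  limsup_height (hgt F) x s ->
  limf_esup (fun t => (F (lattice (flow t * horo x)%g))%:E) +oo = s%:E.
Proof.
move=> [upper lower].
have fE t : F (lattice (flow t * horo x)%g) = hgt F (G t *m h x).
  rewrite -flowE /hgt; congr (F (lattice _)); apply/val_inj/esym; apply: SLval_to_SL.
  by rewrite det_mulmx flowE det_G det_h mulr1.
rewrite /limf_esup; apply/eqP; rewrite eq_le; apply/andP; split.
  apply/lee_addgt0Pr => e e0; have [T0 T0P] := upper e e0.
  apply: ge_ereal_inf.
  exists (ereal_sup
    [set (F (lattice (flow t * horo x)%g))%:E | t in [set t | T0 <= t]]).
    by exists [set t | T0 <= t] => //; exact: nbhs_pinfty_ge (num_real T0).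
  by apply/ereal_supP => _ [t /= Tt <-]; rewrite fE -EFinD lee_fin T0P.
apply/ereal_infP => _ [V [T0 [T0r T0V]] <-].
apply/lee_addgt0Pr => e e0; have [T TT sT] := lower e e0 (T0 + 1).
rewrite -leeBlDr//; apply: ereal_sup_ge.
exists (F (lattice (flow T * horo x)%g))%:E.
  by exists T => //; apply: T0V; rewrite (lt_le_trans _ TT)// ltrDl.
by rewrite fE -EFinB lee_fin ltW.
Qed.


Theorem theorem1p4 (R : realType) (F : lattice_space 3 R -> R) (hF : height_function F) :
  exists T : R, 0 < T /\
    [set s%:E | s in [set s : R | T < s]] `<=` limsup_spectrum F.
Proof.
have [Q [mu [beta [/andP[mu0 mu1] kickE irr [s0 s0V]]]]] := quasi_periodic_exists R.
have [phi W2] := quarter_turn beta mu0; rewrite -kickE in W2.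
pose W := kick Q *m rotmx phi.
have dW : \det W = 1 by rewrite det_mulmx det_kick det_rotmx mulr1.
exists (Num.max 1 (star_height Q (hgt F) W 1%:M)); split; first by rewrite lt_max ltr01.
move=> _ [s /= + <-]; rewrite gt_max => /andP[_ sT].
have [m [dm star1 star2 top]] := target_exists (@hgt_lattice_invariant R F) (hgt_unif_continuous hF)
  (hgt_bounded hF) (hgt_proper hF) dW sT.
have [x xs] := steering_limsup (@hgt_lattice_invariant R F) (hgt_unif_continuous hF)
  (hgt_bounded hF) irr mu0 mu1 kickE W2 dm star1 star2 s0V top.
by exists x => //; exact: limsup_heightE.
Qed.
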